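(* Let $\{Z_n:n\ge1\}$ be a sequence of i.i.d. random variables, with $Z$ denoting a random variable having their common law, whose tails are regularly varying with index $1<\alpha<2$, that is, $\mathbb P(|Z|>x)\sim x^{-\alpha}L(x)$ as $x\to\infty$ for some function $L$ slowly varying at infinity, and satisfying $\mathbb E Z_1=0$. Assume there exist $p,q\in[0,1]$ such that $$\frac{\mathbb P(Z>x)}{\mathbb P(|Z|>x)}\to p,\qquad \frac{\mathbb P(Z<-x)}{\mathbb P(|Z|>x)}\to q,\qquad x\to\infty.$$ Let $\{t_n:n\ge1\}$ be a sequence of positive, integer-valued random variables. Suppose there exist a sequence of positive integers $\{b_n\}$ and a positive constant $c$ such that $t_n/b_n\to c$ in probability and $b_n\to\infty$. Define $S_n=\sum_{i=1}^nZ_i$. Then, as $n\to\infty$, $$\frac{S_{t_n}}{a_{t_n}}\ \stackrel{d}{\longrightarrow}\ S_\alpha(\rho,0),$$ where $\{a_n\}$ is a sequence satisfying $n a_n^{-\alpha}L(a_n)\to1$, $\rho=p-q$, and $S_\alpha(\rho,0)$ is an $\alpha$-stable random variable with characteristic function $$\exp\left(-|t|^\alpha\,\Gamma(1-\alpha)\cos\frac{\pi\alpha}{2}\left(1+\mathrm i\rho\,\mathrm{sgn}(t)\tan\frac{\pi\alpha}{2}\right)\right).$$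
   Context: A slowly varying function at infinity is a positive measurable $L$ with $L(\lambda x)/L(x)\to1$ as $x\to\infty$ for every $\lambda>0$. $f\sim g$ means $f/g\to1$. $\Gamma$ is the Gamma function (on $\mathbb R\setminus\{0,-1,-2,\dots\}$); $\mathrm{sgn}(t)=1,-1,0$ according as $t>0$, $t<0$, $t=0$. $\stackrel{d}{\longrightarrow}$ denotes convergence in distribution.
   Formalization: The limit's characteristic function has 1 − iρ sgn(t) tan(πα/2) instead of 1 + iρ sgn(t) tan(πα/2), which is false for ρ ≠ 0 with E exp(itX); and a_n → ∞ is assumed, since na_n^{-α}L(a_n) → 1 alone allows bounded a_n. *)

(* Defs.v *)
From HB Require Import structures.
From mathcomp Require Import all_boot all_order all_algebra.
From mathcomp Require Import all_classical all_reals all_analysis.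
From mathcomp Require Export complex.
Import Order.TTheory GRing.Theory Num.Theory.
Import numFieldNormedType.Exports.

Set Implicit Arguments.
Unset Strict Implicit.
Unset Printing Implicit Defensive.

Local Open Scope classical_set_scope.
Local Open Scope ring_scope.

(* Euler's integral only converges for 0 < x; elsewhere the functional equation
   Gamma (x + 1) = x * Gamma x is used.  With k the least natural number such
   that 0 < x + k, this gives the usual extension to the reals outside
   {0, -1, -2, ...}; at these poles the value is irrelevant. *)
Definition Gamma_integral {R : realType} (x : R) : R :=
  \int[lebesgue_measure]_(u in `]0, +oo[) (u `^ (x - 1) * expR (- u)).

Definition Gamma {R : realType} (x : R) : R :=
  let k := if 0 < x then 0%N else (Num.truncn (- x)).+1 in
  Gamma_integral (x + k%:R) / \prod_(i < k) (x + i%:R).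

Definition cexp {R : realType} (z : R[i]) : R[i] :=
  let: (x +i* y)%C := z in (expR x * cos y +i* (expR x * sin y))%C.

(* The convention is E[exp(i t X)]. *)
Definition charfun d (T : measurableType d) (R : realType)
    (P : probability T R) (X : {RV P >-> R}) (t : R) : R[i] :=
  (fine 'E_P[fun w => cos (t * X w)] +i* fine 'E_P[fun w => sin (t * X w)])%C.

(* Characteristic function of the stable law S_alpha(rho, 0), 1 < alpha < 2.
   The sign in front of i rho sgn(t) tan(pi alpha / 2) is the one of a law that
   is skewed to the right for rho > 0.  Indeed, if p = 1 and q = 0 then the
   log-characteristic function of the limit at t > 0 has imaginary part
     \int_0^oo (sin (t x) - t x) alpha x^(- alpha - 1) dx < 0,
   while Gamma (1 - alpha) * cos (pi alpha / 2) > 0 > tan (pi alpha / 2).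
   With the opposite sign, which is found in part of the literature, one gets
   the characteristic function of the reflected law S_alpha(- rho, 0). *)
Definition stable_charfun {R : realType} (alpha rho t : R) : R[i] :=
  cexp (- (`|t| `^ alpha * Gamma (1 - alpha) * cos (pi * alpha / 2))%:C%C *
        (1 - 'i%C * (rho * Num.sg t * tan (pi * alpha / 2))%:C%C)).

Definition slowly_varying {R : realType} (L : R -> R) : Prop :=
  [/\ measurable_fun (`]0, +oo[ : set R) L,
      forall x, 0 < x -> 0 < L x
    & forall lambda, 0 < lambda ->
        L (lambda * x) / L x @[x --> +oo] --> (1 : R)].

Definition mutually_independent d (T : measurableType d) (R : realType)
    (P : probability T R) (Z : nat -> {RV P >-> R}) : Prop :=
  forall (J : seq nat) (B : nat -> set R), uniq J ->
    (forall j, j \in J -> measurable (B j)) ->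
    P (\bigcap_(j in [set` J]) (Z j @^-1` B j)) =
    (\prod_(j <- J) fine (P (Z j @^-1` B j)))%:E.

Definition identically_distributed d (T : measurableType d) (R : realType)
    (P : probability T R) (Z : nat -> {RV P >-> R}) : Prop :=
  forall (i j : nat) (B : set R), measurable B ->
    distribution P (Z i) B = distribution P (Z j) B.

Definition cvg_in_probability d (T : measurableType d) (R : realType)
    (P : probability T R) (X : nat -> T -> R) (c : R) : Prop :=
  forall eps : R, 0 < eps ->
    P [set w | eps < `|X n w - c|] @[n --> \oo] --> 0%E.

Definition cvg_in_distribution d (T : measurableType d) (R : realType)
    (P : probability T R) (X : nat -> T -> R)
    d' (T' : measurableType d') (P' : probability T' R) (Y : {RV P' >-> R}) :
    Prop :=
  forall f : R -> R, continuous f -> (exists M, forall x, `|f x| <= M) ->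
    ('E_P[f \o X n])%E @[n --> \oo] --> ('E_P'[f \o Y])%E.

(* With Z indexed from 0, partial_sum Z n is the sum of the first n terms. *)
Definition partial_sum d (T : measurableType d) (R : realType)
    (P : probability T R) (Z : nat -> {RV P >-> R}) (n : nat) (w : T) : R :=
  \sum_(i < n) Z i w.

(* Main.v *)
Require Import Defs.
From mathcomp Require Import all_boot all_order all_algebra.
From mathcomp Require Import all_classical all_reals all_analysis.
From mathcomp Require Import measurable_realfun lebesgue_integral_under.
From mathcomp Require Import ring lra.
Import Order.TTheory GRing.Theory Num.Theory.
Import numFieldNormedType.Exports.

(** The normalized sums S_n / a_n converge to the stable law, and the random
    index t_n may be replaced by the deterministic index m_n, the integer part
    of c b_n. Both facts rest on the tail H x = P (|Z| > x), which is regularly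
    varying of index - alpha, and on Potter's bound [potter_bound] for it:
    beyond some x0 the ratio H (u x) / H x, multiplied by min 1 u, is at most a
    multiple of a function of u that is integrable on the half-line. Here
    1 < alpha < 2 is what makes min 1 u * u ^ (- alpha) integrable at both ends.

    Stable limit. For a nonnegative variable V and F with F 0 = 0 the layer
    cake formula reads E F(V) = int F'(u) P (V > u) du. For V = s Z+ / a_n and
    V = s Z- / a_n, and for F = cos - 1 and F = sin - id, the rescaled tails
    n P (V > u) converge to p s^alpha u^(- alpha) and q s^alpha u^(- alpha), and
    Potter's bound lets dominated convergence act ([tail_integral_cvg]). The
    limits are given by the integrals of sin u * u^(- alpha) and of
    (cos u - 1) * u^(- alpha), equal to Gamma (1 - alpha) times
    cos (pi alpha / 2) and sin (pi alpha / 2); they are found by rotating the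
    half-line of integration of Euler's integral ([rotation_solution]). Since
    E Z = 0, this expands the characteristic function phi of Z at s / a_n up to
    o(1 / n) ([charfun_expansion]), and phi (s / a_n) ^ n converges
    ([cvg_expn_cexp], [normalized_sum_charfun_cvg]).

    Random index. The maximal inequality [partial_sum_maximal] bounds
    P (max_(k <= N) |S_k| >= y) by a constant times N H y: truncate the
    summands at y, apply Kolmogorov's inequality to the centred truncated
    summands, and estimate their mean and variance by Potter's bound. Because
    m H (x a_m) converges for every x, this shows that S_m / a_m is tight and
    that S_k - S_m is small with respect to a_m, uniformly in |k - m| <= delta m
    for small delta. Moreover a_k / a_m is close to 1 for such k, by the
    monotonicity of H ([norming_ratio]). As t_n / m_n tends to 1 in
    probability, S_(t_n) / a_(t_n) and S_(m_n) / a_(m_n) get close in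
    probability ([random_index_close]), so that their characteristic functions
    have the same limits.

    Finally, convergence of characteristic functions to the one of a given
    random variable implies convergence in distribution ([levy_continuity]).
    The function exp (- sigma |s|) has the Cauchy density as its Fourier
    transform, hence the mean of a Poisson integral of a continuous function is
    expressed by characteristic functions; Poisson integrals approximate
    compactly supported functions uniformly, and a cutoff reduces bounded
    functions to these. *)

Set Implicit Arguments.
Unset Strict Implicit.
Unset Printing Implicit Defensive.

Local Open Scope classical_set_scope.
Local Open Scope ring_scope.

(** * Dominated convergence and Fubini for real-valued integrals *)

Section Rintegral_tools.
Context {R : realType} {d : measure_display} {T : measurableType d}.
Implicit Types (mu : {measure set T -> \bar R}) (D : set T) (f g : T -> R).

Lemma Rintegral_EFin mu D f : measurable D -> mu.-integrable D (EFin \o f) ->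
  (\int[mu]_(x in D) (f x)%:E)%E = (\int[mu]_(x in D) f x)%:E.
Proof. by move=> mD If; rewrite /Rintegral fineK//; exact: integrable_fin_num. Qed.

Lemma Rintegrable_measurable mu D f :
  mu.-integrable D (EFin \o f) -> measurable_fun D f.
Proof. by move=> /integrableP[/measurable_EFinP]. Qed.

Lemma RintegrableZl mu D k f : measurable D -> mu.-integrable D (EFin \o f) ->
  mu.-integrable D (EFin \o (fun x => k * f x)).
Proof. by move=> mD If; exact: (integrableZl mD k If). Qed.

Lemma RintegrableD mu D f g : measurable D -> mu.-integrable D (EFin \o f) ->
  mu.-integrable D (EFin \o g) -> mu.-integrable D (EFin \o (fun x => f x + g x)).
Proof. by move=> mD If Ig; exact: (integrableD mD If Ig). Qed.

Lemma RintegrableB mu D f g : measurable D -> mu.-integrable D (EFin \o f) ->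
  mu.-integrable D (EFin \o g) -> mu.-integrable D (EFin \o (fun x => f x - g x)).
Proof. by move=> mD If Ig; exact: (integrableB mD If Ig). Qed.

Lemma le_Rintegrable mu D f g : measurable D -> measurable_fun D f ->
  mu.-integrable D (EFin \o g) -> (forall x, D x -> `|f x| <= g x) ->
  mu.-integrable D (EFin \o f).
Proof.
move=> mD mf Ig fg; apply: (le_integrable mD _ _ Ig).
  exact/measurable_EFinP.
move=> x Dx; rewrite /= lee_fin (le_trans (fg _ Dx))//.
exact: ler_norm.
Qed.

(** Stated for real-valued integrals, in which all the limits below are taken. *)
Lemma Rintegral_dominated mu D (f_ : nat -> T -> R) f g : measurable D ->
  (forall n, measurable_fun D (f_ n)) ->
  (forall x, D x -> f_ n x @[n --> \oo] --> f x) ->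
  mu.-integrable D (EFin \o g) ->
  (forall n x, D x -> `|f_ n x| <= g x) ->
  mu.-integrable D (EFin \o f) /\
  \int[mu]_(x in D) f_ n x @[n --> \oo] --> \int[mu]_(x in D) f x.
Proof.
move=> mD mf_ f_f Ig f_g.
have mf : measurable_fun D f.
  apply: (measurable_fun_cvg (h := f_)) => // x Dx; exact: f_f.
have mEf_ n : measurable_fun D (EFin \o f_ n) by exact/measurable_EFinP.
have mEf : measurable_fun D (EFin \o f) by exact/measurable_EFinP.
have f_fE : {ae mu, forall x, D x -> (EFin \o f_ n) x @[n --> \oo] --> (EFin \o f) x}.
  by apply: aeW => x Dx; apply: cvg_EFin; [exact: nearW|exact: f_f].
have f_gE : {ae mu, forall x n, D x -> (`|(EFin \o f_ n) x| <= (EFin \o g) x)%E}.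
  by apply: aeW => x n Dx; rewrite /= lee_fin; exact: f_g.
have [If _ cf] := dominated_convergence mD mEf_ mEf f_fE Ig f_gE.
split=> //; apply: fine_cvg.
by rewrite -[\int[mu]_(x in D) f x]/(fine _) fineK //; exact: integrable_fin_num.
Qed.

End Rintegral_tools.

Section Fubini_real.
Context {R : realType} {d1 d2 : measure_display}
  {T1 : measurableType d1} {T2 : measurableType d2}.
Context (m1 : {sigma_finite_measure set T1 -> \bar R})
          (m2 : {sigma_finite_measure set T2 -> \bar R}).

(** Finiteness of one iterated integral of the absolute value gives
    integrability on the product, from which the three conclusions follow. *)
Lemma Rintegral_Fubini (f : T1 -> T2 -> R) :
  measurable_fun setT (fun z : T1 * T2 => f z.1 z.2) ->
  (forall x, m2.-integrable setT (EFin \o f x)) ->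
  (forall y, m1.-integrable setT (EFin \o f ^~ y)) ->
  (\int[m2]_y \int[m1]_x (`|f x y|)%:E < +oo)%E ->
  [/\ m1.-integrable setT (fun x => (\int[m2]_y f x y)%:E),
      m2.-integrable setT (fun y => (\int[m1]_x f x y)%:E) &
      \int[m1]_x \int[m2]_y f x y = \int[m2]_y \int[m1]_x f x y].
Proof.
move=> mf If2 If1 fin.
have mEf : measurable_fun setT (fun z : T1 * T2 => (f z.1 z.2)%:E).
  exact/measurable_EFinP.
have imf : (m1 \x m2)%E.-integrable setT (fun z : T1 * T2 => (f z.1 z.2)%:E).
  by apply: (integrable21ltyP m1 m2 mEf).2; exact: fin.
have E1 : (fun x => (\int[m2]_y f x y)%:E) = fubini_F m2 (fun z : T1 * T2 => (f z.1 z.2)%:E).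
  by apply/funext => x; rewrite -Rintegral_EFin.
have E2 : (fun y => (\int[m1]_x f x y)%:E) = fubini_G m1 (fun z : T1 * T2 => (f z.1 z.2)%:E).
  by apply/funext => x; rewrite -Rintegral_EFin//; exact: If1.
split.
- by rewrite E1; exact: integrable_fubini_F.
- rewrite E2; apply/integrableP; split; first exact: (measurable_fubini_G imf).
  apply: le_lt_trans fin; apply: ge0_le_integral => //.
  + apply: measurableT_comp => //; exact: (measurable_fubini_G imf).
  + apply: (measurable_fun_fubini_tonelli_G
      (fun z : T1 * T2 => (`|f z.1 z.2|)%:E)) => //=.
    apply/measurable_EFinP; exact: measurableT_comp.
  + move=> y _; apply: le_abse_integral => //.
    exact: (measurable_int _ (If1 y)).
- by rewrite /Rintegral; congr fine; rewrite E1 E2; exact: (Fubini imf).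
Qed.

End Fubini_real.

(** * Improper integrals on the half-line *)

Section improper.
Context {R : realType}.
Notation mu := (@lebesgue_measure R).
Local Notation halfline := (`]0, +oo[%classic : set R).
Implicit Types (F f : R -> R).

Lemma harmonic_at_right0 : (@harmonic R) @ \oo --> 0^'+.
Proof.
move=> U [e /= e0 eU].
have /cvgrPdist_lt/(_ _ e0) := @cvg_harmonic R.
apply: filterS => n; rewrite sub0r normrN => h.
by apply: eU; rewrite /= ?sub0r ?normrN// /harmonic/= invr_gt0.
Qed.

Lemma natS_cvgy : n.+1%:R @[n --> \oo] --> (+oo : set_system R).
Proof.
have h : (fun n => n%:R : R) n @[n --> \oo] --> +oo by exact: cvgr_idn.
by rewrite -(cvg_shiftS (fun n => n%:R : R)) in h.
Qed.

(** A form of the fundamental theorem of calculus whose hypotheses are pointwise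
    on the closed segment, where all functions below are differentiable. *)
Lemma FTC2_derive F f (a b : R) : a < b ->
  (forall x : R, a <= x <= b -> is_derive x 1 F (f x)) ->
  (forall x : R, a <= x <= b -> {for x, continuous f}) ->
  mu.-integrable `[a, b] (EFin \o f) /\
  \int[mu]_(x in `[a, b]) f x = F b - F a.
Proof.
move=> ab dF cf.
have wcf : {within `[a, b], continuous f}.
  apply/continuous_within_itvP => //; split.
  - by move=> x; rewrite in_itv/= => /andP[ax xb]; apply: cf; rewrite !ltW.
  - by apply: cvg_at_right_filter; apply: cf; rewrite lexx ltW.
  - by apply: cvg_at_left_filter; apply: cf; rewrite lexx ltW.
have cF x : a <= x <= b -> {for x, continuous F}.
  move=> xab; have [dFx _] := dF x xab.
  exact/differentiable_continuous/derivable1_diffP.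
split.
  by apply: continuous_compact_integrable => //; exact: segment_compact.
rewrite /Rintegral (@continuous_FTC2 _ f F a b)//.
  split.
  - by move=> x; rewrite in_itv/= => /andP[ax xb]; case: (dF x); rewrite ?ltW.
  - by apply: cvg_at_right_filter; apply: cF; rewrite lexx ltW.
  - by apply: cvg_at_left_filter; apply: cF; rewrite lexx ltW.
move=> x; rewrite in_itv/= => /andP[ax xb].
by rewrite derive1E; case: (dF x) => //; rewrite !ltW.
Qed.

Let I n : set R := `[n.+2%:R^-1, n.+2%:R]%classic.

Let mI n : measurable (I n). Proof. exact: measurable_itv. Qed.

Let Ioo n : I n `<=` halfline.
Proof.
move=> x; rewrite /I/= !in_itv/= => /andP[nx xn]; rewrite andbT.
by rewrite (lt_le_trans _ nx)// invr_gt0.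
Qed.

Let Ilt n : n.+2%:R^-1 < n.+2%:R :> R.
Proof.
by rewrite (@lt_trans _ _ 1)// ?ltr1n// invf_lt1// ltr1n.
Qed.

Let I_near (x : R) : 0 < x -> \forall n \near \oo, I n x.
Proof.
move=> x0; near=> n; rewrite /I/= in_itv/=; apply/andP; split.
- rewrite invf_ple ?posrE//.
  rewrite (@le_trans _ _ n%:R)// ?ler_nat//; last by apply: (leq_trans (leqnSn _)).
  by near: n; exact: nbhs_infty_ger.
- rewrite (@le_trans _ _ n%:R)// ?ler_nat//; last by apply: (leq_trans (leqnSn _)).
  by near: n; exact: nbhs_infty_ger.
Unshelve. all: by end_near. Qed.

Let I_int F f n : (forall x : R, 0 < x -> is_derive x 1 F (f x)) ->
  (forall x : R, 0 < x -> {for x, continuous f}) ->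
  mu.-integrable (I n) (EFin \o f) /\
  \int[mu]_(x in I n) f x = F n.+2%:R - F n.+2%:R^-1.
Proof.
move=> dF cf; apply: FTC2_derive => //.
- by move=> x /andP[nx xn]; apply: dF; rewrite (lt_le_trans _ nx)// invr_gt0.
- by move=> x /andP[nx xn]; apply: cf; rewrite (lt_le_trans _ nx)// invr_gt0.
Qed.

Let cvgf f (x : R) : 0 < x -> (f \_ (I n)) x @[n --> \oo] --> f x.
Proof.
move=> x0; apply: cvg_near_cst; near=> n.
by rewrite patchE mem_set//; near: n; exact: I_near.
Unshelve. all: by end_near. Qed.

Lemma continuous_oy_measurable f : (forall x : R, 0 < x -> {for x, continuous f}) ->
  measurable_fun halfline f.
Proof.
move=> cf; apply: open_continuous_measurable_fun => //.
by move=> x; rewrite inE/= in_itv/= andbT => /cf.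
Qed.

(** The half-line is exhausted by the segments [1/n, n], on which the
    classical fundamental theorem of calculus applies. *)
Lemma improper_FTC2 F f (l0 l1 : R) :
  (forall x : R, 0 < x -> is_derive x 1 F (f x)) ->
  (forall x : R, 0 < x -> {for x, continuous f}) ->
  mu.-integrable halfline (EFin \o f) ->
  F x @[x --> 0^'+] --> l0 -> F x @[x --> +oo] --> l1 ->
  \int[mu]_(x in halfline) f x = l1 - l0.
Proof.
move=> dF cf If F0 Fy.
have mf := Rintegrable_measurable If.
have Iabs : mu.-integrable halfline (EFin \o (fun x => `|f x|)).
  exact: integrable_norm.
have [//|n|x|n x _|_] := @Rintegral_dominated _ _ _ mu halfline
    (fun n => f \_ (I n)) f _ _ _ _ Iabs.
- apply: (measurable_restrict _ (mI n) _).1 => //; apply: measurable_funS mf => //; exact: subIsetl.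
- by rewrite /= in_itv/= andbT => /cvgf.
- by rewrite patchE; case: ifPn => // _; rewrite normr0.
under eq_fun do rewrite -Rintegral_mkcondr setIidr//.
under eq_fun do rewrite (I_int _ dF cf).2.
move=> h1; rewrite -(cvg_lim _ h1)//; apply/cvg_lim => //; apply: cvgB.
- have h := natS_cvgy; rewrite -(cvg_shiftS (fun n => n.+1%:R : R)) in h.
  exact: cvg_comp h Fy.
- have h := harmonic_at_right0; rewrite -(cvg_shiftS (@harmonic R)) in h.
  exact: cvg_comp h F0.
Unshelve. all: by []. Qed.

(** By monotone convergence: the integral of a nonnegative function over a segment
    is a difference of two values of its bounded primitive. *)
Lemma ge0_improper_integrable F f (M : R) :
  (forall x : R, 0 < x -> is_derive x 1 F (f x)) ->
  (forall x : R, 0 < x -> {for x, continuous f}) ->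
  (forall x : R, 0 < x -> 0 <= f x) ->
  (forall x : R, 0 < x -> `|F x| <= M) ->
  mu.-integrable halfline (EFin \o f).
Proof.
move=> dF cf f0 FM.
have mf := continuous_oy_measurable cf.
apply/integrableP; split; first exact/measurable_EFinP.
rewrite (_ : (\int[mu]_(x in _) _)%E = (\int[mu]_(x in halfline) (f x)%:E)%E); last first.
  apply: eq_integral => x; rewrite inE/= in_itv/= andbT => x0.
  by rewrite /= ger0_norm// f0.
have h : (\int[mu]_(x in halfline) ((f \_ (I n)) x)%:E)%E @[n --> \oo] -->
   (\int[mu]_(x in halfline) (f x)%:E)%E.
  have -> : (\int[mu]_(x in halfline) (f x)%:E =
     \int[mu]_(x in halfline) limn (fun n => ((f \_ (I n)) x)%:E))%E.
    apply: eq_integral => x; rewrite inE/= in_itv/= andbT => x0.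
    by apply/esym/cvg_lim => //; apply: cvg_EFin; [exact: nearW|exact: cvgf].
  apply: cvg_monotone_convergence => //.
  - move=> n; apply/measurable_EFinP; apply: (measurable_restrict _ (mI n) _).1 => //.
    by apply: measurable_funS mf => //; exact: subIsetl.
  - move=> n x; rewrite /= in_itv/= andbT => x0.
    by rewrite lee_fin patchE; case: ifPn => // _; exact: f0.
  - move=> x; rewrite /= in_itv/= andbT => x0 m n mn; rewrite lee_fin !patchE.
    case: ifPn => // xm; last by case: ifPn => // _; exact: f0.
    rewrite ifT//; move: xm; rewrite !inE /I/= !in_itv/= => /andP[mx xm].
    apply/andP; split.
      by rewrite (le_trans _ mx)// lef_pV2 ?posrE// ler_nat !ltnS.
    by rewrite (le_trans xm)// ler_nat !ltnS.
apply: (@le_lt_trans _ _ (M + M)%:E); last by rewrite ltry.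
rewrite -(cvg_lim _ h)//; apply: lime_le; first by apply/cvg_ex; eexists; exact: h.
apply: nearW => n.
rewrite Rintegral_EFin//; last first.
  rewrite -restrict_EFin; apply/integrable_restrict => //; first exact: mI.
  by rewrite setIidr//; exact: (I_int _ dF cf).1.
rewrite -Rintegral_mkcondr setIidr// (I_int _ dF cf).2 lee_fin.
rewrite (le_trans (ler_norm _))// (le_trans (ler_normB _ _))//.
by rewrite lerD// FM// ?invr_gt0.
Qed.

End improper.

(** * Derivatives as relations between eta-expanded functions *)

Section pointwise_derivatives.
Context {R : realType}.
Implicit Types (f g : R -> R) (x df dg k : R).

(** Rules for functions with an explicit variable, rather than for pointwise
    combinations such as [f \+ g]: they unify with concrete expressions and compose
    into derivatives of formulas. *)
Lemma derivR_cst k x : is_derive x 1 (fun=> k) 0.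
Proof. exact: is_derive_cst. Qed.

Lemma derivR_id x : is_derive x 1 (fun y : R => y) 1.
Proof. exact: is_derive_id. Qed.

Lemma derivR_add f g x df dg : is_derive x 1 f df -> is_derive x 1 g dg ->
  is_derive x 1 (fun y => f y + g y) (df + dg).
Proof. by move=> hf hg; exact: is_deriveD. Qed.

Lemma derivR_opp f x df : is_derive x 1 f df -> is_derive x 1 (fun y => - f y) (- df).
Proof. by move=> hf; exact: is_deriveN. Qed.

Lemma derivR_sub f g x df dg : is_derive x 1 f df -> is_derive x 1 g dg ->
  is_derive x 1 (fun y => f y - g y) (df - dg).
Proof. by move=> hf hg; exact: is_deriveB. Qed.

Lemma derivR_mul f g x df dg : is_derive x 1 f df -> is_derive x 1 g dg ->
  is_derive x 1 (fun y => f y * g y) (f x * dg + g x * df).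
Proof. by move=> hf hg; exact: is_deriveM. Qed.

Lemma derivR_scale f k x df : is_derive x 1 f df ->
  is_derive x 1 (fun y => k * f y) (k * df).
Proof. by move=> hf; exact: is_deriveZ. Qed.

Lemma derivR_inv f x df : f x != 0 -> is_derive x 1 f df ->
  is_derive x 1 (fun y => (f y)^-1) (- df / f x ^+ 2).
Proof.
move=> fx0 hf; apply: (is_derive_eq (is_deriveV fx0 hf)).
by rewrite scaleNr mulNr mulrC.
Qed.

Lemma derivR_comp f g x df dg : is_derive (f x) 1 g dg -> is_derive x 1 f df ->
  is_derive x 1 (fun y => g (f y)) (dg * df).
Proof.
by move=> hg hf; exact: (is_derive1_comp hg hf).
Qed.

Lemma derivR_continuous f x df : is_derive x 1 f df -> {for x, continuous f}.
Proof. by move=> [h _]; exact/differentiable_continuous/derivable1_diffP. Qed.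

Lemma derivR_derive1 f x df : is_derive x 1 f df -> derive1 f x = df.
Proof. by move=> [_ h]; rewrite derive1E. Qed.

End pointwise_derivatives.

(** * An integrable majorant with two powers *)

Section power_kernels.
Context {R : realType}.
Notation mu := (@lebesgue_measure R).
Local Notation halfline := (`]0, +oo[%classic : set R).

Lemma powRDp (x r s : R) : 0 < x -> x `^ (r + s) = x `^ r * x `^ s.
Proof. by move=> x0; rewrite powRD//; apply/implyP => _; rewrite gt_eqF. Qed.

(** For small delta it dominates min 1 u * u ^ (- alpha), while it is integrable both
    at 0 and at infinity. *)
Definition two_power_kernel (delta x : R) : R :=
  if x < 1 then x `^ (delta - 1) else x `^ (- delta - 1).

Lemma two_power_kernel_gt0 delta x : 0 < x -> 0 < two_power_kernel delta x.
Proof. by move=> x0; rewrite /two_power_kernel; case: ifPn => _; exact: powR_gt0. Qed.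

Lemma measurable_two_power_kernel delta :
  measurable_fun halfline (two_power_kernel delta).
Proof.
apply: measurable_funTS; apply: measurable_fun_ifT => /=.
- exact: measurable_fun_ltr.
- exact: measurable_powR.
- exact: measurable_powR.
Qed.

(** Up to a constant the kernel is the derivative of the bounded function
    - 1 / (1 + x ^ delta). *)
Lemma integrable_two_power_kernel (delta : R) : 0 < delta ->
  mu.-integrable halfline (EFin \o two_power_kernel delta).
Proof.
move=> d0.
pose F (x : R) := - (1 + x `^ delta)^-1.
pose f (x : R) := delta * x `^ (delta - 1) * (1 + x `^ delta) ^- 2.
have Fpos (x : R) : 0 < 1 + x `^ delta by rewrite ltr_pwDl// powR_ge0.
have If : mu.-integrable halfline (EFin \o f).
  apply: (@ge0_improper_integrable _ F f 1).
  - move=> x x0; rewrite /F /f.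
    have h := derivR_add (derivR_cst 1 x) (is_derive1_powR delta x0).
    have nz : 1 + x `^ delta != 0 by rewrite gt_eqF.
    apply: (is_derive_eq (derivR_opp (derivR_inv (f := fun y => 1 + y `^ delta) nz h))).
    by rewrite add0r mulNr opprK.
  - move=> x x0; have nz : (1 + x `^ delta) ^+ 2 != 0 by rewrite expf_neq0// gt_eqF.
    have h := derivR_add (derivR_cst 1 x) (is_derive1_powR delta x0).
    apply: continuousM; last apply: continuousV => //.
      exact: derivR_continuous (derivR_scale delta (is_derive1_powR _ x0)).
    exact: derivR_continuous (derivR_mul h h).
  - move=> x x0; rewrite /f mulr_ge0//; first by rewrite mulr_ge0 ?powR_ge0// ltW.
    by rewrite invr_ge0 exprn_ge0// ltW.
  - move=> x x0; rewrite /F normrN ger0_norm; last by rewrite invr_ge0 ltW.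
    by rewrite invf_le1// lerDl powR_ge0.
have one_powR : (1 : R) `^ delta = 1 by rewrite powR1.
have Ig : mu.-integrable halfline (EFin \o (fun x => 4 / delta * f x)).
  exact: RintegrableZl.
apply: (le_Rintegrable _ _ Ig) => //; first exact: measurable_two_power_kernel.
move=> x; rewrite /= in_itv/= andbT => x0.
rewrite ger0_norm; last by rewrite ltW// two_power_kernel_gt0.
(* The factor 4 / delta makes the derivative dominate the kernel, because
   1 + x ^ delta is at most twice the larger of its two terms. *)
have -> : 4 / delta * f x = x `^ (delta - 1) * (2 / (1 + x `^ delta)) ^+ 2.
  by rewrite /f; field; rewrite !gt_eqF.
rewrite /two_power_kernel; case: ltP => x1.
  rewrite ler_peMr ?powR_ge0// -[leLHS](expr1n _ 2) ler_sqr ?nnegrE ?divr_ge0 ?(ltW (Fpos _))//.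
  rewrite ler_pdivlMr// mul1r [leRHS](_ : 2 = 1 + 1)// lerD2l.
  by rewrite -one_powR ge0_ler_powR// ?nnegrE// ltW.
have -> : x `^ (- delta - 1) = x `^ (delta - 1) * (x `^ delta)^-1 ^+ 2.
  rewrite -powRN -powR_mulrn ?powR_ge0// -powRrM -powRDp//.
  by congr (_ `^ _); ring.
rewrite ler_wpM2l ?powR_ge0// ler_sqr ?nnegrE ?divr_ge0 ?invr_ge0 ?powR_ge0 ?(ltW (Fpos _))//.
have xd1 : 1 <= x `^ delta by rewrite -one_powR ge0_ler_powR// ?nnegrE// ltW.
rewrite ler_pdivlMr// mulrC ler_pdivrMr ?(lt_le_trans _ xd1)//.
by lra.
Qed.

Lemma integrable_two_power_kernelZ (k delta : R) : 0 < delta ->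
  mu.-integrable halfline (EFin \o (fun x => k * two_power_kernel delta x)).
Proof. by move=> d0; apply: RintegrableZl => //; exact: integrable_two_power_kernel. Qed.

End power_kernels.

(** * The integrals of sin x and cos x - 1 against a power *)

Section elementary_bounds.
Context {R : realType}.

Lemma MVT_derive (f df : R -> R) (a b : R) : a <= b ->
  (forall x : R, a <= x <= b -> is_derive x 1 f (df x)) ->
  exists2 c, a <= c <= b & f b - f a = df c * (b - a).
Proof.
move=> ab dF; have [| |c cab e] := @MVT_segment R f df a b ab.
- by move=> x; rewrite in_itv/= => /andP[ax xb]; apply: dF; rewrite !ltW.
- apply: derivable_within_continuous => x; rewrite in_itv/= => /dF.
  by case.
by exists c; rewrite // in_itv/= in cab.
Qed.

Lemma lipschitz_derive (f df : R -> R) : (forall x : R, is_derive x 1 f (df x)) ->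
  (forall x, `|df x| <= 1) -> forall x y, `|f x - f y| <= `|x - y|.
Proof.
move=> dF df1 x y; wlog yx : x y / y <= x.
  move=> h; have [|/ltW xy] := leP y x; first exact: h.
  by rewrite distrC (distrC x); exact: h.
have [c _ ->] := @MVT_derive f df y x yx (fun z _ => dF z).
by rewrite normrM ler_piMl.
Qed.

Lemma cos_lipschitz (x y : R) : `|cos x - cos y| <= `|x - y|.
Proof.
apply: (@lipschitz_derive cos (fun x => - sin x)) => z.
by rewrite normrN sin_max.
Qed.

Lemma sin_lipschitz (x y : R) : `|sin x - sin y| <= `|x - y|.
Proof. by apply: (@lipschitz_derive sin cos) => z; exact: cos_max. Qed.

Lemma ler_cos_norm (x y : R) : `|x| <= y -> y <= pi -> cos y <= cos x.
Proof.
move=> xy ypi; rewrite -(cos_norm x).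
have [->|xney] := eqVneq `|x| y; first by [].
rewrite ltW// ltr_cos ?in_itv/= ?normr_ge0 ?(le_trans xy)//.
  by rewrite lt_neqAle xney.
by rewrite ypi andbT (le_trans _ xy).
Qed.

Lemma expRN_bound (x : R) : 0 <= x -> 0 <= 1 - expR (- x) <= x.
Proof.
move=> x0; rewrite subr_ge0 expR_le1 oppr_le0 x0/=.
by have := expR_ge1Dx (- x); lra.
Qed.

Lemma expRN_le_inv (x : R) : 0 < x -> expR (- x) <= x^-1.
Proof.
move=> x0; rewrite expRN lef_pV2 ?posrE ?expR_gt0//.
by have := expR_ge1Dx x; lra.
Qed.

End elementary_bounds.

Section rotation.
Context {R : realType} (alpha : R).
Context (alpha1 : 1 < alpha) (alpha2 : alpha < 2).
Notation mu := (@lebesgue_measure R).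
Local Notation halfline := (`]0, +oo[%classic : set R).

(** The real part of exp (- x exp (- i theta) + i phi). It interpolates between
    the exponential of Euler's integral (theta = 0) and the trigonometric
    functions (theta = pi / 2); the phase phi gives access to real and imaginary
    parts with one real function. *)
Definition damped_cos (phi theta x : R) :=
  expR (- (x * cos theta)) * cos (x * sin theta + phi).

Let delta := Num.min (2 - alpha) (alpha - 1).

Let delta0 : 0 < delta. Proof. by rewrite /delta lt_min !subr_gt0 alpha1 alpha2. Qed.

(** Multiplication by - exp (- i theta), the derivative of the exponent in x,
    changes the sign and shifts the phase by - theta. *)
Lemma damped_cos_dx (phi theta x : R) :
  is_derive x 1 (damped_cos phi theta) (- damped_cos (phi - theta) theta x).
Proof.
rewrite /damped_cos.
have h1 := derivR_opp (derivR_mul (derivR_id x) (derivR_cst (cos theta) x)).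
have h2 := derivR_add (derivR_mul (derivR_id x) (derivR_cst (sin theta) x)) (derivR_cst phi x).
have h3 := derivR_mul (derivR_comp (is_derive_expR _) h1) (derivR_comp (is_derive_cos _) h2).
apply: (is_derive_eq h3).
rewrite addrA cosB/=; ring.
Qed.

(** The derivative of the exponent in theta is i x exp (- i theta), that is,
    x times the unit complex number with phase pi / 2 - theta. *)
Lemma damped_cos_dtheta (phi theta x : R) :
  is_derive theta 1 (fun th => damped_cos phi th x)
    (x * damped_cos (phi - theta + pi / 2) theta x).
Proof.
rewrite /damped_cos.
have h1 := derivR_opp (derivR_scale x (is_derive_cos theta)).
have h2 := derivR_add (derivR_scale x (is_derive_sin theta)) (derivR_cst phi theta).
have h3 := derivR_mul (derivR_comp (is_derive_expR _) h1) (derivR_comp (is_derive_cos _) h2).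
apply: (is_derive_eq h3).
rewrite !addrA cosDpihalf sinB/=; ring.
Qed.

Lemma damped_cos_bound (phi theta x : R) : 0 <= cos theta -> 0 < x ->
  `|damped_cos phi theta x| <= 1 /\
  `|damped_cos phi theta x - cos phi| <= Num.min (2 * x) 2.
Proof.
move=> c0 x0; have e1 : expR (- (x * cos theta)) <= 1.
  by rewrite expR_le1 oppr_le0 mulr_ge0// ltW.
have d1 : `|damped_cos phi theta x| <= 1.
  by rewrite normrM -[leRHS]mulr1 ler_pM// ?cos_max// ger0_norm ?expR_ge0.
split => //; rewrite le_min; apply/andP; split; last first.
  rewrite (le_trans (ler_normB _ _))// (_ : 2 = 1 + 1)// lerD//.
  exact: cos_max.
rewrite /damped_cos; set A := x * sin theta + phi; set e := expR _.
have -> : e * cos A - cos phi = - ((1 - e) * cos A) + (cos A - cos phi) by ring.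
rewrite (le_trans (ler_normD _ _))// mulr_natl mulr2n lerD//.
  rewrite normrN normrM -[leRHS]mulr1 ler_pM ?cos_max//.
  have /andP[a b] := expRN_bound (mulr_ge0 (ltW x0) c0).
  rewrite ger0_norm//; apply: (le_trans b).
  by rewrite ler_piMr ?cos_le1// ltW.
rewrite (le_trans (cos_lipschitz _ _))// /A addrK normrM gtr0_norm//.
by rewrite ler_piMr ?sin_max// ltW.
Qed.

Lemma continuous_damped_cos phi theta : continuous (damped_cos phi theta).
Proof. by move=> x; exact: derivR_continuous (damped_cos_dx _ _ _). Qed.

Lemma two_power_kernel_ge_small (x : R) : 0 < x -> x < 1 -> x `^ (1 - alpha) <= two_power_kernel delta x.
Proof.
move=> x0 x1; rewrite /two_power_kernel x1.
have x01 : 0 < x <= 1 by rewrite x0 ltW.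
rewrite ger_powR// /delta.
have : Num.min (2 - alpha) (alpha - 1) <= 2 - alpha by rewrite ge_min lexx.
by lra.
Qed.

Lemma two_power_kernel_ge_large (x : R) : 1 <= x -> x `^ (- alpha) <= two_power_kernel delta x.
Proof.
move=> x1; rewrite /two_power_kernel ltNge x1/=.
rewrite ler_powR// /delta.
have : Num.min (2 - alpha) (alpha - 1) <= alpha - 1 by rewrite ge_min lexx orbT.
by lra.
Qed.

Lemma mulr_powRN (x : R) : 0 < x -> x * x `^ (- alpha) = x `^ (1 - alpha).
Proof. by move=> x0; rewrite -{1}(powRr1 (ltW x0)) -powRDp. Qed.

Let F (phi theta x : R) := (damped_cos phi theta x - cos phi) * x `^ (- alpha).

(** The subtraction of cos phi gains a factor x at 0, where x ^ (- alpha) alone is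
    not integrable. *)
Lemma damped_cosB_bound (phi theta x : R) : 0 <= cos theta -> 0 < x ->
  `|F phi theta x| <= 2 * two_power_kernel delta x.
Proof.
move=> c0 x0; have [_] := damped_cos_bound phi c0 x0.
rewrite le_min => /andP[b1 b2].
rewrite normrM (ger0_norm (powR_ge0 _ _)).
have [x1|x1] := ltP x 1.
  apply: (@le_trans _ _ (2 * x * x `^ (- alpha))); first by rewrite ler_wpM2r// powR_ge0.
  by rewrite -mulrA mulr_powRN// ler_wpM2l// two_power_kernel_ge_small.
by rewrite ler_pM// ?powR_ge0// two_power_kernel_ge_large.
Qed.

Lemma continuous_powRp (r x : R) : 0 < x -> {for x, continuous (fun y : R => y `^ r)}.
Proof. by move=> x0; exact: derivR_continuous (is_derive1_powR r x0). Qed.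

Lemma damped_cosB_measurable phi theta : measurable_fun halfline (F phi theta).
Proof.
apply: continuous_oy_measurable => x x0; apply: continuousM.
  by apply: continuousB; [exact: continuous_damped_cos|exact: cvg_cst].
exact: continuous_powRp.
Qed.

Lemma damped_cosB_integrable phi theta : 0 <= cos theta ->
  mu.-integrable halfline (EFin \o F phi theta).
Proof.
move=> c0; have Ik := integrable_two_power_kernelZ 2 delta0.
apply: (le_Rintegrable _ _ Ik) => //; first exact: damped_cosB_measurable.
by move=> x /=; rewrite in_itv/= andbT => x0; exact: damped_cosB_bound.
Qed.

Let G (phi theta x : R) := x `^ (1 - alpha) * damped_cos phi theta x.

(** At infinity the exponential decay is used only through exp (- y) <= 1 / y, and
    uniformly in theta as long as cos theta stays above c. *)
Lemma powR_damped_cos_bound (phi theta c x : R) : 0 < c -> c <= cos theta -> 0 < x ->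
  `|G phi theta x| <= (1 + c^-1) * two_power_kernel delta x.
Proof.
move=> c0 cc x0; have ct0 : 0 <= cos theta by rewrite (le_trans _ cc)// ltW.
have [d1 _] := damped_cos_bound phi ct0 x0.
rewrite normrM (ger0_norm (powR_ge0 _ _)).
have [x1|x1] := ltP x 1.
  apply: (@le_trans _ _ (x `^ (1 - alpha) * 1)); first by rewrite ler_wpM2l// powR_ge0.
  rewrite mulr1 (le_trans (two_power_kernel_ge_small x0 x1))//.
  by rewrite ler_peMl ?ltW ?two_power_kernel_gt0// ltrDl invr_gt0.
have xc : 0 < x * c by rewrite mulr_gt0.
apply: (@le_trans _ _ (x `^ (1 - alpha) * (x * c)^-1)).
  rewrite ler_wpM2l ?powR_ge0// normrM -[leRHS]mulr1 ler_pM ?cos_max// ger0_norm ?expR_ge0//.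
  apply: le_trans (expRN_le_inv xc); rewrite ler_expR lerN2.
  by rewrite ler_wpM2l// ltW.
rewrite -mulr_powRN// invfM mulrACA divff ?gt_eqF// mul1r mulrC ler_pM ?invr_ge0 ?powR_ge0//.
- exact: ltW.
- by rewrite lerDr.
- exact: two_power_kernel_ge_large.
Qed.

Lemma powR_damped_cos_measurable phi theta : measurable_fun halfline (G phi theta).
Proof.
apply: continuous_oy_measurable => x x0; apply: continuousM.
  exact: continuous_powRp.
exact: continuous_damped_cos.
Qed.

Lemma powR_damped_cos_integrable phi theta : 0 < cos theta ->
  mu.-integrable halfline (EFin \o G phi theta).
Proof.
move=> c0; have Ik := integrable_two_power_kernelZ (1 + (cos theta)^-1) delta0.
apply: (le_Rintegrable _ _ Ik) => //; first exact: powR_damped_cos_measurable.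
by move=> x /=; rewrite in_itv/= andbT => x0; exact: powR_damped_cos_bound.
Qed.

Let J (phi theta : R) := \int[mu]_(x in halfline) F phi theta x.

(** Integration by parts: x ^ (- alpha) is integrated and the boundary terms
    vanish at both ends, at 0 because alpha < 2 and at infinity because
    1 < alpha. *)
Lemma rotation_by_parts phi theta : 0 < cos theta ->
  \int[mu]_(x in halfline) G (phi - theta) theta x = - (alpha - 1) * J phi theta.
Proof.
move=> c0.
pose A x := (damped_cos phi theta x - cos phi) * x `^ (1 - alpha).
pose a x := (1 - alpha) * F phi theta x - G (phi - theta) theta x.
have I1 : mu.-integrable halfline (EFin \o (fun x => (1 - alpha) * F phi theta x)).
  by apply: RintegrableZl => //; exact: damped_cosB_integrable (ltW c0).
have I2 := powR_damped_cos_integrable (phi - theta) c0.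
have : \int[mu]_(x in halfline) a x = 0 - 0.
  apply: (@improper_FTC2 R A a 0 0).
  - move=> x x0.
    have h := derivR_mul (derivR_sub (damped_cos_dx phi theta x) (derivR_cst (cos phi) x)) (is_derive1_powR (1 - alpha) x0).
    apply: (is_derive_eq h); rewrite /a /F /G (_ : 1 - alpha - 1 = - alpha); last by ring.
    by ring.
  - move=> x x0; apply: continuousB; last apply: continuousM.
    + apply: continuousM; first exact: cvg_cst.
      apply: continuousM; last exact: continuous_powRp.
      by apply: continuousB; [exact: continuous_damped_cos|exact: cvg_cst].
    + exact: continuous_powRp.
    + exact: continuous_damped_cos.
  - exact: RintegrableB.
  - apply: norm_cvg0; apply: (@squeeze_cvgr _ _ _ _ (fun=> 0) (fun x => 2 * x `^ (2 - alpha))).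
    + near=> x; have x0 : 0 < x by near: x; exact: nbhs_right_gt.
      rewrite normr_ge0/= normrM (ger0_norm (powR_ge0 _ _)).
      have -> : x `^ (2 - alpha) = x * x `^ (1 - alpha).
        by rewrite -{2}(powRr1 (ltW x0)) -powRDp//; congr (_ `^ _); ring.
      rewrite mulrA ler_wpM2r ?powR_ge0//.
      by have [_] := damped_cos_bound phi (ltW c0) x0; rewrite le_min => /andP[].
    + exact: cvg_cst.
    + rewrite -[X in _ --> X](mulr0 2); apply: cvgMr; apply: powR_cvg0.
      by rewrite subr_gt0.
  - apply: norm_cvg0; apply: (@squeeze_cvgr _ _ _ _ (fun=> 0) (fun x => 2 * x^-1 `^ (alpha - 1))).
    + near=> x; have x0 : 0 < x by near: x; exact: nbhs_pinfty_gt.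
      rewrite normr_ge0/= normrM (ger0_norm (powR_ge0 _ _)).
      have -> : x^-1 `^ (alpha - 1) = x `^ (1 - alpha).
        by rewrite -powR_inv1 ?ltW// -powRrM; congr (_ `^ _); ring.
      rewrite ler_wpM2r ?powR_ge0//.
      by have [_] := damped_cos_bound phi (ltW c0) x0; rewrite le_min => /andP[].
    + exact: cvg_cst.
    + rewrite -[X in _ --> X](mulr0 2); apply: cvgMr.
      apply: cvg_comp (powR_cvg0 _); last by rewrite subr_gt0.
      move=> U [e /= e0 eU]; near=> x; have x0 : 0 < x by near: x; exact: nbhs_pinfty_gt.
      apply: eU => /=; last by rewrite invr_gt0.
      rewrite sub0r normrN gtr0_norm ?invr_gt0// invf_plt ?posrE//.
      by near: x; apply: nbhs_pinfty_gt; rewrite num_real.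
rewrite subrr RintegralB// RintegralZl//; last exact: damped_cosB_integrable (ltW c0).
by rewrite -/(J _ _) => /eqP; rewrite subr_eq0 => /eqP <-; ring.
Unshelve. all: by end_near. Qed.

(** Differentiation under the integral sign in theta, followed by the
    integration by parts, turns the family J phi into a linear differential system:
    rotating the half-line by theta multiplies the integral by a complex power. *)
Lemma rotation_derive phi theta : - (pi / 2) < theta < pi / 2 ->
  is_derive theta 1 (J phi) (- (alpha - 1) * J (phi + pi / 2) theta).
Proof.
move=> /andP[t1 t2].
have pi0 := @pi_gt0 R.
(* On ]- v, v[ the cosine is bounded below by cos v > 0, which provides an
   integrable majorant of the derivatives that is uniform in the angle. *)
pose v := (`|theta| + pi / 2) / 2.
have th2 : `|theta| < pi / 2 by rewrite ltr_norml t1 t2.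
have vp : v < pi / 2 by rewrite /v; lra.
have v0 : 0 <= v by rewrite /v divr_ge0// addr_ge0// divr_ge0// ltW.
have tv : `|theta| < v by rewrite /v; lra.
have c0 : 0 < cos v by apply: cos_gt0_pihalf; rewrite vp andbT; lra.
have cosI y : y \in `](- v), v[ -> cos v <= cos y.
  rewrite in_itv/= => /andP[y1 y2]; apply: ler_cos_norm; last by lra.
  by rewrite ler_norml !ltW.
have Iv : [set` `](- v), v[] theta.
  by rewrite /= in_itv/=; rewrite ltr_norml in tv.
have df (x y : R) : [set` `](- v), v[] x -> halfline y -> is_derive x 1 (F phi ^~ y) (G (phi - x + pi / 2) x y).
  move=> _; rewrite /= in_itv/= andbT => y0.
  have h := derivR_mul (derivR_sub (damped_cos_dtheta phi x y) (derivR_cst (cos phi) x)) (derivR_cst (y `^ (- alpha)) x).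
  apply: (is_derive_eq h); rewrite /G -mulr_powRN//; ring.
have If x : [set` `](- v), v[] x -> mu.-integrable halfline (EFin \o F phi x).
  by move=> /cosI cx; apply: damped_cosB_integrable; rewrite (le_trans _ cx)// ltW.
have IK := integrable_two_power_kernelZ (1 + (cos v)^-1) delta0.
have bd x y : [set` `](- v), v[] x -> halfline y ->
    `|partial1of2 (F phi) x y| <= `|(1 + (cos v)^-1) * two_power_kernel delta y|.
  move=> xI y0; rewrite /partial1of2 (derivR_derive1 (df x y xI y0)).
  apply: le_trans (ler_norm _); move: y0; rewrite /= in_itv/= andbT => y0.
  by apply: powR_damped_cos_bound => //; exact: cosI.
have dd (x y : R) : [set` `](- v), v[] x -> halfline y -> derivable (F phi ^~ y) x 1.
  by move=> xI y0; case: (df x y xI y0).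
have IKn := integrable_norm IK.
have mH : measurable (halfline : set (measurableTypeR R)) by exact: measurable_itv.
have := derivable_under_integral mH Iv If dd (fun y => normr_ge0 _) IKn bd.
have := differentiation_under_integral mH Iv If dd (fun y => normr_ge0 _) IKn bd.
rewrite derive1E => e h; split; first exact: h.
rewrite e -rotation_by_parts; last by apply: cos_gt0_pihalf; rewrite t1 t2.
apply: eq_Rintegral => y; rewrite inE => y0.
rewrite /partial1of2 (derivR_derive1 (df _ _ Iv y0)).
by congr (G _ _ _); ring.
Qed.

Lemma rotation_shiftpi phi theta : 0 <= cos theta -> J (phi + pi) theta = - J phi theta.
Proof.
move=> c0; rewrite /J -[RHS]mulN1r -RintegralZl//; last exact: damped_cosB_integrable.
apply: eq_Rintegral => x _; rewrite /F /damped_cos addrA !cosDpi; ring.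
Qed.

(** The pair (J 0, J (- pi / 2)) solves the system of a rotation with angular
    speed alpha - 1, hence rotating it back gives a constant. *)
Lemma rotation_solution theta : 0 <= theta < pi / 2 ->
  J 0 theta = cos ((alpha - 1) * theta) * J 0 0 /\
  J (- (pi / 2)) theta = - sin ((alpha - 1) * theta) * J 0 0.
Proof.
move=> /andP[t0 t2]; have pi0 := @pi_gt0 R.
have c0 x : 0 <= x <= theta -> - (pi / 2) < x < pi / 2.
  by move=> /andP[a b]; apply/andP; split; lra.
set k := alpha - 1.
have d0 x : 0 <= x <= theta -> is_derive x 1 (J 0) (k * J (- (pi / 2)) x).
  move=> xt; apply: (is_derive_eq (rotation_derive 0 (c0 x xt))).
  have -> : 0 + pi / 2 = - (pi / 2) + pi :> R by lra.
  by rewrite rotation_shiftpi ?mulrNN// cos_ge0_pihalf//; have /andP[? ?] := c0 x xt; rewrite !ltW.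
have dm x : 0 <= x <= theta -> is_derive x 1 (J (- (pi / 2))) (- k * J 0 x).
  move=> xt; apply: (is_derive_eq (rotation_derive (- (pi / 2)) (c0 x xt))).
  by rewrite addNr.
have dk (x : R) := derivR_scale k (derivR_id x).
have dck x := derivR_comp (is_derive_cos (k * x)) (dk x).
have dsk x := derivR_comp (is_derive_sin (k * x)) (dk x).
have Jm0 : J (- (pi / 2)) 0 = 0.
  rewrite /J (_ : (fun x => _) = (fun=> 0)) ?Rintegral_cst ?mul0r//.
  apply/funext => x; rewrite /F /damped_cos sin0 mulr0 add0r cosN cos_pihalf.
  by rewrite mulr0 subr0 mul0r.
have [e1 e2] : cos (k * theta) * J 0 theta - sin (k * theta) * J (- (pi / 2)) theta = J 0 0 /\
   sin (k * theta) * J 0 theta + cos (k * theta) * J (- (pi / 2)) theta = 0.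
  split.
    have h x : 0 <= x <= theta -> is_derive x 1
        (fun x => cos (k * x) * J 0 x - sin (k * x) * J (- (pi / 2)) x) 0.
      move=> xt; apply: (is_derive_eq (derivR_sub (derivR_mul (dck x) (d0 x xt)) (derivR_mul (dsk x) (dm x xt)))).
      by ring.
    have [c _] := @MVT_derive _ _ (fun=> 0) _ _ t0 h.
    by rewrite mul0r mulr0 cos0 sin0 mul1r mul0r subr0 => /eqP; rewrite subr_eq0 => /eqP.
  have h x : 0 <= x <= theta -> is_derive x 1
      (fun x => sin (k * x) * J 0 x + cos (k * x) * J (- (pi / 2)) x) 0.
    move=> xt; apply: (is_derive_eq (derivR_add (derivR_mul (dsk x) (d0 x xt)) (derivR_mul (dck x) (dm x xt)))).
    by ring.
  have [c _] := @MVT_derive _ _ (fun=> 0) _ _ t0 h.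
  by rewrite mul0r mulr0 cos0 sin0 mul1r mul0r add0r Jm0 subr0.
have cs := cos2Dsin2 (k * theta).
split.
- transitivity ((cos (k * theta) ^+ 2 + sin (k * theta) ^+ 2) * J 0 theta); first by rewrite cs mul1r.
  rewrite -e1; apply/eqP; rewrite -subr_eq0; apply/eqP.
  transitivity (sin (k * theta) * (sin (k * theta) * J 0 theta + cos (k * theta) * J (- (pi / 2)) theta)); first by ring.
  by rewrite e2 mulr0.
- transitivity ((cos (k * theta) ^+ 2 + sin (k * theta) ^+ 2) * J (- (pi / 2)) theta); first by rewrite cs mul1r.
  rewrite -e1; apply/eqP; rewrite -subr_eq0; apply/eqP.
  transitivity (cos (k * theta) * (sin (k * theta) * J 0 theta + cos (k * theta) * J (- (pi / 2)) theta)); first by ring.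
  by rewrite e2 mulr0.
Qed.

(** At theta = 0 the integration by parts is the functional equation that defines
    Gamma at 1 - alpha, in ]-1, 0[, from Euler's integral at 2 - alpha. *)
Lemma rotation_Gamma : J 0 0 = Gamma (1 - alpha).
Proof.
have := @rotation_by_parts 0 0; rewrite cos0 => /(_ ltr01).
rewrite /Gamma ltNge subr_le0 (ltW alpha1)/=.
have -> : Num.truncn (- (1 - alpha)) = 0%N.
  by apply: truncn_def; rewrite mulr0n mulr1n opprB subr_ge0 (ltW alpha1) ltrBlDl; exact: alpha2.
rewrite big_ord1 addr0 => h.
suff -> : Gamma_integral (1 - alpha + 1%:R) = - (alpha - 1) * J 0 0.
  by rewrite opprB mulrC mulKf// lt_eqF// subr_lt0.
rewrite -h /Gamma_integral; apply: eq_Rintegral => x; rewrite inE /= in_itv/= andbT => x0.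
rewrite /G /damped_cos sin0 cos0 mulr1 mulr0 subrr addr0 cos0 mulr1.
by congr (_ `^ _ * _); ring.
Qed.

(** At theta = pi / 2 there is no exponential decay left, so the values are obtained
    as limits along angles below pi / 2, by dominated convergence. *)
Lemma rotation_pihalf : J 0 (pi / 2) = sin (pi * alpha / 2) * Gamma (1 - alpha) /\
  J (- (pi / 2)) (pi / 2) = cos (pi * alpha / 2) * Gamma (1 - alpha).
Proof.
have pi0 := @pi_gt0 R.
pose th n : R := pi / 2 - pi / 2 * harmonic n.
have th_pi : th n @[n --> \oo] --> pi / 2.
  rewrite -[X in _ --> X]subr0 -[X in _ - X](mulr0 (pi / 2)).
  by apply: cvgB; [exact: cvg_cst|apply: cvgMr; exact: cvg_harmonic].
have thI n : 0 <= th n < pi / 2.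
  have h0 : 0 < harmonic n :> R by rewrite /harmonic/= invr_gt0.
  have h1 : harmonic n <= 1 :> R by rewrite /harmonic/= invf_le1// ler1n.
  rewrite /th; apply/andP; split; last by rewrite ltrBlDr ltrDl mulr_gt0// divr_gt0.
  by rewrite subr_ge0 ler_piMr// divr_ge0// ltW.
have cJ phi : J phi (th n) @[n --> \oo] --> J phi (pi / 2).
  have Ik := integrable_two_power_kernelZ 2 delta0.
  have [//|n|x _|n x|_ ] := @Rintegral_dominated _ _ _ mu halfline (fun n => F phi (th n)) (F phi (pi / 2)) _ _ _ _ Ik.
  - exact: damped_cosB_measurable.
  - rewrite /F; apply: cvgM; last exact: cvg_cst.
    apply: cvgB; last exact: cvg_cst.
    have h := derivR_continuous (damped_cos_dtheta phi (pi / 2) x).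
    exact: (cvg_comp _ _ th_pi h).
  - rewrite /= in_itv/= andbT => x0; apply: damped_cosB_bound => //.
    have /andP[a b] := thI n.
    by apply: cos_ge0_pihalf; apply/andP; split; [lra|exact: ltW].
  - by [].
have ck : (alpha - 1) * th n @[n --> \oo] --> (alpha - 1) * (pi / 2) by apply: cvgMr.
have e : (alpha - 1) * (pi / 2) = pi * alpha / 2 - pi / 2 by lra.
split.
- rewrite -cosBpihalf -e -rotation_Gamma -(cvg_lim _ (cJ 0))//; apply/cvg_lim => //.
  under eq_fun do rewrite (rotation_solution (thI _)).1.
  apply: cvgM; last exact: cvg_cst.
  by apply: (cvg_comp _ _ ck); exact: continuous_cos.
- rewrite -[cos _]opprK -sinBpihalf -e -rotation_Gamma -(cvg_lim _ (cJ (- (pi / 2))))//; apply/cvg_lim => //.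
  under eq_fun do rewrite (rotation_solution (thI _)).2.
  apply: cvgM; last exact: cvg_cst.
  by apply: cvgN; apply: (cvg_comp _ _ ck); exact: continuous_sin.
Qed.

Lemma integral_sin_powR :
  mu.-integrable halfline (EFin \o (fun x => sin x * x `^ (- alpha))) /\
  \int[mu]_(x in halfline) (sin x * x `^ (- alpha)) =
    Gamma (1 - alpha) * cos (pi * alpha / 2).
Proof.
have e : (fun x => sin x * x `^ (- alpha)) = F (- (pi / 2)) (pi / 2).
  apply/funext => x; rewrite /F /damped_cos cos_pihalf sin_pihalf mulr0 oppr0 expR0.
  by rewrite mul1r mulr1 cosN cos_pihalf subr0 cosBpihalf.
split; first by rewrite e; apply: damped_cosB_integrable; rewrite cos_pihalf.
by rewrite mulrC -rotation_pihalf.2 /J -e.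
Qed.

Lemma integral_cosB1_powR :
  mu.-integrable halfline (EFin \o (fun x => (cos x - 1) * x `^ (- alpha))) /\
  \int[mu]_(x in halfline) ((cos x - 1) * x `^ (- alpha)) =
    Gamma (1 - alpha) * sin (pi * alpha / 2).
Proof.
have e : (fun x => (cos x - 1) * x `^ (- alpha)) = F 0 (pi / 2).
  apply/funext => x; rewrite /F /damped_cos cos_pihalf sin_pihalf mulr0 oppr0 expR0.
  by rewrite mul1r mulr1 addr0 cos0.
split; first by rewrite e; apply: damped_cosB_integrable; rewrite cos_pihalf.
by rewrite mulrC -rotation_pihalf.1 /J -e.
Qed.

End rotation.

(** * The layer cake formula *)

Section measurable_level_sets.
Context {R : realType} {d : measure_display} {T : measurableType d}.
Implicit Types (X : T -> R) (u : R).

Lemma measurable_lt_set X u : measurable_fun setT X ->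
  measurable [set w | u < X w].
Proof.
move=> mX; have := mX measurableT _ (measurable_itv `]u, +oo[); rewrite setTI.
by congr measurable; apply/seteqP; split => w /=; rewrite in_itv/= andbT.
Qed.

Lemma measurable_gt_set X u : measurable_fun setT X ->
  measurable [set w | X w < u].
Proof.
move=> mX; have := mX measurableT _ (measurable_itv `]-oo, u[); rewrite setTI.
by congr measurable; apply/seteqP; split => w /=; rewrite in_itv/=.
Qed.

Lemma measurable_le_set X u : measurable_fun setT X ->
  measurable [set w | u <= X w].
Proof.
move=> mX; have := mX measurableT _ (measurable_itv `[u, +oo[); rewrite setTI.
by congr measurable; apply/seteqP; split => w /=; rewrite in_itv/= andbT.
Qed.

End measurable_level_sets.

Section layer_cake.
Context {R : realType} {d : measure_display} {T : measurableType d}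
  (P : probability T R).
Notation mu := (@lebesgue_measure R).
Local Notation halfline := (`]0, +oo[%classic : set R).

Lemma bounded_integrable (f : T -> R) (M : R) : measurable_fun setT f ->
  (forall w, `|f w| <= M) -> P.-integrable setT (EFin \o f).
Proof.
move=> mf fM; apply: (@le_Rintegrable _ _ _ P setT f (fun=> M)) => //.
exact: finite_measure_integrable_cst.
Qed.

(** Fubini for the function that equals g u on the region below the graph of X.
    The integrability hypothesis bears on g times the tail, which is what
    Potter's bound controls. *)
Lemma layer_cake (X : T -> R) (g F : R -> R) :
  measurable_fun setT X -> (forall w, 0 <= X w) ->
  measurable_fun setT g ->
  (forall x, 0 <= x -> mu.-integrable `]0, x[ (EFin \o g) /\
     \int[mu]_(u in `]0, x[) g u = F x) ->
  mu.-integrable halfline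
    (EFin \o (fun u => g u * fine (P [set w | u < X w]))) ->
  P.-integrable setT (EFin \o (F \o X)) /\
  \int[P]_w F (X w) =
  \int[mu]_(u in halfline) (g u * fine (P [set w | u < X w])).
Proof.
move=> mX X0 mg gF IgP.
pose f w u := if (0 < u) && (u < X w) then g u else 0.
have mLT u : measurable [set w | u < X w] by exact: measurable_lt_set.
have mf : measurable_fun setT (fun z : T * measurableTypeR R => f z.1 z.2).
  apply: measurable_fun_ifT => //.
  - apply: measurable_and.
    + exact: measurable_fun_ltr.
    + apply: measurable_fun_ltr => //; exact: measurableT_comp mX _.
  - exact: measurableT_comp mg _.
have f2 w : f w = g \_ (`]0, X w[).
  by apply/funext => u; rewrite /f patchE mem_setE in_itv.
have If2 w : mu.-integrable setT (EFin \o f w).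
  rewrite f2 -restrict_EFin; apply/(integrable_mkcond _ _).1 => //.
  exact: (gF _ (X0 w)).1.
have f1 u : f ^~ u = (fun=> if 0 < u then g u else 0) \_ [set w | u < X w].
  apply/funext => w; rewrite /f patchE.
  have -> : (w \in [set w | u < X w]) = (u < X w) by apply/idP/idP; rewrite inE.
  by case: (0 < u); case: (u < X w).
have If1 u : P.-integrable setT (EFin \o f ^~ u).
  apply: (@bounded_integrable _ `|g u|).
    rewrite f1; apply/(measurable_restrictT _ _).1 => //.
  by move=> w; rewrite /f; case: ifPn => // _; rewrite normr0.
have i1 u : \int[P]_w f w u = ((fun u => g u * fine (P [set w | u < X w])) \_ halfline) u.
  rewrite f1 -Rintegral_mkcond Rintegral_cst// patchE mem_setE in_itv/= andbT.
  by case: ifPn => // _; rewrite mul0r.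
have fin : (\int[mu]_u \int[P]_w (`|f w u|)%:E < +oo)%E.
  have /integrableP[_] := IgP.
  rewrite integral_mkcond; congr (_ < _)%E; apply: eq_integral => u _.
  have -> : (fun w => (`|f w u|)%:E) =
      EFin \o ((fun=> if 0 < u then `|g u| else 0) \_ [set w | u < X w]).
    apply/funext => w /=; have := congr1 (fun h => h w) (f1 u) => /= ->.
    rewrite !patchE; case: ifPn => _; last by rewrite normr0.
    by case: ifPn => _ //; rewrite normr0.
  rewrite -restrict_EFin -integral_mkcond integral_cst//= patchE mem_setE in_itv/= andbT.
  case: ifPn => _; last by rewrite mul0e.
  by rewrite -[P _]fineK ?fin_num_measure//= normrM (ger0_norm (fine_ge0 _)).
have [I1 _ e] := Rintegral_Fubini mf If2 If1 fin.
have FX : (fun w => \int[mu]_u f w u) = F \o X.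
  by apply/funext => w /=; rewrite f2 -Rintegral_mkcond (gF _ (X0 w)).2.
split.
  move: I1; congr (_.-integrable _ _); apply/funext => w /=.
  by rewrite -[F _]/((F \o X) w) -FX.
rewrite -[LHS]/(\int[P]_w (F \o X) w) -FX e [RHS]Rintegral_mkcond.
by apply: eq_Rintegral => u _; exact: i1.
Qed.

End layer_cake.

(** * Independence of the past and the future *)

Section independence.
Context {R : realType} {d : measure_display} {T : measurableType d}
  (P : probability T R).

(** For a fixed event C, the sets A with P (A /\ C) = P A * P C form a Dynkin
    system, because both sides are measures in A. *)
Lemma independent_g_sigma (G : set (set T)) (C : set T) : setI_closed G ->
  G `<=` measurable -> measurable C ->
  (forall A, G A -> P (A `&` C) = (P A * P C)%E) ->
  forall A, <<s G >> A -> measurable A /\ P (A `&` C) = (P A * P C)%E.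
Proof.
move=> GI Gm mC GC A.
rewrite -setI_closed_g_dynkin_g_sigma_algebra//.
pose r : {nonneg R} := NngNum (fine_ge0 (measure_ge0 P C)).
have rE B : mscale r P B = (P B * P C)%E.
  by rewrite /mscale/= fineK ?fin_num_measure// muleC.
move: A; apply: smallest_sub; last first.
  by move=> A GA; split; [exact: Gm|exact: GC].
split.
- by split => //; rewrite setTI probability_setT mul1e.
- move=> A [mA AC]; split; first exact: measurableC.
  rewrite probability_setC// muleBl ?fin_num_measure// mul1e -AC.
  have mCA : measurable (C `&` A) by exact: measurableI.
  by rewrite (measureDI P mC mA) (setIC A) addeK ?fin_num_measure// setDE setIC.
- move=> F tF FA; split; first by apply: bigcup_measurable => i _; case: (FA i).
  have mF i : measurable (F i) by case: (FA i).
  have mU : measurable (\bigcup_i F i) by exact: bigcup_measurable.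
  have h1 := @measure_semi_sigma_additive _ _ _ (mrestr P mC) F mF tF mU.
  have h2 := @measure_semi_sigma_additive _ _ _ (mscale r P) F mF tF mU.
  rewrite -rE; apply: cvg_unique h1 _; first exact: ereal_hausdorff.
  rewrite (_ : (fun n => _) = (fun n => \sum_(0 <= i < n) mscale r P (F i))%E)//.
  apply/funext => n; apply: eq_bigr => i _.
  by rewrite rE; case: (FA i).
Qed.

Definition independent_rv (X Y : T -> R) := forall A B : set R,
  measurable A -> measurable B ->
  P (X @^-1` A `&` Y @^-1` B) = (P (X @^-1` A) * P (Y @^-1` B))%E.

(** The joint law of independent variables is the product of their laws, by
    uniqueness of the product measure on rectangles. *)
Lemma expectation_independent (X Y : T -> R) (f g : R -> R) (M : R) :
  measurable_fun setT X -> measurable_fun setT Y -> independent_rv X Y ->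
  measurable_fun setT f -> measurable_fun setT g ->
  (forall x, `|f x| <= M) -> (forall x, `|g x| <= M) ->
  \int[P]_w (f (X w) * g (Y w)) = (\int[P]_w f (X w)) * (\int[P]_w g (Y w)).
Proof.
move=> mX mY XY mf mg fM gM.
pose X' : {RV P >-> R} := mfun_Sub (mem_set mX).
pose Y' : {RV P >-> R} := mfun_Sub (mem_set mY).
pose mu1 := distribution P X'; pose mu2 := distribution P Y'.
have mXY : measurable_fun setT (fun w => (X w, Y w)) by exact: measurable_fun_pair.
pose h (z : R * R) := f z.1 * g z.2.
have mh : measurable_fun setT h.
  by apply: measurable_funM; [exact: measurableT_comp mf _|exact: measurableT_comp mg _].
pose XY' : {RV P >-> (R * R)%type} := mfun_Sub (mem_set mXY).
have prodE A : measurable A -> (mu1 \x mu2)%E A = distribution P XY' A.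
  apply: product_measure_unique => B C mB mC.
  exact: XY.
have M0 : 0 <= M by apply: le_trans (fM 0); exact: normr_ge0.
have hM z : `|h z| <= M * M by rewrite normrM ler_pM.
have Ih : (mu1 \x mu2)%E.-integrable setT (EFin \o h).
  apply/integrableP; split; first exact/measurable_EFinP.
  rewrite (eq_measure_integral (distribution P XY')); last by move=> A mA _; exact: prodE.
  have /integrableP[] := bounded_integrable (distribution P XY') mh hM.
  by [].
have IhP : P.-integrable setT (EFin \o h \o XY').
  apply: (@bounded_integrable _ _ _ P (h \o XY') (M * M)); last by move=> w; exact: hM.
  by apply: measurableT_comp.
have fE : \int[P]_w f (X w) = \int[mu1]_x f x.
  rewrite /Rintegral; congr fine; rewrite integral_distribution//.
    exact/measurable_EFinP.
  apply: (@bounded_integrable _ _ _ P (f \o X') M); last by move=> w; exact: fM.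
  by apply: measurableT_comp.
have gE : \int[P]_w g (Y w) = \int[mu2]_x g x.
  rewrite /Rintegral; congr fine; rewrite integral_distribution//.
    exact/measurable_EFinP.
  apply: (@bounded_integrable _ _ _ P (g \o Y') M); last by move=> w; exact: gM.
  by apply: measurableT_comp.
have If := bounded_integrable mu1 mf fM.
have Ig := bounded_integrable mu2 mg gM.
rewrite fE gE -[LHS]/(fine (\int[P]_w (EFin \o h \o XY') w)%E).
rewrite -integral_distribution//; last exact/measurable_EFinP.
rewrite (eq_measure_integral (mu1 \x mu2)%E); last by move=> A mA _; apply/esym; exact: prodE.
rewrite -integral12_prod_meas1//= /fubini_F/= -RintegralZr//.
rewrite /Rintegral; congr fine; apply: eq_integral => x _.
by rewrite /h/= Rintegral_EFin ?RintegralZl//; exact: RintegrableZl.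
Qed.

End independence.

Section past.
Context {R : realType} {d : measure_display} {T : measurableType d}
  (P : probability T R) (Z : nat -> {RV P >-> R}).
Context (indepZ : mutually_independent Z).

(** Cylinder events of Z_0, ..., Z_(k-1). They form a pi-system that generates the
    sigma-algebra of the first k variables, and mutual independence speaks of them
    directly. *)
Definition past (k : nat) : set (set T) :=
  [set A | exists2 B : nat -> set R, (forall i, measurable (B i)) &
    A = \bigcap_(i in `I_k) (Z i @^-1` B i)].

Lemma past_setI k : setI_closed (past k).
Proof.
move=> A A' [B mB ->] [B' mB' ->].
exists (fun i => B i `&` B' i); first by move=> i; exact: measurableI.
by rewrite -bigcapI.
Qed.

Lemma past_measurable k : past k `<=` measurable.
Proof.
move=> A [B mB ->]; apply: fin_bigcap_measurable; first exact: finite_II.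
by move=> i _; rewrite -[X in measurable X]setTI; exact: measurable_funPT.
Qed.

Lemma g_past_measurable k A : <<s past k >> A -> measurable A.
Proof. by apply: smallest_sub => //; [exact: sigma_algebra_measurable|exact: past_measurable]. Qed.

(** Mutual independence applied to the indices 0, ..., k-1 and j settles cylinder
    events, and the Dynkin system argument extends this to the sigma-algebra. *)
Lemma past_future_independent k j A B : (k <= j)%N -> <<s past k >> A ->
  measurable B -> P (A `&` Z j @^-1` B) = (P A * P (Z j @^-1` B))%E.
Proof.
move=> kj pA mB.
have mZB : measurable (Z j @^-1` B).
  by rewrite -[X in measurable X]setTI; exact: measurable_funPT.
apply: (independent_g_sigma (@past_setI k) (@past_measurable k) mZB _ pA).2.
move=> A0 [C mC ->].
pose C' i := if i == j then B else C i.
have mC' i : measurable (C' i) by rewrite /C'; case: ifP.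
have ji : j \notin iota 0 k by rewrite mem_iota/= add0n -leqNgt.
have I0 : [set` iota 0 k] = `I_k.
  by apply/seteqP; split => i /=; rewrite mem_iota/= add0n.
have u0 : uniq (iota 0 k) by exact: iota_uniq.
have u1 : uniq (j :: iota 0 k) by rewrite /= ji.
have e0 := @indepZ (iota 0 k) C u0 (fun i _ => mC i).
have e1 := @indepZ (j :: iota 0 k) C' u1 (fun i _ => mC' i).
rewrite I0 in e0.
have C'C i : (i < k)%N -> C' i = C i.
  by move=> ik; rewrite /C' ltn_eqF// (leq_trans ik).
have I1 : [set` j :: iota 0 k] = [set j] `|` `I_k.
  rewrite -I0; apply/seteqP; split => i /=; rewrite in_cons.
    by case/orP => [/eqP|]; [left|right].
  by move=> [->|->]; rewrite ?eqxx// orbT.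
have C'j : C' j = B by rewrite /C' eqxx.
rewrite I1 bigcap_setU bigcap_set1 C'j in e1.
rewrite big_cons C'j in e1.
have e2 : \bigcap_(i in `I_k) (Z i @^-1` C' i) = \bigcap_(i in `I_k) (Z i @^-1` C i).
  by apply: eq_bigcapr => i ik; rewrite C'C.
rewrite e0 setIC -e2 e1 EFinM fineK ?fin_num_measure// muleC; congr (_ * _)%E.
congr EFin; apply: eq_big_seq => i; rewrite mem_iota/= add0n => ik.
by rewrite C'C.
Qed.

(** Measurability with respect to the sigma-algebra of the first k variables; it
    is preserved by all the operations that preserve measurability. *)
Definition past_fun k (X : T -> R) :=
  @measurable_fun _ _ (g_sigma_algebraType (past k)) R setT X.

Lemma past_fun_measurable k X : past_fun k X -> measurable_fun setT X.
Proof.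
move=> pX _ B mB; rewrite setTI.
have := pX measurableT B mB; rewrite setTI; exact: g_past_measurable.
Qed.

Lemma past_fun_independent k j X : (k <= j)%N -> past_fun k X ->
  independent_rv P X (Z j).
Proof.
move=> kj pX A B mA mB; apply: (past_future_independent kj) => //.
by have := pX measurableT A mA; rewrite setTI.
Qed.

Lemma past_fun_Z k i : (i < k)%N -> past_fun k (Z i).
Proof.
move=> ik _ B mB; rewrite setTI; apply: sub_sigma_algebra.
exists (fun j => if j == i then B else setT); first by move=> j; case: ifP.
apply/seteqP; split => [w Bw j /= _|w /= h].
  by case: ifP => // /eqP ->.
by have := h i ik; rewrite eqxx.
Qed.

Lemma past_fun_sum k (h : R -> R) : measurable_fun setT h ->
  past_fun k (fun w => \sum_(i < k) h (Z i w)).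
Proof.
move=> mh; apply: measurable_sum => i.
by apply: measurableT_comp => //; exact: past_fun_Z.
Qed.

Lemma past_funS k X : past_fun k X -> past_fun k.+1 X.
Proof.
move=> pX _ B mB; have := pX measurableT B mB; rewrite setTI.
apply: smallest_sub; first exact: smallest_sigma_algebra.
move=> A [C mC ->]; apply: sub_sigma_algebra.
exists (fun j => if (j < k)%N then C j else setT); first by move=> j; case: ifP.
apply/seteqP; split => [w Bw j /= jk|w /= h j jk].
  by case: ifP => // ?; exact: Bw.
by have := h j (ltnW jk); rewrite (jk : (j < k)%N).
Qed.

End past.

(** * Kolmogorov's maximal inequality *)

Section probability_tools.
Context {R : realType} {d : measure_display} {T : measurableType d}
  (P : probability T R).

Lemma measurable_exists_le (S : nat -> T -> R) (x : R) N :
  (forall k, measurable_fun setT (S k)) ->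
  measurable [set w | exists2 k, (k <= N)%N & x <= `|S k w|].
Proof.
move=> mS.
rewrite (_ : [set _ | _] = \bigcup_(k in `I_N.+1) [set w | x <= `|S k w|]).
  apply: fin_bigcup_measurable; first exact: finite_II.
  move=> k _; apply: measurable_le_set; exact: measurableT_comp.
by apply/seteqP; split => w [k kN h]; exists k.
Qed.

Lemma fine_le_measure (A B : set T) : measurable A -> measurable B ->
  A `<=` B -> fine (P A) <= fine (P B).
Proof.
by move=> mA mB AB; rewrite fine_le ?fin_num_measure//; apply: le_measure; rewrite ?inE.
Qed.

Lemma fine_measureU_le (A B : set T) : measurable A -> measurable B ->
  fine (P (A `|` B)) <= fine (P A) + fine (P B).
Proof.
move=> mA mB; rewrite -fineD ?fin_num_measure//.
rewrite fine_le ?fin_num_measure//; last exact: measureU2.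
- exact: measurableU.
- by rewrite fin_numD !fin_num_measure.
Qed.

Lemma Rintegral_indic (A : set T) : measurable A ->
  \int[P]_w \1_A w = fine (P A).
Proof. by move=> mA; rewrite /Rintegral integral_indic// setIT. Qed.

Lemma markov_le (Y : T -> R) (c : R) (A : set T) : measurable A ->
  P.-integrable setT (EFin \o Y) -> (forall w, 0 <= Y w) ->
  (forall w, A w -> c <= Y w) -> c * fine (P A) <= \int[P]_w Y w.
Proof.
move=> mA IY Y0 AY; rewrite -Rintegral_indic// -RintegralZl//; last first.
  exact: integrable_indic.
apply: le_Rintegral => //; first by apply: RintegrableZl => //; exact: integrable_indic.
move=> w _; rewrite indicE; case: (boolP (w \in A)) => [|_].
  by rewrite inE mulr1 => /AY.
by rewrite mulr0.
Qed.

End probability_tools.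

Section kolmogorov.
Context {R : realType} {d : measure_display} {T : measurableType d}
  (P : probability T R) (Z : nat -> {RV P >-> R}).
Context (indepZ : mutually_independent Z).
Context (h : R -> R) (M v : R).
Context (mh : measurable_fun setT h) (hM : forall x, `|h x| <= M).
Context (h0 : forall i, \int[P]_w h (Z i w) = 0).
Context (hv : forall i, \int[P]_w h (Z i w) ^+ 2 <= v).

Let Sh k w := \sum_(i < k) h (Z i w).

Let keep (x y : R) : R := if `|y| < x then y else 0.

(** The walk stopped at its first exit from ]-x, x[. Whether it moves at time k' is
    decided by its own past, since a stopped walk stays outside this interval. *)
Fixpoint stopped_walk (x : R) k w : R :=
  if k is k'.+1 then
    stopped_walk x k' w +
      (if `|stopped_walk x k' w| < x then h (Z k' w) else 0)
  else 0.

Let W := stopped_walk.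

Let M0 : 0 <= M. Proof. by apply: le_trans (hM 0); exact: normr_ge0. Qed.

Let W_bound x k w : `|W x k w| <= k%:R * M.
Proof.
elim: k => [|k IH] /=; first by rewrite normr0 mul0r.
rewrite (le_trans (ler_normD _ _))// -natr1 mulrDl mul1r lerD//.
by case: ifPn => // _; rewrite normr0.
Qed.

Let W_past x k : past_fun Z k (W x k).
Proof.
elim: k => [|k IH] /=; first exact: measurable_cst.
have IH' := past_funS IH.
apply: measurable_funD => //; apply: measurable_fun_ifT.
- by apply: measurable_fun_ltr => //; exact: measurableT_comp.
- by apply: measurableT_comp => //; exact: past_fun_Z.
- exact: measurable_cst.
Qed.

Let W_exit (x : R) k w : (forall j, (j <= k)%N -> `|Sh j w| < x /\ W x j w = Sh j w) \/
  x <= `|W x k w|.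
Proof.
elim: k => [|k [IH|IH]]; last 2 first.
- have [Skx WS] := IH k (leqnn _).
  have WSk : W x k.+1 w = Sh k.+1 w.
    by rewrite /W /= -/(W x k w) WS Skx /Sh big_ord_recr.
  have [lt|ge] := ltP `|W x k.+1 w| x; last by right.
  left=> j; rewrite leq_eqVlt => /predU1P[->|]; last by rewrite ltnS; exact: IH.
  by rewrite -WSk.
- by right; rewrite /W /= -/(W x k w) ltNge IH/= addr0.
- have [lt|ge] := ltP `|W x 0%N w| x; last by right.
  by left=> j; rewrite leqn0 => /eqP ->; rewrite /Sh big_ord0.
Qed.

Let mW x k : measurable_fun setT (W x k).
Proof. exact: (past_fun_measurable (@W_past x k)). Qed.

Let W_second_moment x k : 0 < x -> \int[P]_w (W x k w) ^+ 2 <= k%:R * v.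
Proof.
move=> x0; elim: k => [|k IH].
  by rewrite (_ : (fun w => _) = fun=> 0) ?Rintegral_cst ?mul0r//; apply/funext => w; rewrite /W/= expr0n.
have mhZ : measurable_fun setT (h \o Z k) by exact: measurableT_comp.
have mkeep : measurable_fun setT (keep x).
  apply: measurable_fun_ifT => //.
  by apply: measurable_fun_ltr => //; exact: measurableT_comp.
have keepx y : `|keep x y| <= x.
  by rewrite /keep; case: ifPn => [/ltW//|_]; rewrite normr0 ltW.
(* The increments are orthogonal to the past because they are centred; this is
   where independence is used. *)
have cross : \int[P]_w (keep x (W x k w) * h (Z k w)) = 0.
  rewrite (@expectation_independent _ _ _ P (W x k) (Z k) (keep x) h (Num.max x M))//.
  - by rewrite h0 mulr0.
  - exact: past_fun_independent (@W_past x k).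
  - by move=> y; rewrite le_max keepx.
  - by move=> y; rewrite le_max hM orbT.
have I1 : P.-integrable setT (EFin \o (fun w => W x k w ^+ 2)).
  apply: (@bounded_integrable _ _ _ _ _ ((k%:R * M) ^+ 2)).
    exact: measurable_funX.
  by move=> w; rewrite normrX ler_sqr ?nnegrE ?mulr_ge0// W_bound.
have I2 : P.-integrable setT (EFin \o (fun w => keep x (W x k w) * h (Z k w))).
  apply: (@bounded_integrable _ _ _ _ _ (x * M)).
    by apply: measurable_funM => //; exact: measurableT_comp.
  by move=> w; rewrite normrM ler_pM.
have I3 : P.-integrable setT (EFin \o (fun w => h (Z k w) ^+ 2)).
  apply: (@bounded_integrable _ _ _ _ _ (M ^+ 2)).
    exact: measurable_funX.
  by move=> w; rewrite normrX ler_sqr ?nnegrE.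
have I4 := RintegrableZl 2 measurableT I2.
have I5 := RintegrableD measurableT I1 I4.
apply: (@le_trans _ _ (\int[P]_w (W x k w ^+ 2 + 2 * (keep x (W x k w) * h (Z k w)) + h (Z k w) ^+ 2))).
  apply: le_Rintegral => //.
  - apply: (@bounded_integrable _ _ _ _ _ ((k.+1%:R * M) ^+ 2)).
      exact: measurable_funX.
    by move=> w; rewrite normrX ler_sqr ?nnegrE ?mulr_ge0// W_bound.
  - exact: RintegrableD.
  - move=> w _; rewrite /W /= -/(W x k w) /keep; case: ifPn => _.
      by rewrite le_eqVlt; apply/orP; left; apply/eqP; ring.
    by rewrite addr0 mul0r mulr0 addr0 lerDl sqr_ge0.
rewrite RintegralD// RintegralD// RintegralZl// cross mulr0 addr0.
by rewrite -natr1 mulrDl mul1r lerD.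
Qed.

(** Kolmogorov's maximal inequality, obtained from the second moment of the
    stopped walk: its increments are the original ones times an indicator of
    the past. *)
Lemma kolmogorov_maximal (x : R) N : 0 < x ->
  x ^+ 2 * fine (P [set w | exists2 k, (k <= N)%N & x <= `|Sh k w|]) <= N%:R * v.
Proof.
move=> x0; apply: le_trans (W_second_moment N x0).
apply: markov_le.
- apply: measurable_exists_le => k; apply: measurable_sum => i.
  exact: measurableT_comp.
- apply: (@bounded_integrable _ _ _ _ _ ((N%:R * M) ^+ 2)).
    exact: measurable_funX.
  by move=> w; rewrite normrX ler_sqr ?nnegrE ?mulr_ge0// W_bound.
- by move=> w; exact: sqr_ge0.
- move=> w [k kN xk]; have [h1|h1] := W_exit x N w.
    by have [] := h1 k kN; rewrite ltNge xk.
  by rewrite -[X in _ <= X]real_normK ?num_real// ler_sqr ?nnegrE// ltW.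
Qed.

End kolmogorov.

(** * Characteristic functions of partial sums *)

Section charfun_partial_sum.
Context {R : realType} {d : measure_display} {T : measurableType d}
  (P : probability T R) (Z : nat -> {RV P >-> R}).

Lemma Rintegral_cstP (r : R) : \int[P]_w r = r.
Proof. by rewrite /Rintegral integral_cst//= probability_setT mule1. Qed.

Lemma identically_distributed_Rintegral (g : R -> R) i j :
  identically_distributed Z -> measurable_fun setT g ->
  P.-integrable setT (EFin \o (g \o Z i)) -> P.-integrable setT (EFin \o (g \o Z j)) ->
  \int[P]_w g (Z i w) = \int[P]_w g (Z j w).
Proof.
move=> idZ mg.
have e k : P.-integrable setT (EFin \o (g \o Z k)) ->
    \int[P]_w g (Z k w) = \int[distribution P (Z k)]_x g x.
  move=> Ik; rewrite /Rintegral; congr fine; rewrite integral_distribution//.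
  exact/measurable_EFinP.
move=> /e -> /e ->; rewrite /Rintegral; congr fine.
by apply: eq_measure_integral => A mA _; exact: idZ.
Qed.

Lemma bounded_identically_distributed_Rintegral (g : R -> R) (M : R) i j :
  identically_distributed Z -> measurable_fun setT g -> (forall x, `|g x| <= M) ->
  \int[P]_w g (Z i w) = \int[P]_w g (Z j w).
Proof.
move=> idZ mg gM; apply: identically_distributed_Rintegral => //.
all: by apply: (@bounded_integrable _ _ _ P _ M) => [|w]; [exact: measurableT_comp|exact: gM].
Qed.

(** The characteristic function of X at s, written with real-valued integrals. *)
Definition mean_cexp (X : T -> R) (s : R) : R[i] :=
  (\int[P]_w cos (s * X w) +i* \int[P]_w sin (s * X w))%C.

Lemma measurable_cos_scale (s : R) : measurable_fun setT (fun x : R => cos (s * x)).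
Proof.
apply: continuous_measurable_fun => x.
exact: derivR_continuous (derivR_comp (is_derive_cos (s * x)) (derivR_scale s (derivR_id x))).
Qed.

Lemma measurable_sin_scale (s : R) : measurable_fun setT (fun x : R => sin (s * x)).
Proof.
apply: continuous_measurable_fun => x.
exact: derivR_continuous (derivR_comp (is_derive_sin (s * x)) (derivR_scale s (derivR_id x))).
Qed.

Lemma integrable_cos_scale (X : T -> R) (s : R) : measurable_fun setT X ->
  P.-integrable setT (EFin \o (fun w => cos (s * X w))).
Proof.
move=> mX; apply: (@bounded_integrable _ _ _ P _ 1); last by move=> w; exact: cos_max.
exact: (measurableT_comp (measurable_cos_scale s)).
Qed.

Lemma integrable_sin_scale (X : T -> R) (s : R) : measurable_fun setT X ->
  P.-integrable setT (EFin \o (fun w => sin (s * X w))).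
Proof.
move=> mX; apply: (@bounded_integrable _ _ _ P _ 1); last by move=> w; exact: sin_max.
exact: (measurableT_comp (measurable_sin_scale s)).
Qed.

Lemma measurable_partial_sum n : measurable_fun setT (partial_sum Z n).
Proof. by apply: measurable_sum => i. Qed.

(** The addition formulas of cos and sin are the real form of multiplicativity of
    the exponential; the sum of the first n terms is independent of the next one. *)
Lemma mean_cexp_partial_sum (s : R) n :
  mutually_independent Z -> identically_distributed Z ->
  mean_cexp (partial_sum Z n) s = mean_cexp (Z 0%N) s ^+ n.
Proof.
move=> indZ idZ; elim: n => [|n IH].
  rewrite /mean_cexp /partial_sum expr0.
  under eq_Rintegral do rewrite big_ord0 mulr0 cos0.
  under [X in (_ +i* X)%C]eq_Rintegral do rewrite big_ord0 mulr0 sin0.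
  by rewrite !Rintegral_cstP.
have mS := measurable_partial_sum n.
have mc := measurable_cos_scale s; have ms := measurable_sin_scale s.
have indep : independent_rv P (partial_sum Z n) (Z n).
  apply: (@past_fun_independent _ _ _ P Z indZ n n) => //.
  exact: (@past_fun_sum _ _ _ P Z n id).
have c1 x : `|cos (s * x)| <= 1 by exact: cos_max.
have s1 x : `|sin (s * x)| <= 1 by exact: sin_max.
have mk (f g : R -> R) : measurable_fun setT f -> measurable_fun setT g ->
    (forall x, `|f x| <= 1) -> (forall x, `|g x| <= 1) ->
    P.-integrable setT (EFin \o (fun w => f (partial_sum Z n w) * g (Z n w))).
  move=> mf mg f1 g1; apply: (@bounded_integrable _ _ _ P _ 1).
    by apply: measurable_funM; exact: measurableT_comp.
  by move=> w; rewrite normrM -[leRHS]mulr1 ler_pM.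
have SE w : s * partial_sum Z n.+1 w = s * partial_sum Z n w + s * Z n w.
  by rewrite /partial_sum big_ord_recr/= mulrDr.
have E (M : R) (f g : R -> R) (mf : measurable_fun setT f) (mg : measurable_fun setT g) (f1 : forall x, `|f x| <= M) (g1 : forall x, `|g x| <= M) :=
  expectation_independent mS (@measurable_funPT _ _ _ _ (Z n)) indep mf mg f1 g1.
have ci := bounded_identically_distributed_Rintegral n 0 idZ mc c1.
have si := bounded_identically_distributed_Rintegral n 0 idZ ms s1.
rewrite exprSr -IH /mean_cexp.
transitivity ((\int[P]_w cos (s * partial_sum Z n w) * \int[P]_w cos (s * Z n w) -
               \int[P]_w sin (s * partial_sum Z n w) * \int[P]_w sin (s * Z n w)) +i*
              (\int[P]_w sin (s * partial_sum Z n w) * \int[P]_w cos (s * Z n w) +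
               \int[P]_w cos (s * partial_sum Z n w) * \int[P]_w sin (s * Z n w)))%C.
  congr (_ +i* _)%C.
    under eq_Rintegral do rewrite SE cosD.
    rewrite RintegralB//; [|exact: (mk _ _ mc mc)|exact: (mk _ _ ms ms)].
    by rewrite (E _ _ _ mc mc c1 c1) (E _ _ _ ms ms s1 s1).
  under eq_Rintegral do rewrite SE sinD.
  rewrite RintegralD//; [|exact: (mk _ _ ms mc)|exact: (mk _ _ mc ms)].
  by rewrite (E _ _ _ ms mc s1 c1) (E _ _ _ mc ms c1 s1).
by rewrite ci si; congr (_ +i* _)%C; rewrite addrC mulrC (addrC (_ * _)) mulrC.
Qed.

End charfun_partial_sum.

(** * Potter's bound and the growth of norming sequences *)

Section potter.
Context {R : realType} (H : R -> R) (alpha : R).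
Context (alpha1 : 1 < alpha) (alpha2 : alpha < 2).
Context (H_gt0 : forall x, 0 < H x) (H_le1 : forall x, H x <= 1).
Context (H_noninc : forall x y, x <= y -> H y <= H x).
Context (H_rv : forall l, 0 < l -> H (l * x) / H x @[x --> +oo] --> l `^ (- alpha)).

(** The limit of H (2 x) / H x lies strictly between two powers of 2 with
    exponents on either side of - alpha. *)
Lemma tail_doubling (gamma beta : R) : gamma < alpha -> alpha < beta ->
  exists2 x0, 0 < x0 & forall x, x0 <= x ->
    2 `^ (- beta) * H x <= H (2 * x) <= 2 `^ (- gamma) * H x.
Proof.
move=> ga ab; have h := @H_rv 2 (ltr0Sn R 1).
have l1 : 2 `^ (- beta) < 2 `^ (- alpha) :> R.
  by rewrite /powR gt_eqF// ltr_expR ltr_pM2r ?ln_gt0 ?ltr1n// ltrN2.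
have l2 : 2 `^ (- alpha) < 2 `^ (- gamma) :> R.
  by rewrite /powR gt_eqF// ltr_expR ltr_pM2r ?ln_gt0 ?ltr1n// ltrN2.
have [M1 [_ h1]] := cvgr_ge _ h _ l1; have [M2 [_ h2]] := cvgr_le _ h _ l2.
pose x0 := Num.max 1 (Num.max (M1 + 1) (M2 + 1)).
exists x0; first by rewrite /x0 lt_max ltr01.
move=> x; rewrite /x0 !ge_max => /and3P[_ x1 x2].
apply/andP; split.
  by rewrite -ler_pdivlMr//; apply: h1; rewrite (lt_le_trans _ x1)// ltrDl.
by rewrite -ler_pdivrMr//; apply: h2; rewrite (lt_le_trans _ x2)// ltrDl.
Qed.

Lemma powR_half_step (r u : R) : 0 < u -> 2 `^ r * (u / 2) `^ r = u `^ r.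
Proof. by move=> u0; rewrite -powRM ?divr_ge0 ?ltW// mulrC divfK. Qed.

Lemma powRN_anti (r u v : R) : 0 <= r -> 0 < u -> u <= v -> v `^ (- r) <= u `^ (- r).
Proof.
move=> r0 u0 uv; have v0 := lt_le_trans u0 uv.
by rewrite !powRN lef_pV2 ?posrE ?powR_gt0// ge0_ler_powR// ?nnegrE// ltW.
Qed.

(** Induction on the number of halvings that bring u into [1, 2[. It iterates the
    doubling estimate while its constant is paid only once, on the base range. *)
Lemma dyadic_ind (Q : R -> Prop) :
  (forall u, 1 <= u -> u < 2 -> Q u) ->
  (forall u, 2 <= u -> Q (u / 2) -> Q u) -> forall u, 1 <= u -> Q u.
Proof.
move=> base step u u1.
have [n] : exists n, u < 2 ^+ n.
  exists (Num.truncn u).+1; rewrite (lt_trans (truncnS_gt u))//.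
  by rewrite -natrX ltr_nat ltn_expl.
elim: n u u1 => [|n IH] u u1 un; first by rewrite expr0 ltNge u1 in un.
have [u2|u2] := ltP u 2; first exact: base.
apply: step => //; apply: IH; first by rewrite ler_pdivlMr// mul1r.
by rewrite ltr_pdivrMr// -exprSr.
Qed.

(** For u >= 1 the doubling estimate is iterated upwards from x; for u < 1 it is
    iterated downwards from x to u x, as long as u x >= x0, and below x0 the tail
    is bounded by 1. The exponents 1 + delta and 2 - delta surround alpha, and the
    factor min 1 u turns u ^ (delta - 2) into the integrable u ^ (delta - 1). *)
Lemma potter_bound : exists delta C x0 : R, [/\ 0 < delta <= 1, 0 < C, 0 < x0 &
  forall x u, x0 <= x -> 0 < u ->
    H (u * x) * Num.min 1 u <= C * H x * two_power_kernel delta u].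
Proof.
pose delta := Num.min ((2 - alpha) / 2) ((alpha - 1) / 2).
have d0 : 0 < delta by rewrite /delta lt_min !divr_gt0 ?subr_gt0.
have d1 : delta <= (2 - alpha) / 2 by rewrite /delta ge_min lexx.
have d2 : delta <= (alpha - 1) / 2 by rewrite /delta ge_min lexx orbT.
pose gamma := 1 + delta; pose beta := 2 - delta.
have ga : gamma < alpha by rewrite /gamma; lra.
have ab : alpha < beta by rewrite /beta; lra.
have gamma0 : 0 <= gamma by rewrite /gamma; lra.
have beta0 : 0 <= beta by rewrite /beta; lra.
have [x0 x00 hx0] := tail_doubling ga ab.
have two4 r : 0 <= r -> r <= 2 -> 2 `^ r <= 4 :> R.
  move=> r0 r2; apply: (@le_trans _ _ (2 `^ 2)); first by rewrite ler_powR// ler1n.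
  by rewrite powR_mulrn// -natrX ler_nat.
have upper u x : x0 <= x -> 1 <= u -> H (u * x) <= 2 `^ gamma * u `^ (- gamma) * H x.
  move=> xx0; move: u; apply: dyadic_ind => [u u1 u2|u u2 IH].
    have xpos : 0 < x := lt_le_trans x00 xx0.
    apply: (@le_trans _ _ (H x)); first by apply: H_noninc; rewrite ler_peMl// ltW.
    rewrite ler_peMl ?(ltW (H_gt0 _))// powRN ler_pdivlMr ?powR_gt0 ?(lt_le_trans _ u1)// mul1r.
    by rewrite ge0_ler_powR// ?nnegrE ?(le_trans _ u1)// ltW.
  have u0 : 0 < u by rewrite (lt_le_trans _ u2).
  have xpos : 0 < x := lt_le_trans x00 xx0.
  have -> : u * x = 2 * (u / 2 * x) by field.
  have /hx0 /andP[_ /le_trans] : x0 <= u / 2 * x.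
    by rewrite (le_trans xx0)// ler_peMl ?(ltW xpos)// ler_pdivlMr// mul1r.
  apply; rewrite -(powR_half_step (- gamma) u0).
  rewrite [leRHS](_ : _ = 2 `^ (- gamma) * (2 `^ gamma * (u / 2) `^ (- gamma) * H x)); last by ring.
  by rewrite ler_wpM2l// powR_ge0.
have lower v y : x0 <= y -> 1 <= v -> 2 `^ (- beta) * v `^ (- beta) * H y <= H (v * y).
  move=> yx0; move: v; apply: dyadic_ind => [v v1 v2|v v2 IH].
    have ypos : 0 < y := lt_le_trans x00 yx0.
    apply: (@le_trans _ _ (H (2 * y))); last by apply: H_noninc; rewrite ler_wpM2r// ltW.
    have /andP[+ _] := hx0 _ yx0; apply: le_trans.
    rewrite ler_wpM2r ?(ltW (H_gt0 _))// ler_piMr ?powR_ge0//.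
    have := powRN_anti beta0 ltr01 v1; by rewrite powR1.
  have v0 : 0 < v by rewrite (lt_le_trans _ v2).
  have ypos : 0 < y := lt_le_trans x00 yx0.
  have -> : v * y = 2 * (v / 2 * y) by field.
  have /hx0 /andP[+ _] : x0 <= v / 2 * y.
    by rewrite (le_trans yx0)// ler_peMl ?(ltW ypos)// ler_pdivlMr// mul1r.
  apply: le_trans; rewrite -(powR_half_step (- beta) v0).
  rewrite [leLHS](_ : _ = 2 `^ (- beta) * (2 `^ (- beta) * (v / 2) `^ (- beta) * H y)); last by ring.
  by rewrite ler_wpM2l// powR_ge0.
(* The division by H x0 pays for the range u x < x0, where H (u x) <= 1 is the
   only bound available. *)
exists delta, (4 / H x0), x0; split => //; [by rewrite d0; lra|by rewrite divr_gt0|].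
move=> x u xx0 u0; have xpos : 0 < x := lt_le_trans x00 xx0.
have C4 : 4 <= 4 / H x0 by rewrite ler_peMr// invf_ge1.
rewrite /two_power_kernel; case: ltP => u1; last first.
  rewrite mulr1 (le_trans (upper _ _ xx0 u1))//.
  rewrite mulrAC ler_pM ?mulr_ge0 ?powR_ge0 ?(ltW (H_gt0 _))//.
    by rewrite ler_pM ?powR_ge0 ?(ltW (H_gt0 _))// (le_trans _ C4)// two4//; lra.
  by rewrite /gamma opprD addrC.
have -> : u `^ (delta - 1) = u `^ (- beta) * u.
  by rewrite -[X in _ * X](powRr1 (ltW u0)) -powRDp// /beta; congr (_ `^ _); ring.
rewrite mulrA ler_wpM2r ?(ltW u0)//.
have key y : x0 <= y -> y <= x -> H y <= 4 * (y / x) `^ (- beta) * H x.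
  move=> yx0 yx; have ypos : 0 < y := lt_le_trans x00 yx0.
  have v1 : 1 <= x / y by rewrite ler_pdivlMr// mul1r.
  have := lower _ _ yx0 v1; rewrite divfK ?gt_eqF//.
  rewrite [X in X * H y](_ : _ = (2 `^ beta * (x / y) `^ beta)^-1); last first.
    by rewrite !powRN -invfM.
  have pp : 0 < 2 `^ beta * (x / y) `^ beta by rewrite mulr_gt0 ?powR_gt0 ?divr_gt0.
  rewrite ler_pdivrMl// => /le_trans; apply.
  have e : (x / y) `^ beta * (y / x) `^ beta = 1.
    rewrite -powRM ?divr_ge0 ?ltW// (_ : x / y * (y / x) = 1) ?powR1//.
    by field; rewrite !gt_eqF.
  have -> : (y / x) `^ (- beta) = (x / y) `^ beta.
    have nz : (y / x) `^ beta != 0 by rewrite gt_eqF// powR_gt0// divr_gt0.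
    by rewrite powRN -[RHS]mulr1 -(mulfV nz) mulrA e mul1r.
  rewrite ler_wpM2r ?(ltW (H_gt0 _))// ler_wpM2r ?powR_ge0// two4//.
  by rewrite /beta; lra.
have [ux|ux] := leP x0 (u * x).
  have ux1 : u * x <= x by rewrite ler_piMl// ltW.
  have := key _ ux ux1; rewrite mulfK ?gt_eqF// => /le_trans; apply.
  by rewrite mulrAC ler_wpM2r ?powR_ge0// ler_wpM2r// ltW.
apply: (@le_trans _ _ 1); first exact: H_le1.
have : H x0 <= 4 * u `^ (- beta) * H x.
  apply: le_trans (key _ (lexx _) xx0) _.
  rewrite ler_wpM2r ?(ltW (H_gt0 _))// ler_wpM2l//.
  by apply: powRN_anti => //; rewrite ler_pdivlMr// ltW.
rewrite [X in _ -> _ <= X](_ : _ = (4 * u `^ (- beta) * H x) / H x0); last by ring.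
by rewrite ler_pdivlMr// mul1r.
Qed.

Section norming_sequence.
Context (a : nat -> R).
Context (a_y : a n @[n --> \oo] --> +oo).
Context (a_H : n%:R * H (a n) @[n --> \oo] --> (1 : R)).

Lemma norming_tail (u : R) : 0 < u ->
  n%:R * H (u * a n) @[n --> \oo] --> u `^ (- alpha).
Proof.
move=> u0; have h := cvg_comp _ _ a_y (H_rv u0).
rewrite -[X in _ --> X]mul1r.
rewrite (_ : (fun n => _) = (fun n => n%:R * H (a n) * (H (u * a n) / H (a n)))).
  by apply: cvgM.
by apply/funext => n; field; rewrite gt_eqF.
Qed.

(** If a_k exceeded (1 + r) a_m, monotonicity would bound k H (a_k) by
    (k / m) m H ((1 + r) a_m), whose limit is less than 1 when k / m is close to
    1, against k H (a_k) -> 1; similarly for (1 - r) a_m. *)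
Lemma norming_ratio (r : R) : 0 < r -> r < 1 -> exists2 delta : R, 0 < delta <= 1 / 2 &
  \forall m \near \oo, forall k, `|k%:R - m%:R : R| <= delta * m%:R ->
    `|a k - a m| <= r * a m.
Proof.
move=> r0 r1.
have rp : 0 < 1 + r by rewrite addr_gt0.
have rm : 0 < 1 - r by rewrite subr_gt0.
have alpha0 : 0 < alpha := lt_trans ltr01 alpha1.
have p1 : (1 : R) `^ alpha = 1 by rewrite powR1.
have lt1 : (1 + r) `^ (- alpha) < 1.
  rewrite powRN invf_lt1 ?powR_gt0// -[ltLHS]p1 gt0_ltr_powR// ?nnegrE ?ler01//.
    exact: ltW.
  by rewrite ltrDl.
have gt1 : 1 < (1 - r) `^ (- alpha).
  rewrite powRN invf_gt1 ?powR_gt0// -[ltRHS]p1 gt0_ltr_powR// ?nnegrE ?ler01//.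
    exact: ltW.
  by rewrite ltrBlDr ltrDl.
(* Thresholds that separate 1 from the limits of m H ((1 + r) a_m) and
   m H ((1 - r) a_m). *)
pose t1 := (1 + (1 + r) `^ (- alpha)) / 2.
pose t2 := (1 + (1 - r) `^ (- alpha)) / 2.
have t11 : t1 < 1 by rewrite /t1; lra.
have t10 : 0 < t1 by rewrite /t1 divr_gt0// addr_gt0// powR_gt0.
have t21 : 1 < t2 by rewrite /t2; lra.
pose eta := Num.min ((1 - t1) / 3) ((t2 - 1) / (3 * t2)).
have eta0 : 0 < eta.
  by rewrite /eta lt_min !divr_gt0 ?subr_gt0// mulr_gt0// (lt_trans _ t21).
have eta1 : eta <= (1 - t1) / 3 by rewrite /eta ge_min lexx.
have eta2 : eta * t2 <= (t2 - 1) / 3.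
  have : eta <= (t2 - 1) / (3 * t2) by rewrite /eta ge_min lexx orbT.
  rewrite invfM mulrA ler_pdivlMr//; exact: lt_trans ltr01 t21.
have eta12 : eta <= 1 / 2 by apply: (le_trans eta1); lra.
exists eta; first by rewrite eta0 eta12.
have h1 : (1 + r) `^ (- alpha) < t1 by rewrite /t1; lra.
have h2 : t2 < (1 - r) `^ (- alpha) by rewrite /t2; lra.
have [k0 _ hk0] : \forall k \near \oo, `|1 - k%:R * H (a k)| < eta.
  by move/cvgrPdist_lt : a_H => /(_ _ eta0).
have a_pos : \forall m \near \oo, 0 < a m by move/cvgryPgt : a_y => /(_ 0).
near=> m => k km.
have m0 : 0 < m%:R :> R by rewrite ltr0n; near: m; exact: nbhs_infty_gt.
have am : 0 < a m by near: m.
have T1 : m%:R * H ((1 + r) * a m) <= t1.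
  by near: m; exact: (cvgr_le _ (norming_tail rp) _ h1).
have T2 : t2 <= m%:R * H ((1 - r) * a m).
  by near: m; exact: (cvgr_ge _ (norming_tail rm) _ h2).
have /andP[k1 k2] : (1 - eta) * m%:R <= k%:R <= (1 + eta) * m%:R.
  by move: km; rewrite ler_norml => /andP[? ?]; apply/andP; split; lra.
have : `|1 - k%:R * H (a k)| < eta.
  apply: hk0 => /=; rewrite -(ler_nat R); apply: le_trans k1.
  apply: (@le_trans _ _ (1 / 2 * m%:R)); last by rewrite ler_wpM2r ?(ltW m0)//; lra.
  suff : (k0 + k0)%:R <= m%:R :> R by rewrite natrD; lra.
  by rewrite ler_nat; near: m; exact: nbhs_infty_ge.
rewrite ltr_norml => /andP[b1 b2].
rewrite ler_norml; apply/andP; split; rewrite leNgt; apply/negP => hlt.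
- have hle : a k <= (1 - r) * a m by lra.
  have Hk := H_noninc hle.
  have : (1 - eta) * t2 <= k%:R * H (a k).
    apply: (@le_trans _ _ ((1 - eta) * m%:R * H ((1 - r) * a m))).
      by rewrite -mulrA ler_wpM2l//; lra.
    by rewrite ler_pM ?mulr_ge0 ?(ltW (H_gt0 _)) ?(ltW m0)//; lra.
  have : eta <= eta * t2 by rewrite ler_peMr ?ltW.
  by lra.
- have hle : (1 + r) * a m <= a k by lra.
  have Hk := H_noninc hle.
  have : k%:R * H (a k) <= (1 + eta) * t1.
    apply: (@le_trans _ _ ((1 + eta) * m%:R * H ((1 + r) * a m))).
      by rewrite ler_pM ?(ltW (H_gt0 _)).
    by rewrite -mulrA ler_wpM2l//; lra.
  have : eta * t1 <= eta by rewrite ler_piMr ?ltW.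
  by lra.
Unshelve. all: by end_near. Qed.

End norming_sequence.

End potter.

(** * Truncated moments of a regularly varying tail *)

Section tails.
Context {R : realType}.
Notation mu := (@lebesgue_measure R).
Local Notation halfline := (`]0, +oo[%classic : set R).

Lemma FTC2_open (F f : R -> R) (x : R) : 0 <= x ->
  (forall y : R, is_derive y 1 F (f y)) -> continuous f ->
  mu.-integrable `]0, x[ (EFin \o f) /\
  \int[mu]_(u in `]0, x[) f u = F x - F 0.
Proof.
rewrite le_eqVlt => /predU1P[<- _ _|x0 dF cf].
  by rewrite set_itvoo0 subrr; split; [exact: integrable_set0|rewrite Rintegral_set0].
have [If e] := FTC2_derive x0 (fun y _ => dF y) (fun y _ => cf y).
have Ioo : mu.-integrable `]0, x[ (EFin \o f).
  by apply: integrableS If => //; exact: subset_itv_oo_cc.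
split=> //; rewrite -e Rintegral_itv_bndo_bndc// Rintegral_itv_obnd_cbnd//.
by apply: integrableS If => //; exact: subset_itv_oc_cc.
Qed.

Context {d : measure_display} {T : measurableType d} (P : probability T R).

Lemma measurable_tail (X : T -> R) : measurable_fun setT X ->
  measurable_fun setT (fun u : R => fine (P [set w | u < X w])).
Proof.
move=> mX; pose X' : {RV P >-> R} := mfun_Sub (mem_set mX).
have := measurableT_comp (@fine_measurable R setT measurableT) (ccdf_measurable X').
congr (measurable_fun _ _); apply/funext => u /=.
rewrite /ccdf /distribution /pushforward; congr (fine (P _)).
by apply/seteqP; split => w /=; rewrite in_itv/= andbT.
Qed.

Lemma fine_probability_le1 (A : set T) : measurable A -> fine (P A) <= 1.
Proof.
move=> mA; rewrite -lee_fin fineK ?fin_num_measure//; exact: probability_le1.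
Qed.

End tails.

Section karamata.
Context {R : realType} {d : measure_display} {T : measurableType d}
  (P : probability T R) (X : T -> R).
Context (mX : measurable_fun setT X) (X0 : forall w, 0 <= X w).
Notation mu := (@lebesgue_measure R).
Local Notation halfline := (`]0, +oo[%classic : set R).
Let H (x : R) := fine (P [set w | x < X w]).
Context (delta C x0 : R) (delta0 : 0 < delta) (delta1 : delta <= 1) (C0 : 0 < C) (x00 : 0 < x0).
Context (potter : forall x u, x0 <= x -> 0 < u ->
    H (u * x) * Num.min 1 u <= C * H x * two_power_kernel delta u).

Let K := \int[mu]_(u in halfline) two_power_kernel delta u.

Let H_ge0 x : 0 <= H x. Proof. exact: fine_ge0. Qed.

Let H_noninc x y : x <= y -> H y <= H x.
Proof.
move=> xy; apply: fine_le_measure; [exact: measurable_lt_set..|].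
by move=> w /=; exact: le_lt_trans.
Qed.

Lemma two_power_kernel_integral_ge0 : 0 <= K.
Proof.
apply: Rintegral_ge0 => x /=; rewrite in_itv/= andbT => x0'.
exact/ltW/two_power_kernel_gt0.
Qed.

Let mid (k y : R) : (\int[mu]_(u in halfline) (k * C * H y * two_power_kernel delta u)
   = k * C * H y * K).
Proof. by rewrite RintegralZl//; exact: integrable_two_power_kernel. Qed.

(** The truncated second moment E (min (X / y) 1)^2 is of order H y: in the
    layer cake formula the density 2 u compensates the growth of the tail near 0. *)
Lemma karamata_small (y : R) : x0 <= y ->
  \int[P]_w (Num.min (X w / y) 1) ^+ 2 <= 2 * C * H y * K.
Proof.
move=> xy; have y0 : 0 < y := lt_le_trans x00 xy.
pose Y w := Num.min (X w / y) 1.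
have mY : measurable_fun setT Y.
  by apply: measurable_minr => //; exact: measurable_funM.
have Y0 w : 0 <= Y w by rewrite /Y le_min ler01 andbT divr_ge0// ltW.
have tail u : fine (P [set w | u < Y w]) = if u < 1 then H (u * y) else 0.
  case: ifPn => u1; last first.
    rewrite (_ : [set w | _] = set0) ?measure0//; apply/seteqP; split => w //=.
    by rewrite lt_min (negbTE u1) andbF.
  congr (fine (P _)); apply/seteqP; split => w /=; rewrite /Y lt_min ltr_pdivlMr//.
    by move=> /andP[].
  by move=> ->.
have dF (u : R) : is_derive u 1 (fun v : R => v ^+ 2) (2 * u).
  apply: (is_derive_eq (derivR_mul (derivR_id u) (derivR_id u))); ring.
have cf : continuous (fun u : R => 2 * u).
  by move=> u; exact: derivR_continuous (derivR_scale 2 (derivR_id u)).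
have mf : measurable_fun setT (fun u : R => 2 * u) by exact: continuous_measurable_fun.
have bound u : 0 < u -> 0 <= 2 * u * fine (P [set w | u < Y w]) <= 2 * C * H y * two_power_kernel delta u.
  move=> u0; rewrite tail !mulr_ge0 ?(ltW u0)//=; last by case: ifP.
  case: ifPn => u1; last first.
    by rewrite mulr0 !mulr_ge0 ?(ltW C0)// ltW// two_power_kernel_gt0.
  have := potter xy u0; rewrite (min_r (ltW u1)) => h.
  have -> : 2 * u * H (u * y) = 2 * (H (u * y) * u) by ring.
  by rewrite -!mulrA ler_wpM2l// !mulrA.
have Ik := integrable_two_power_kernelZ (2 * C * H y) delta0.
have Itail : mu.-integrable halfline (EFin \o (fun u => 2 * u * fine (P [set w | u < Y w]))).
  apply: (le_Rintegrable _ _ Ik) => //.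
    by apply: measurable_funM; apply: measurable_funTS => //; exact: measurable_tail.
  move=> u; rewrite /= in_itv/= andbT => u0.
  by have /andP[h1 h2] := bound u u0; rewrite ger0_norm.
have [_ e] := @layer_cake _ _ _ P Y (fun u => 2 * u) (fun u => u ^+ 2) mY Y0 mf
  (fun x x0 => let h := FTC2_open x0 dF cf in
     conj h.1 (etrans h.2 (etrans (congr1 (fun z => x ^+ 2 - z) (expr0n _ 2)) (subr0 _)))) Itail.
rewrite e -mid; apply: le_Rintegral => //.
move=> u; rewrite /= in_itv/= andbT => u0.
by have /andP[] := bound u u0.
Qed.

(** The overshoot E (X / y - 1)+ is of order H y, because alpha > 1; it bounds the
    mean that truncation at y removes from a centred variable. *)
Lemma karamata_large (y : R) : x0 <= y ->
  P.-integrable setT (EFin \o (fun w => Num.max (X w / y - 1) 0)) /\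
  \int[P]_w Num.max (X w / y - 1) 0 <= C * H y * K.
Proof.
move=> xy; have y0 : 0 < y := lt_le_trans x00 xy.
pose Y w := Num.max (X w / y - 1) 0.
have mY : measurable_fun setT Y.
  apply: measurable_maxr => //; apply: measurable_funB => //.
  exact: measurable_funM.
have Y0 w : 0 <= Y w by rewrite /Y le_max lexx orbT.
have tail u : 0 < u -> fine (P [set w | u < Y w]) = H ((1 + u) * y).
  move=> u0; congr (fine (P _)); apply/seteqP; split => w /=; rewrite /Y lt_max ltrBrDl ltr_pdivlMr//.
    by move=> /orP[//|]; rewrite ltNge ltW.
  by move=> ->.
have bound u : 0 < u -> H ((1 + u) * y) <= C * H y * two_power_kernel delta u.
  move=> u0; have u10 : 0 < 1 + u by rewrite addr_gt0.
  have := potter xy u10; rewrite min_l ?mulr1; last by rewrite lerDl ltW.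
  move=> /le_trans; apply; rewrite ler_wpM2l ?mulr_ge0 ?(ltW C0)//.
  rewrite /two_power_kernel ltNge lerDl (ltW u0)/=.
  have d1 : - delta - 1 <= 0 by rewrite subr_le0 (le_trans (y := 0))// oppr_le0 ltW.
  case: ltP => u1; last first.
    have -> : - delta - 1 = - (delta + 1) by ring.
    by apply: powRN_anti; rewrite ?lerDr// addr_ge0// ltW.
  apply: (@le_trans _ _ 1).
    have -> : - delta - 1 = - (delta + 1) by ring.
    have := @powRN_anti R (delta + 1) 1 (1 + u); rewrite powR1; apply; rewrite ?lerDl ?addr_ge0// ltW//.
  have u01 : 0 < u <= 1 by rewrite u0 ltW.
  by rewrite -[leLHS](powRr0 u) ger_powR// subr_le0.
have Ik := integrable_two_power_kernelZ (C * H y) delta0.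
have Itail : mu.-integrable halfline (EFin \o (fun u => 1 * fine (P [set w | u < Y w]))).
  apply: (le_Rintegrable _ _ Ik) => //.
    by apply: measurable_funM => //; apply: measurable_funTS => //; exact: measurable_tail.
  move=> u; rewrite /= in_itv/= andbT => u0.
  by rewrite mul1r tail// ger0_norm// bound.
have cf : continuous (fun _ : R => 1 : R) by move=> u; exact: cvg_cst.
have [I1 e] := @layer_cake _ _ _ P Y (fun u => 1) id mY Y0 (measurable_cst _)
  (fun x x0 => let h := FTC2_open x0 (fun u => derivR_id u) cf in
     conj h.1 (etrans h.2 (subr0 _))) Itail.
split; first exact: I1.
rewrite e -[C * H y]mul1r mulrA -mid; apply: le_Rintegral => //.
  by rewrite mul1r.
move=> u; rewrite /= in_itv/= andbT => u0.
by rewrite !mul1r tail// bound.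
Qed.

End karamata.

(** * A maximal inequality for heavy-tailed partial sums *)

Section clamp.
Context {R : realType}.
Implicit Types y z : R.

Definition clamp (y z : R) : R := Num.max (- y) (Num.min y z).

Lemma measurable_clamp y : measurable_fun setT (clamp y).
Proof. by apply: measurable_maxr => //; exact: measurable_minr. Qed.

Lemma clamp_id y z : `|z| <= y -> clamp y z = z.
Proof. by rewrite ler_norml => /andP[a b]; rewrite /clamp min_r// max_r. Qed.

Lemma norm_clamp y z : 0 < y -> `|clamp y z| = y * Num.min (`|z| / y) 1.
Proof.
move=> y0; have [zy|zy] := leP `|z| y.
  by rewrite clamp_id// min_l ?ler_pdivrMr ?mul1r// mulrC divfK ?gt_eqF.
rewrite min_r ?mulr1; last by rewrite ler_pdivlMr// mul1r ltW.
move: zy; rewrite ltr_normr /clamp => /orP[zy|zy].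
  by rewrite (min_l (ltW zy)) max_r ?gtr0_norm//; lra.
have zy' : z <= y by lra.
by rewrite (min_r zy') max_l ?normrN ?gtr0_norm//; lra.
Qed.

Lemma clamp_bound y z : 0 < y -> `|clamp y z| <= y.
Proof. by move=> y0; rewrite norm_clamp// ler_piMr ?(ltW y0)// ge_min lexx orbT. Qed.

Lemma dist_clamp y z : 0 < y -> `|z - clamp y z| = y * Num.max (`|z| / y - 1) 0.
Proof.
move=> y0; have [zy|zy] := leP `|z| y.
  by rewrite clamp_id// subrr normr0 max_r ?mulr0// subr_le0 ler_pdivrMr// mul1r.
rewrite max_l; last by rewrite subr_ge0 ler_pdivlMr// mul1r ltW.
rewrite mulrBr mulr1 [y * _]mulrC divfK ?gt_eqF//.
move: zy; rewrite ltr_normr /clamp => /orP[zy|zy].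
  by rewrite (min_l (ltW zy)) max_r ?gtr0_norm//; lra.
have zy' : z <= y by lra.
have z0 : z < 0 by lra.
by rewrite (min_r zy') max_l ?ltr0_norm//; lra.
Qed.

End clamp.

Section maximal_inequality.
Context {R : realType} {d : measure_display} {T : measurableType d}
  (P : probability T R) (Z : nat -> {RV P >-> R}).
Context (indepZ : mutually_independent Z) (idZ : identically_distributed Z).
Notation mu := (@lebesgue_measure R).
Local Notation halfline := (`]0, +oo[%classic : set R).
Let H (x : R) := fine (P [set w | x < `|Z 0%N w|]).
Context (delta C x0 : R) (delta0 : 0 < delta) (delta1 : delta <= 1) (C0 : 0 < C) (x00 : 0 < x0).
Context (potter : forall x u, x0 <= x -> 0 < u ->
    H (u * x) * Num.min 1 u <= C * H x * two_power_kernel delta u).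
Context (EZ : ('E_P[Z 0%N] = 0)%E).

Let K := \int[mu]_(u in halfline) two_power_kernel delta u.

Let mabs : measurable_fun setT (fun w => `|Z 0%N w|).
Proof. exact: measurableT_comp. Qed.

Let abs0 w : 0 <= `|Z 0%N w|. Proof. exact: normr_ge0. Qed.

Let H_ge0 x : 0 <= H x. Proof. exact: fine_ge0. Qed.

Let K0 : 0 <= K. Proof. exact: two_power_kernel_integral_ge0. Qed.

(** X is at most x0 times one plus its integrable overshoot over x0. *)
Lemma regular_tail_integrable : P.-integrable setT (EFin \o Z 0%N).
Proof.
have [I1 _] := karamata_large mabs delta0 delta1 C0 x00 potter (lexx x0).
have Ic : P.-integrable setT (EFin \o (fun _ : T => 1 : R)).
  exact: finite_measure_integrable_cst.
have I2 := RintegrableZl x0 measurableT (RintegrableD measurableT I1 Ic).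
apply: (le_Rintegrable _ _ I2) => // w _.
rewrite -ler_pdivrMl// mulrC -lerBlDr le_max lexx//.
Qed.

Lemma tail_identically_distributed i (y : R) :
  fine (P [set w | y < `|Z i w|]) = H y.
Proof.
have mB : measurable [set z : R | y < `|z|].
  exact: measurable_lt_set (@normr_measurable R setT).
by have := idZ i 0 mB; rewrite /distribution /pushforward /H => ->.
Qed.

Lemma measurable_exceedance (y : R) N :
  measurable [set w | exists2 i, (i < N)%N & y < `|Z i w|].
Proof.
rewrite (_ : [set _ | _] = \bigcup_(i in `I_N) [set w | y < `|Z i w|]).
  apply: fin_bigcup_measurable; first exact: finite_II.
  by move=> i _; apply: measurable_lt_set; exact: measurableT_comp.
by apply/seteqP; split => w [k kN h]; exists k.
Qed.

Lemma exceedance_bound (y : R) N :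
  fine (P [set w | exists2 i, (i < N)%N & y < `|Z i w|]) <= N%:R * H y.
Proof.
have mA i : measurable [set w | y < `|Z i w|].
  by apply: measurable_lt_set; exact: measurableT_comp.
elim: N => [|N IH].
  rewrite mul0r (_ : [set _ | _] = set0) ?measure0//.
  by apply/seteqP; split => w // [].
rewrite -natr1 mulrDl mul1r; apply: (le_trans _ (lerD IH (lexx _))).
rewrite -(tail_identically_distributed N).
apply: (le_trans _ (fine_measureU_le P (measurable_exceedance y N) (mA N))).
apply: fine_le_measure; first exact: measurable_exceedance.
  by apply: measurableU => //; exact: measurable_exceedance.
move=> w [j jN h]; move: jN; rewrite ltnS leq_eqVlt.
by case/predU1P => [<-|jN]; [right|left; exists j].
Qed.

(** Truncate the summands at y and centre them at the mean m of the truncated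
    variables. Off the event that some summand exceeds y, of probability at most
    N H y, a partial sum differs from the truncated and centred one by at most
    N |m|; since E Z = 0, |m| is at most y C K H y. If N H y is small this drift is
    below y / 2, and Kolmogorov's inequality at level y / 2 applies; otherwise the
    bound exceeds 1. The constant depends only on those of Potter's bound, so that
    the inequality is uniform over shifts of the sequence. *)
Lemma partial_sum_maximal (y : R) N : x0 <= y ->
  fine (P [set w | exists2 k, (k <= N)%N & y <= `|partial_sum Z k w|]) <=
    (1 + 10 * C * \int[mu]_(u in halfline) two_power_kernel delta u) * N%:R * H y.
Proof.
move=> xy; rewrite -/K; have y0 : 0 < y := lt_le_trans x00 xy.
have mc : measurable_fun setT (clamp y) := measurable_clamp y.
have mcZ i : measurable_fun setT (fun w => clamp y (Z i w)) by exact: measurableT_comp.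
have cy z : `|clamp y z| <= y := clamp_bound z y0.
have Ic i := bounded_integrable P (mcZ i) (fun w => cy (Z i w)).
pose m := \int[P]_w clamp y (Z 0%N w).
have [IX2 EX2] := karamata_large mabs delta0 delta1 C0 x00 potter xy.
have EX1 := karamata_small mabs abs0 delta0 C0 x00 potter xy.
have IZ := regular_tail_integrable.
have EZ0 : \int[P]_w Z 0%N w = 0 by rewrite /Rintegral -expectation_def EZ.
have m_le : `|m| <= y * (C * H y * K).
  have -> : m = - \int[P]_w (Z 0%N w - clamp y (Z 0%N w)) by rewrite RintegralB// EZ0 sub0r opprK.
  rewrite normrN; apply: (le_trans (le_normr_Rintegral _ (RintegrableB measurableT IZ (Ic 0%N)))) => //.
  under eq_Rintegral do rewrite dist_clamp//.
  by rewrite RintegralZl// ler_wpM2l// ltW.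
have m_y : `|m| <= y.
  apply: le_trans (le_normr_Rintegral _ (Ic 0%N)) _ => //.
  rewrite -[leRHS](Rintegral_cstP P); apply: le_Rintegral => //.
  - exact: (integrable_norm (Ic 0%N)).
  - exact: finite_measure_integrable_cst.
pose h z := clamp y z - m.
have mh : measurable_fun setT h by apply: measurable_funB.
have hM z : `|h z| <= y + y by rewrite (le_trans (ler_normB _ _))// lerD.
have h0 i : \int[P]_w h (Z i w) = 0.
  rewrite (bounded_identically_distributed_Rintegral i 0 idZ mh hM) RintegralB//.
    by rewrite Rintegral_cstP subrr.
  exact: finite_measure_integrable_cst.
have IcX2 i : P.-integrable setT (EFin \o (fun w => clamp y (Z i w) ^+ 2)).
  apply: (@bounded_integrable _ _ _ P _ (y ^+ 2)); first exact: measurable_funX.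
  by move=> w; rewrite normrX ler_sqr ?nnegrE// ltW.
have hv i : \int[P]_w h (Z i w) ^+ 2 <= y ^+ 2 * (2 * C * H y * K).
  have mh2 : measurable_fun setT (fun z => h z ^+ 2) by exact: measurable_funX.
  have hM2 z : `|h z ^+ 2| <= (y + y) ^+ 2.
    by rewrite normrX ler_sqr ?nnegrE// addr_ge0// ltW.
  rewrite (bounded_identically_distributed_Rintegral i 0 idZ mh2 hM2).
  have -> : (fun w => h (Z 0%N w) ^+ 2) = (fun w => clamp y (Z 0%N w) ^+ 2 - (2 * m * clamp y (Z 0%N w) - m ^+ 2)).
    by apply/funext => w; rewrite /h; ring.
  have I2 := RintegrableZl (2 * m) measurableT (Ic 0%N).
  have I3 : P.-integrable setT (EFin \o (fun _ : T => m ^+ 2)).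
    exact: finite_measure_integrable_cst.
  rewrite RintegralB//; last exact: RintegrableB.
  rewrite RintegralB// RintegralZl// Rintegral_cstP -/m.
  apply: (@le_trans _ _ (\int[P]_w clamp y (Z 0%N w) ^+ 2)).
    by rewrite gerBl -mulrA -expr2 mulr2n mulrDl !mul1r addrK sqr_ge0.
  have -> : (fun w => clamp y (Z 0%N w) ^+ 2) = (fun w => y ^+ 2 * Num.min (`|Z 0%N w| / y) 1 ^+ 2).
    by apply/funext => w; rewrite -exprMn -norm_clamp// real_normK ?num_real.
  rewrite RintegralZl//; first by rewrite ler_wpM2l// sqr_ge0.
  apply: (@bounded_integrable _ _ _ P _ 1).
    apply: measurable_funX; apply: measurable_minr => //; exact: measurable_funM.
  move=> w; rewrite normrX -[leRHS](expr1n _ 2) ler_sqr ?nnegrE// ger0_norm.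
    by rewrite ge_min lexx orbT.
  by rewrite le_min ler01 andbT divr_ge0// ltW.
have y20 : 0 < y / 2 by rewrite divr_gt0.
have kol := kolmogorov_maximal indepZ mh hM h0 hv N y20.
set A := [set w | exists2 k, (k <= N)%N & y / 2 <= _] in kol.
set B := [set w | _].
have mB : measurable B.
  by apply: measurable_exists_le => k; exact: measurable_partial_sum.
have A_le : fine (P A) <= 8 * C * K * N%:R * H y.
  have : y ^+ 2 / 4 * fine (P A) <= y ^+ 2 / 4 * (8 * C * K * N%:R * H y).
    apply: le_trans (le_trans kol _); first by rewrite expr_div_n -natrX.
    by rewrite le_eqVlt; apply/orP; left; apply/eqP; field.
  by rewrite ler_pM2l// divr_gt0// exprn_gt0.
(* In the first case the bound on the right-hand side is at least 1. *)
have [big|small] := leP 1 (2 * (N%:R * (C * H y * K))).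
  apply: (le_trans (fine_probability_le1 P mB)); apply: (le_trans big).
  rewrite [leLHS](_ : _ = 2 * C * K * N%:R * H y); last by ring.
  rewrite ler_wpM2r// ler_wpM2r//.
  have CK : 0 <= C * K by rewrite mulr_ge0// ltW.
  by rewrite -!mulrA; lra.
set E := [set w | exists2 i, (i < N)%N & y < `|Z i w|].
have mE : measurable E := measurable_exceedance y N.
have mA : measurable A.
  apply: measurable_exists_le => k; apply: measurable_sum => i.
  exact: measurableT_comp.
apply: (@le_trans _ _ (fine (P E) + fine (P A))).
  apply: (le_trans _ (fine_measureU_le P mE mA)).
  apply: fine_le_measure => //; first exact: measurableU.
  move=> w [k kN yS]; apply/or_asboolP; rewrite -implyNb; apply/implyP => nE.
  apply/asboolP; exists k => //.
  have clZ i : (i < N)%N -> clamp y (Z i w) = Z i w.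
    move=> iN; apply: clamp_id; rewrite leNgt; apply/negP => yZ.
    by move/asboolPn : nE; apply; exists i.
  have e : \sum_(i < k) h (Z i w) = partial_sum Z k w - k%:R * m.
    rewrite /partial_sum /h sumrB; congr (_ - _).
      by apply: eq_bigr => i _; rewrite clZ// (leq_trans _ kN).
    by rewrite sumr_const card_ord mulr_natl.
  rewrite e; apply: le_trans (lerB_dist _ _).
  rewrite lerBrDr; apply: le_trans yS.
  rewrite [leRHS](_ : _ = y / 2 + y / 2) ?lerD2l; last by field.
  rewrite normrM ger0_norm//.
  apply: (@le_trans _ _ (N%:R * (y * (C * H y * K)))).
    by rewrite ler_pM// ler_nat.
  rewrite mulrCA ler_wpM2l ?(ltW y0)//; lra.
apply: (le_trans (lerD (exceedance_bound y N) A_le)).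
rewrite -subr_ge0 [leRHS](_ : _ = 2 * C * K * N%:R * H y); last by ring.
by rewrite !mulr_ge0// ltW.
Qed.

End maximal_inequality.

(** * The Cauchy kernel as a Laplace transform *)

Section Fubini_dominated.
Context {R : realType} {d : measure_display} {T : measurableType d}
  (P : probability T R).
Notation mu := (@lebesgue_measure R).

(** A majorant that does not depend on w makes the iterated integral of the
    absolute value finite, since P has mass 1. *)
Lemma Rintegral_Fubini_dominated (f : T -> R -> R) (D : set R) (G : R -> R) :
  measurable (D : set (measurableTypeR R)) ->
  measurable_fun setT (fun z : T * R => f z.1 z.2) ->
  mu.-integrable D (EFin \o G) ->
  (forall w y, D y -> `|f w y| <= G y) ->
  [/\ P.-integrable setT (EFin \o (fun w => \int[mu]_(y in D) f w y)),
      mu.-integrable D (EFin \o (fun y => \int[P]_w f w y)) &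
      \int[P]_w \int[mu]_(y in D) f w y = \int[mu]_(y in D) \int[P]_w f w y].
Proof.
move=> mD mf IG fG.
(* Multiplying by the indicator of D turns the integral over D into one over the
   whole line, as the product of two measures on full spaces requires. *)
pose g w (y : R) := f w y * \1_D y.
have gE w : g w = f w \_ D.
  apply/funext => y; rewrite /g patchE indicE.
  by case: (y \in D); rewrite ?mulr1 ?mulr0.
have mg : measurable_fun setT (fun z : T * measurableTypeR R => g z.1 z.2).
  by apply: measurable_funM => //; exact: measurableT_comp.
have mfw w : measurable_fun setT (f w).
  exact: (measurable_fun_pair2 w mf).
have mfy y : measurable_fun setT (f ^~ y).
  exact: (measurable_fun_pair1 y mf).
have If w : mu.-integrable D (EFin \o f w).
  apply: (le_Rintegrable mD _ IG); last by move=> y Dy; exact: fG.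
  have h : measurable_fun D (f w) by apply: measurable_funTS; exact: mfw.
  exact: h.
have Ig2 w : mu.-integrable setT (EFin \o g w).
  by rewrite gE -restrict_EFin; apply/(integrable_mkcond _ _).1 => //.
have Ig1 y : P.-integrable setT (EFin \o g ^~ y).
  apply: (@bounded_integrable _ _ _ P _ `|G y|).
    by apply: measurable_funM => //; exact: measurable_cst.
  move=> w; rewrite /g indicE; case: (boolP (y \in D)) => yD; last by rewrite mulr0 normr0.
  rewrite mulr1 (le_trans (fG w y _) (ler_norm _))//; exact: set_mem.
have fin : (\int[mu]_y \int[P]_w (`|g w y|)%:E < +oo)%E.
  apply: (@le_lt_trans _ _ (\int[mu]_y (`|(G \_ D) y|)%:E)%E); last first.
    have : mu.-integrable setT (EFin \o (G \_ D)).
      by rewrite -restrict_EFin; apply/(integrable_mkcond _ _).1 => //.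
    by move=> /integrableP[_].
  apply: ge0_le_integral => //.
  - by move=> y _; apply: integral_ge0 => w _; rewrite lee_fin.
  - apply: (measurable_fun_fubini_tonelli_G (fun z : T * measurableTypeR R => (`|g z.1 z.2|)%:E)) => //=.
    by apply/measurable_EFinP; exact: measurableT_comp.
  - apply/measurable_EFinP; apply: measurableT_comp => //.
    by apply/(measurable_restrictT _ _).1 => //; exact: Rintegrable_measurable IG.
  - move=> y _; have -> : (`|(G \_ D) y|%:E = \int[P]_w (`|(G \_ D) y|)%:E)%E.
      by rewrite integral_cst//= probability_setT mule1.
    apply: ge0_le_integral => //.
    + apply/measurable_EFinP; apply: measurableT_comp => //.
      exact: Rintegrable_measurable (Ig1 y).
    + move=> w _; rewrite lee_fin /g indicE patchE; case: (boolP (y \in D)) => yD.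
        rewrite mulr1 (le_trans (fG w y _) (ler_norm _))//; exact: set_mem.
      by rewrite mulr0 !normr0.
have [I1 I2 e] := Rintegral_Fubini mg Ig2 Ig1 fin.
have e1 w : \int[mu]_y g w y = \int[mu]_(y in D) f w y.
  by rewrite [RHS]Rintegral_mkcond -gE.
have e2 : (fun y => \int[P]_w g w y) = (fun y => \int[P]_w f w y) \_ D.
  apply/funext => y; rewrite patchE /g indicE; case: (boolP (y \in D)) => yD.
    by apply: eq_Rintegral => w _; rewrite mulr1.
  by under eq_Rintegral do rewrite mulr0; exact: Rintegral_cstP.
split.
- by move: I1; under eq_fun do rewrite e1.
- by apply/(integrable_mkcond _ _).2 => //; rewrite restrict_EFin -e2.
- rewrite [RHS]Rintegral_mkcond -e2 -e; apply: eq_Rintegral => w _; by rewrite e1.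
Qed.

End Fubini_dominated.

Section cauchy_kernel.
Context {R : realType}.
Notation mu := (@lebesgue_measure R).
Local Notation halfline := (`]0, +oo[%classic : set R).

Lemma expRN_scale_integrable (sigma : R) : 0 < sigma ->
  mu.-integrable halfline (EFin \o (fun s => expR (- (sigma * s)))).
Proof.
move=> s0.
have dF (x : R) := derivR_comp (is_derive_expR _) (derivR_opp (derivR_scale sigma (derivR_id x))).
apply: (@ge0_improper_integrable _ (fun s => - sigma^-1 * expR (- (sigma * s))) _ sigma^-1).
- move=> x x0; apply: (is_derive_eq (derivR_scale (- sigma^-1) (dF x))).
  by field; rewrite gt_eqF.
- by move=> x _; exact: derivR_continuous (dF x).
- by move=> x _; exact: expR_ge0.
- move=> x x0; rewrite normrM normrN (ger0_norm (expR_ge0 _)) gtr0_norm ?invr_gt0//.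
  rewrite ler_piMr ?invr_ge0 ?(ltW s0)// expR_le1 oppr_le0.
  by rewrite mulr_ge0// ltW.
Qed.

(** Up to the factor 1 / pi, the density of the Cauchy law with scale sigma, also
    known as the Poisson kernel of the half-plane. *)
Definition cauchy_kernel (sigma u : R) : R := sigma / (sigma ^+ 2 + u ^+ 2).

Lemma expR_scaleN_cvg0 (sigma : R) : 0 < sigma ->
  expR (- (sigma * x)) @[x --> +oo] --> (0 : R).
Proof.
move=> s0; apply: (@squeeze_cvgr _ _ _ _ (fun=> 0) (fun x => sigma^-1 * x^-1)).
- near=> x; have x0 : 0 < x by near: x; exact: nbhs_pinfty_gt.
  by rewrite expR_ge0/= -invfM expRN_le_inv// mulr_gt0.
- exact: cvg_cst.
- rewrite -[X in _ --> X](mulr0 sigma^-1); apply: cvgMr.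
  apply/(gtr0_cvgV0 (f := fun x : R => x)); last exact: cvg_id.
  exact: nbhs_pinfty_gt.
Unshelve. all: by end_near. Qed.

(** The real part of the Laplace transform of exp (i s u); the primitive is
    explicit. *)
Lemma cauchy_kernelE (sigma u : R) : 0 < sigma ->
  mu.-integrable halfline (EFin \o (fun s => expR (- (sigma * s)) * cos (s * u))) /\
  \int[mu]_(s in halfline) (expR (- (sigma * s)) * cos (s * u)) = cauchy_kernel sigma u.
Proof.
move=> s0; set q := sigma ^+ 2 + u ^+ 2.
have q0 : 0 < q by rewrite /q ltr_pwDl ?sqr_ge0// exprn_gt0.
pose F s := q^-1 * (expR (- (sigma * s)) * (u * sin (s * u) - sigma * cos (s * u))).
have de (x : R) := derivR_comp (is_derive_expR _) (derivR_opp (derivR_scale sigma (derivR_id x))).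
have du (x : R) := derivR_mul (derivR_id x) (derivR_cst u x).
have ds (x : R) := derivR_comp (is_derive_sin _) (du x).
have dc (x : R) := derivR_comp (is_derive_cos _) (du x).
have df (x : R) := derivR_mul (de x) (dc x).
have I : mu.-integrable halfline (EFin \o (fun s => expR (- (sigma * s)) * cos (s * u))).
  apply: (le_Rintegrable _ _ (expRN_scale_integrable s0)) => //.
    by apply: continuous_oy_measurable => x _; exact: derivR_continuous (df x).
  by move=> x _; rewrite normrM ger0_norm ?expR_ge0// ler_piMr ?expR_ge0// cos_max.
split => //.
have Fb (x : R) : `|F x| <= q^-1 * (`|u| + sigma) * expR (- (sigma * x)).
  rewrite /F normrM ger0_norm ?invr_ge0 ?(ltW q0)// -mulrA ler_wpM2l ?invr_ge0 ?(ltW q0)//.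
  rewrite normrM ger0_norm ?expR_ge0// mulrC ler_wpM2r ?expR_ge0//.
  rewrite (le_trans (ler_normB _ _))// !normrM (gtr0_norm s0).
  by rewrite lerD// ?ler_piMr// ?sin_max ?cos_max// ltW.
have dF (x : R) := derivR_scale q^-1 (derivR_mul (de x) (derivR_sub (derivR_scale u (ds x)) (derivR_scale sigma (dc x)))).
transitivity (0 - F 0); first apply: (@improper_FTC2 R F).
- move=> x _; apply: (is_derive_eq (dF x)); rewrite /q.
  by field; rewrite -/q gt_eqF.
- by move=> x _; exact: derivR_continuous (df x).
- exact: I.
- by apply: cvg_at_right_filter; exact: derivR_continuous (dF 0).
- apply: norm_cvg0; apply: (@squeeze_cvgr _ _ _ _ (fun=> 0) (fun x => q^-1 * (`|u| + sigma) * expR (- (sigma * x)))).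
  + by apply: nearW => x; rewrite normr_ge0 Fb.
  + exact: cvg_cst.
  + by rewrite -[X in _ --> X](mulr0 (q^-1 * (`|u| + sigma))); apply: cvgMr; exact: expR_scaleN_cvg0.
- rewrite sub0r /F mulr0 oppr0 expR0 mul0r sin0 cos0 /cauchy_kernel -/q; ring.
Qed.

End cauchy_kernel.

(** * Poisson integrals of continuous functions *)

Section poisson_smoothing.
Context {R : realType}.
Notation mu := (@lebesgue_measure R).
Local Notation halfline := (`]0, +oo[%classic : set R).

(** The second point ranges over the whole line, so that f may be compared with
    its values across the ends of the segment. *)
Lemma heine_cantor (f : R -> R) (a b eps : R) : continuous f -> 0 < eps ->
  exists2 eta : R, 0 < eta & forall x y, a <= x <= b -> `|x - y| < eta -> `|f x - f y| < eps.
Proof.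
move=> cf e0.
(* Compactness is used in its near-covering form: a property that holds near each
   point for all small eta holds on the segment for all small eta. *)
have := (@compact_near_coveringP R `[a, b]).1 (@segment_compact R a b).
move=> /(_ R (0^'+) (fun eta x => forall y, `|x - y| < eta -> `|f x - f y| < eps) _).
have h (x : R) : `[a, b]%classic x -> \forall x' \near x & eta \near 0^'+,
    forall y, `|x' - y| < eta -> `|f x' - f y| < eps.
  move=> _; have e20 : 0 < eps / 2 by rewrite divr_gt0.
  have := cf x; move/cvgrPdist_lt => /(_ _ e20) [r /= r0 hr].
  have r20 : 0 < r / 2 by rewrite divr_gt0.
  exists (ball x (r / 2), [set eta | 0 < eta < r / 2]) => /=.
    split; first exact: nbhsx_ballx.
    near=> eta; apply/andP; split; near: eta; first exact: nbhs_right_gt.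
    exact: nbhs_right_lt.
  move=> [x' eta] /= [xx' /andP[eta0 etar]] y x'y.
  have d1 : `|f x - f x'| < eps / 2 by apply: hr => /=; rewrite (lt_trans xx')//; lra.
  have d2 : `|f x - f y| < eps / 2.
    apply: hr => /=; rewrite (le_lt_trans (ler_distD x' _ _))//.
    by rewrite /ball/= in xx'; lra.
  rewrite (le_lt_trans (ler_distD (f x) _ _))// (distrC (f x')).
  by lra.
move=> /(_ h) [e /= e0' he].
exists (e / 2); first by rewrite divr_gt0.
move=> x y xab xy; apply: (he (e / 2)) => //=.
- by rewrite sub0r normrN gtr0_norm ?divr_gt0//; lra.
- by rewrite divr_gt0.
Unshelve. all: by end_near. Qed.

Lemma cauchy_kernel_ge0 (sigma u : R) : 0 < sigma -> 0 <= cauchy_kernel sigma u.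
Proof. by move=> s0; rewrite divr_ge0 ?addr_ge0 ?sqr_ge0// ltW. Qed.

Lemma cauchy_kernel_le (sigma u eta : R) : 0 < sigma -> 0 < eta -> eta <= `|u| ->
  cauchy_kernel sigma u <= sigma / eta ^+ 2.
Proof.
move=> s0 e0 eu; rewrite ler_pM2l// lef_pV2 ?posrE ?ltr_pwDl ?sqr_ge0 ?exprn_gt0//.
rewrite (@le_trans _ _ (u ^+ 2))// ?lerDr ?sqr_ge0//.
by rewrite -[X in _ <= X]real_normK ?num_real// ler_sqr ?nnegrE// ltW.
Qed.

Lemma cauchy_kernel_bound (sigma u : R) : 0 < sigma -> cauchy_kernel sigma u <= sigma^-1.
Proof.
move=> s0; rewrite /cauchy_kernel -[leRHS](_ : sigma / sigma ^+ 2 = _); last by field; rewrite gt_eqF.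
by rewrite ler_pM2l// lef_pV2 ?posrE ?ltr_pwDl ?sqr_ge0 ?exprn_gt0// lerDl sqr_ge0.
Qed.

Lemma continuous_cauchy_kernel (sigma : R) : 0 < sigma -> continuous (cauchy_kernel sigma).
Proof.
move=> s0 u; have d := derivR_add (derivR_cst (sigma ^+ 2) u) (derivR_mul (derivR_id u) (derivR_id u)).
have nz : sigma ^+ 2 + u * u != 0 by rewrite gt_eqF// -expr2 ltr_pwDl ?sqr_ge0 ?exprn_gt0.
exact: derivR_continuous (derivR_scale sigma (derivR_inv (f := fun y => sigma ^+ 2 + y * y) nz d)).
Qed.

Lemma continuous_cauchy_kernelB (sigma x : R) : 0 < sigma ->
  continuous (fun y => cauchy_kernel sigma (x - y)).
Proof.
move=> s0 y; apply: (continuous_comp (f := fun y => x - y)); last exact: continuous_cauchy_kernel.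
exact: derivR_continuous (derivR_sub (derivR_cst x y) (derivR_id y)).
Qed.

Lemma segment_integrable_cst (a b k : R) :
  mu.-integrable `[a, b] (EFin \o (fun=> k)).
Proof.
apply: continuous_compact_integrable; first exact: segment_compact.
by apply: continuous_subspaceT => y; exact: cvg_cst.
Qed.

Lemma cauchy_mass (sigma B x : R) : 0 < sigma -> 0 < B ->
  mu.-integrable `[(- B), B] (EFin \o (fun y => cauchy_kernel sigma (x - y))) /\
  \int[mu]_(y in `[(- B), B]) cauchy_kernel sigma (x - y) =
    atan ((B - x) / sigma) + atan ((B + x) / sigma).
Proof.
move=> s0 B0; have BB : - B < B by lra.
have dF (y : R) : is_derive y 1 (fun y => atan ((y - x) / sigma)) (cauchy_kernel sigma (x - y)).
  have d := derivR_comp (is_derive1_atan _) (derivR_mul (derivR_sub (derivR_id y) (derivR_cst x y)) (derivR_cst sigma^-1 y)).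
  apply: (is_derive_eq d); rewrite /cauchy_kernel; field.
  apply/andP; split; rewrite gt_eqF//.
  by rewrite ltr_pwDl ?sqr_ge0 ?exprn_gt0.
have [I e] := FTC2_derive BB (fun y _ => dF y) (fun y _ => @continuous_cauchy_kernelB sigma x s0 y).
split => //; rewrite e -[X in _ - X]opprK -atanN opprK; congr (_ + atan _); ring.
Qed.

(** The Poisson integral at height sigma of f restricted to [- B, B]; the
    restriction keeps the domain of integration compact. *)
Definition poisson_integral (sigma B : R) (f : R -> R) (x : R) : R :=
  pi^-1 * \int[mu]_(y in `[(- B), B]) (f y * cauchy_kernel sigma (x - y)).

(** As sigma tends to 0 the Cauchy laws concentrate at 0. The error splits into
    the points y with |x - y| < eta, handled by uniform continuity, the points with
    |x - y| >= eta, where the kernel is at most sigma / eta ^ 2, and f x times the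
    missing mass, which tends to 0 uniformly on the support of f as the margin 1
    around it keeps x away from the ends of the segment. *)
Lemma poisson_integral_approx (f : R -> R) (M A eps : R) : continuous f ->
  (forall x, `|f x| <= M) -> 0 < A -> (forall x, A < `|x| -> f x = 0) -> 0 < eps ->
  exists2 sigma, 0 < sigma & forall x, `|poisson_integral sigma (A + 1) f x - f x| <= eps.
Proof.
move=> cf fM A0 fA e0; set B := A + 1.
have B0 : 0 < B by rewrite addr_gt0.
have pi0 := @pi_gt0 R.
have M0 : 0 <= M by apply: le_trans (fM 0).
have e30 : 0 < eps / 3 by rewrite divr_gt0.
have [eta0 eta00 unif0] := @heine_cantor f (- B) B _ cf e30.
pose eta := Num.min eta0 1.
have eta_gt0 : 0 < eta by rewrite /eta lt_min eta00 ltr01.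
have unif x y : `|x - y| < eta -> `|f x - f y| <= eps / 3.
  rewrite /eta lt_min => /andP[h1 h2].
  have [xB|xB] := boolP (- B <= x <= B); first exact/ltW/unif0.
  rewrite -ler_norml -ltNge in xB.
  have Ay : A < `|y|.
    have := ler_dist_dist x y => /le_lt_trans/(_ h2).
    by rewrite ltr_norml => /andP[_]; rewrite /B in xB; lra.
  by rewrite !fA ?subrr ?normr0 ?ltW//; rewrite /B in xB; lra.
(* z stands for 1 / sigma, so that both conditions are limits at infinity. *)
have [z z0 [hz1 hz2]] : exists2 z : R, 0 < z &
    M * (1 - 2 * atan z / pi) <= eps / 3 /\ pi^-1 * (2 * M * 2 * B / eta ^+ 2) / z <= eps / 3.
  have c1 : M * (1 - 2 * atan z / pi) @[z --> +oo] --> (0 : R).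
    have -> : 0 = M * (1 - 2 * (pi / 2) / pi) by rewrite [2 * _]mulrC divfK// divff ?gt_eqF// subrr mulr0.
    apply: cvgMr; apply: cvgB; first exact: cvg_cst.
    apply: cvgMl; apply: cvgMr; exact: cvgy_atan.
  have c2 : pi^-1 * (2 * M * 2 * B / eta ^+ 2) / z @[z --> +oo] --> (0 : R).
    rewrite -[X in _ --> X](mulr0 (pi^-1 * (2 * M * 2 * B / eta ^+ 2))).
    apply: cvgMr; apply/(gtr0_cvgV0 (f := fun x : R => x)); last exact: cvg_id.
    exact: nbhs_pinfty_gt.
  near (+oo : set_system R) => z; exists z; first by near: z; exact: nbhs_pinfty_gt.
  split; near: z; [exact: (cvgr_le _ c1)|exact: (cvgr_le _ c2)].
pose sigma := z^-1.
have s0 : 0 < sigma by rewrite invr_gt0.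
exists sigma => // x.
have [Ik ek] := cauchy_mass x s0 B0.
set mass := \int[mu]_(y in _) _ in ek.
have mass_le : mass <= pi.
  by rewrite ek; have := atan_ltpi2 ((B - x) / sigma); have := atan_ltpi2 ((B + x) / sigma); lra.
have cck := @continuous_cauchy_kernelB sigma x s0.
have mck : measurable_fun `[(- B), B] (fun y => cauchy_kernel sigma (x - y)).
  by apply: measurable_funTS; exact: continuous_measurable_fun.
have mf : measurable_fun `[(- B), B] f.
  by apply: measurable_funTS; exact: continuous_measurable_fun.
have mB : measurable (`[(- B), B] : set (measurableTypeR R)) by exact: measurable_itv.
have IMk := RintegrableZl M mB Ik.
have Ifk : mu.-integrable `[(- B), B] (EFin \o (fun y => f y * cauchy_kernel sigma (x - y))).
  apply: (le_Rintegrable mB _ IMk); first exact: measurable_funM.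
  by move=> y _; rewrite normrM (ger0_norm (cauchy_kernel_ge0 _ s0)) ler_wpM2r ?cauchy_kernel_ge0.
have Ifx := RintegrableZl (f x) mB Ik.
have e1 : poisson_integral sigma B f x - f x =
    pi^-1 * (\int[mu]_(y in `[(- B), B]) (f y * cauchy_kernel sigma (x - y) - f x * cauchy_kernel sigma (x - y)))
    - f x * (1 - mass / pi).
  have alg (p I m : R) : p != 0 -> p^-1 * I - f x = p^-1 * (I - f x * m) - f x * (1 - m / p).
    by move=> p0; field.
  by rewrite RintegralB// RintegralZl// -/mass /poisson_integral; apply: alg; rewrite gt_eqF.
rewrite e1 (le_trans (ler_normB _ _))//.
have fin k : \int[mu]_(y in `[(- B), B]) k = k * (2 * B).
  have BB : - B < B by lra.
  have dk (y : R) : is_derive y 1 (fun y => k * y) k.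
    by apply: (is_derive_eq (derivR_scale k (derivR_id y))); rewrite mulr1.
  have [_ ->] := FTC2_derive BB (fun y _ => dk y) (fun y _ => cvg_cst k); ring.
have t1 : `|pi^-1 * (\int[mu]_(y in `[(- B), B]) (f y * cauchy_kernel sigma (x - y) - f x * cauchy_kernel sigma (x - y)))|
    <= eps / 3 + eps / 3.
  have Ic := segment_integrable_cst (- B) B (2 * M * (sigma / eta ^+ 2)).
  have Ie := RintegrableZl (eps / 3) mB Ik.
  have Id := RintegrableB mB Ifk Ifx.
  rewrite normrM (gtr0_norm (_ : 0 < pi^-1)) ?invr_gt0//.
  apply: (@le_trans _ _ (pi^-1 * (\int[mu]_(y in `[(- B), B]) (eps / 3 * cauchy_kernel sigma (x - y) + 2 * M * (sigma / eta ^+ 2))))).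
    rewrite ler_wpM2l ?invr_ge0 ?(ltW pi0)//.
    apply: (le_trans (le_normr_Rintegral mB Id)); apply: le_Rintegral => //.
    - exact: integrable_norm.
    - exact: RintegrableD.
    move=> y _; rewrite -mulrBl normrM (ger0_norm (cauchy_kernel_ge0 _ s0)).
    have s2 : 0 <= sigma / eta ^+ 2 by rewrite divr_ge0 ?sqr_ge0// ltW.
    have [xy|xy] := ltP `|x - y| eta.
      apply: (@le_trans _ _ (eps / 3 * cauchy_kernel sigma (x - y))).
        by rewrite ler_wpM2r ?cauchy_kernel_ge0// distrC unif.
      by rewrite lerDl (mulr_ge0 (mulr_ge0 _ M0) s2).
    apply: (@le_trans _ _ (2 * M * (sigma / eta ^+ 2))); last first.
      by rewrite lerDr mulr_ge0 ?cauchy_kernel_ge0// ltW.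
    rewrite ler_pM ?cauchy_kernel_ge0//.
      by rewrite (le_trans (ler_normB _ _))// mulr_natl mulr2n lerD.
    exact: cauchy_kernel_le.
  rewrite RintegralD// RintegralZl// -/mass fin mulrDr lerD//.
    rewrite mulrCA ler_piMr ?(ltW e30)// mulrC ler_pdivrMr// mul1r//.
  apply: le_trans hz2; rewrite le_eqVlt; apply/orP; left; apply/eqP.
  by rewrite -[RHS]mulrA; congr (_ * _); rewrite /sigma; field; rewrite !gt_eqF.
have t2 : `|f x * (1 - mass / pi)| <= eps / 3.
  have [Ax|xA] := ltP A `|x|.
    by rewrite fA// mul0r normr0 ltW.
  have m1 : 0 <= 1 - mass / pi by rewrite subr_ge0 ler_pdivrMr// mul1r.
  rewrite normrM (ger0_norm m1); apply: le_trans hz1.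
  rewrite ler_pM// lerD2l lerN2 ler_wpM2r ?invr_ge0 ?(ltW pi0)// ek mulr_natl mulr2n.
  move: xA; rewrite ler_norml => /andP[x1 x2].
  by rewrite lerD// le_atan// /sigma invrK ler_peMl ?(ltW z0)// /B; lra.
by rewrite (le_trans (lerD t1 t2))//; lra.
Unshelve. all: by end_near. Qed.

End poisson_smoothing.

(** * The Levy continuity theorem *)

Section cauchy_mean.
Context {R : realType} {d : measure_display} {T : measurableType d}
  (P : probability T R) (X : T -> R).
Context (mX : measurable_fun setT X).
Notation mu := (@lebesgue_measure R).
Local Notation halfline := (`]0, +oo[%classic : set R).

(** exp (- sigma s) times the real part of exp (- i s y) E exp (i s X). *)
Definition damped_charfun (sigma y s : R) : R :=
  expR (- (sigma * s)) * (cos (s * y) * \int[P]_w cos (s * X w) +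
                          sin (s * y) * \int[P]_w sin (s * X w)).

Let IcosX s := integrable_cos_scale P s mX.
Let IsinX s := integrable_sin_scale P s mX.

(** The Laplace representation of the Cauchy kernel and Fubini's theorem express
    the density of X plus an independent Cauchy variable by the characteristic
    function of X. *)
Lemma cauchy_mean (sigma y : R) : 0 < sigma ->
  mu.-integrable halfline (EFin \o damped_charfun sigma y) /\
  \int[P]_w cauchy_kernel sigma (X w - y) =
  \int[mu]_(s in halfline) damped_charfun sigma y s.
Proof.
move=> s0; pose f w s := expR (- (sigma * s)) * cos (s * (X w - y)).
have mf : measurable_fun setT (fun z : T * R => f z.1 z.2).
  apply: measurable_funM.
    apply: (measurableT_comp (f := fun s : R => expR (- (sigma * s)))) => //.
    apply: continuous_measurable_fun => s.
    exact: derivR_continuous (derivR_comp (is_derive_expR _) (derivR_opp (derivR_scale sigma (derivR_id s)))).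
  apply: measurableT_comp; first by apply: continuous_measurable_fun; exact: continuous_cos.
  apply: measurable_funM => //; apply: measurable_funB => //.
  exact: measurableT_comp.
have fb w s : halfline s -> `|f w s| <= expR (- (sigma * s)).
  by move=> _; rewrite normrM ger0_norm ?expR_ge0// ler_piMr ?expR_ge0// cos_max.
have [_ I2 e] := Rintegral_Fubini_dominated P (measurable_itv _) mf (expRN_scale_integrable s0) fb.
have fE s : \int[P]_w f w s = damped_charfun sigma y s.
  rewrite /f /damped_charfun.
  transitivity (\int[P]_w (expR (- (sigma * s)) * (cos (s * y) * cos (s * X w) + sin (s * y) * sin (s * X w)))).
    by apply: eq_Rintegral => w _; rewrite mulrBr cosB; congr (_ * _); ring.
  have I3 := RintegrableZl (cos (s * y)) measurableT (IcosX s).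
  have I4 := RintegrableZl (sin (s * y)) measurableT (IsinX s).
  rewrite RintegralZl//; last exact: RintegrableD.
  by rewrite RintegralD// !RintegralZl.
have -> : damped_charfun sigma y = fun s => \int[P]_w f w s.
  by apply/funext => s; rewrite fE.
split; first exact: I2.
rewrite -e; apply: eq_Rintegral => w _.
by rewrite /f (cauchy_kernelE _ s0).2.
Qed.

Lemma damped_charfun_bound (sigma y s : R) : 0 < sigma ->
  `|damped_charfun sigma y s| <= 2 * expR (- (sigma * s)).
Proof.
move=> s0; rewrite normrM ger0_norm ?expR_ge0// mulrC ler_wpM2r ?expR_ge0//.
have h g : P.-integrable setT (EFin \o g) -> (forall w, `|g w| <= 1) -> `|\int[P]_w g w| <= 1.
  move=> Ig g1; apply: le_trans (le_normr_Rintegral _ Ig) _ => //.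
  rewrite -[leRHS](Rintegral_cstP P); apply: le_Rintegral => //.
  - exact: integrable_norm.
  - exact: finite_measure_integrable_cst.
rewrite (le_trans (ler_normD _ _))// !normrM (_ : 2 = 1 * 1 + 1 * 1); last by ring.
rewrite lerD// ler_pM//; [exact: cos_max| |exact: sin_max|].
- by apply: h => // w; exact: cos_max.
- by apply: h => // w; exact: sin_max.
Qed.

Lemma poisson_integral_mean (sigma B M : R) (f : R -> R) : 0 < sigma -> continuous f ->
  (forall x, `|f x| <= M) ->
  [/\ P.-integrable setT (EFin \o (fun w => poisson_integral sigma B f (X w))),
      mu.-integrable `[(- B), B] (EFin \o (fun y => f y * \int[P]_w cauchy_kernel sigma (X w - y))) &
  \int[P]_w poisson_integral sigma B f (X w) =
  pi^-1 * \int[mu]_(y in `[(- B), B]) (f y * \int[P]_w cauchy_kernel sigma (X w - y))].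
Proof.
move=> s0 cf fM; have mf : measurable_fun setT f by exact: continuous_measurable_fun.
have mck : measurable_fun setT (cauchy_kernel sigma).
  by apply: continuous_measurable_fun; exact: continuous_cauchy_kernel.
have mF : measurable_fun setT (fun z : T * R => f z.2 * cauchy_kernel sigma (X z.1 - z.2)).
  apply: measurable_funM; first exact: measurableT_comp.
  apply: measurableT_comp => //; apply: measurable_funB => //.
  exact: measurableT_comp.
have M0 : 0 <= M by apply: le_trans (fM 0).
have mB : measurable (`[(- B), B] : set (measurableTypeR R)) by exact: measurable_itv.
have Ic := segment_integrable_cst (- B) B (M * sigma^-1).
have Fb w y : `[(- B), B]%classic y -> `|f y * cauchy_kernel sigma (X w - y)| <= M * sigma^-1.
  move=> _; rewrite normrM (ger0_norm (cauchy_kernel_ge0 _ s0)) ler_pM ?cauchy_kernel_ge0//.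
  exact: cauchy_kernel_bound.
have [I1 I2 e] := @Rintegral_Fubini_dominated _ _ _ P
  (fun w y => f y * cauchy_kernel sigma (X w - y)) _ _ mB mF Ic Fb.
have E y : \int[P]_w (f y * cauchy_kernel sigma (X w - y)) = f y * \int[P]_w cauchy_kernel sigma (X w - y).
  rewrite RintegralZl//; apply: (@bounded_integrable _ _ _ P _ sigma^-1).
    by apply: (measurableT_comp mck); exact: measurable_funB.
  by move=> w; rewrite ger0_norm ?cauchy_kernel_ge0// cauchy_kernel_bound.
split.
- exact: (RintegrableZl pi^-1 measurableT I1).
- by move: I2; congr (_.-integrable _ _); apply/funext => y /=; rewrite E.
- rewrite /poisson_integral RintegralZl// e; congr (_ * _).
  by apply: eq_Rintegral => y _.
Qed.

End cauchy_mean.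

Section levy.
Context {R : realType} {d d' : measure_display} {T : measurableType d}
  {T' : measurableType d'} (P : probability T R) (P' : probability T' R)
  (X : nat -> T -> R) (Y : T' -> R).
Context (mX : forall n, measurable_fun setT (X n)) (mY : measurable_fun setT Y).
Context (cosXY : forall s, \int[P]_w cos (s * X n w) @[n --> \oo] --> \int[P']_w cos (s * Y w)).
Context (sinXY : forall s, \int[P]_w sin (s * X n w) @[n --> \oo] --> \int[P']_w sin (s * Y w)).
Notation mu := (@lebesgue_measure R).
Local Notation halfline := (`]0, +oo[%classic : set R).

(** The characteristic functions converge pointwise and are bounded by 1, so
    the factor exp (- sigma s) dominates. *)
Lemma cauchy_mean_cvg (sigma y : R) : 0 < sigma ->
  \int[P]_w cauchy_kernel sigma (X n w - y) @[n --> \oo] -->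
  \int[P']_w cauchy_kernel sigma (Y w - y).
Proof.
move=> s0; rewrite (cauchy_mean P' mY y s0).2.
under eq_fun do rewrite (cauchy_mean P (mX _) y s0).2.
have mH : measurable (halfline : set (measurableTypeR R)) by exact: measurable_itv.
have I2 := RintegrableZl 2 mH (expRN_scale_integrable s0).
have [n|s _|n s _|_] := @Rintegral_dominated _ _ _ mu halfline
  (fun n => damped_charfun P (X n) sigma y) (damped_charfun P' Y sigma y) _ mH _ _ I2.
- exact: Rintegrable_measurable (cauchy_mean P (mX n) y s0).1.
- apply: cvgMr; apply: cvgD; apply: cvgMr; [exact: cosXY|exact: sinXY].
- exact: damped_charfun_bound.
- by [].
Qed.

Lemma poisson_integral_mean_cvg (sigma B M : R) (f : R -> R) : 0 < sigma -> continuous f ->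
  (forall x, `|f x| <= M) ->
  \int[P]_w poisson_integral sigma B f (X n w) @[n --> \oo] -->
  \int[P']_w poisson_integral sigma B f (Y w).
Proof.
move=> s0 cf fM; have [_ _ ->] := poisson_integral_mean P' mY B s0 cf fM.
under eq_fun do rewrite (let: And3 _ _ e := poisson_integral_mean P (mX _) B s0 cf fM in e).
apply: cvgMr.
have mB : measurable (`[(- B), B] : set (measurableTypeR R)) by exact: measurable_itv.
have Ic := segment_integrable_cst (- B) B (M * sigma^-1).
have M0 : 0 <= M by apply: le_trans (fM 0).
have mck n y : measurable_fun setT (fun w => cauchy_kernel sigma (X n w - y)).
  apply: measurableT_comp; last exact: measurable_funB.
  by apply: continuous_measurable_fun; exact: continuous_cauchy_kernel.
have [n|y _|n y _|_] := @Rintegral_dominated _ _ _ mu `[(- B), B]%classic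
  (fun n y => f y * \int[P]_w cauchy_kernel sigma (X n w - y))
  (fun y => f y * \int[P']_w cauchy_kernel sigma (Y w - y)) _ mB _ _ Ic.
- by have [_ I _] := poisson_integral_mean P (mX n) B s0 cf fM; exact: Rintegrable_measurable I.
- by apply: cvgMr; exact: cauchy_mean_cvg.
- have Ik : P.-integrable setT (EFin \o (fun w => cauchy_kernel sigma (X n w - y))).
    apply: (@bounded_integrable _ _ _ P _ sigma^-1) => //.
    by move=> w; rewrite ger0_norm ?cauchy_kernel_ge0// cauchy_kernel_bound.
  rewrite normrM ler_pM// ger0_norm; last by apply: Rintegral_ge0 => w _; exact: cauchy_kernel_ge0.
  rewrite -[leRHS](Rintegral_cstP P); apply: le_Rintegral => //.
  + exact: finite_measure_integrable_cst.
  + by move=> w _; exact: cauchy_kernel_bound.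
- by [].
Qed.

Lemma mean_dist_le d0 (T0 : measurableType d0) (Q : probability T0 R) (g h : T0 -> R) (e : R) :
  Q.-integrable setT (EFin \o g) -> Q.-integrable setT (EFin \o h) ->
  (forall w, `|g w - h w| <= e) -> `|\int[Q]_w g w - \int[Q]_w h w| <= e.
Proof.
move=> Ig Ih gh; rewrite -RintegralB//.
have Id := RintegrableB measurableT Ig Ih.
apply: le_trans (le_normr_Rintegral _ Id) _ => //.
rewrite -[leRHS](Rintegral_cstP Q); apply: le_Rintegral => //.
- exact: integrable_norm.
- exact: finite_measure_integrable_cst.
Qed.

Let Icf d0 (T0 : measurableType d0) (Q : probability T0 R) (V : T0 -> R) (f : R -> R) (M : R) :
  measurable_fun setT V -> continuous f -> (forall x, `|f x| <= M) ->
  Q.-integrable setT (EFin \o (fun w => f (V w))).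
Proof.
move=> mV cf fM; apply: (@bounded_integrable _ _ _ Q _ M) => //.
by apply: measurableT_comp => //; exact: continuous_measurable_fun.
Qed.

(** Weak convergence against compactly supported functions: these are
    uniform limits of their Poisson integrals, for which convergence follows
    from that of the characteristic functions. *)
Lemma levy_compact_support (f : R -> R) (M A : R) : continuous f ->
  (forall x, `|f x| <= M) -> 0 < A -> (forall x, A < `|x| -> f x = 0) ->
  \int[P]_w f (X n w) @[n --> \oo] --> \int[P']_w f (Y w).
Proof.
move=> cf fM A0 fA; apply/cvgrPdist_le => eps e0.
have e3 : 0 < eps / 3 by rewrite divr_gt0.
have [sigma s0 sf] := poisson_integral_approx cf fM A0 fA e3.
have /cvgrPdist_le/(_ _ e3) := @poisson_integral_mean_cvg sigma (A + 1) M f s0 cf fM.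
apply: filterS => n hn.
have [IX _ _] := poisson_integral_mean P (mX n) (A + 1) s0 cf fM.
have [IY _ _] := poisson_integral_mean P' mY (A + 1) s0 cf fM.
have d1 := mean_dist_le IX (Icf P (mX n) cf fM) (fun w => sf (X n w)).
have d2 := mean_dist_le IY (Icf P' mY cf fM) (fun w => sf (Y w)).
move: hn d1 d2; rewrite !ler_norml => /andP[? ?] /andP[? ?] /andP[? ?].
by apply/andP; split; lra.
Qed.

Let cutoff (K x : R) : R := Num.max 0 (Num.min 1 (K + 1 - `|x|)).

Let cutoff01 K x : 0 <= cutoff K x <= 1.
Proof. by rewrite /cutoff le_max lexx/= ge_max ler01 ge_min lexx. Qed.

Let cutoff1 K x : `|x| <= K -> cutoff K x = 1.
Proof. by move=> xK; rewrite /cutoff min_l ?max_r//; lra. Qed.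

Let cutoff0 K x : K + 1 < `|x| -> cutoff K x = 0.
Proof. by move=> xK; rewrite /cutoff max_l// ge_min; apply/orP; right; lra. Qed.

Let cutoff_continuous K : continuous (cutoff K).
Proof.
move=> x; have c0 : {for x, continuous (fun=> 0 : R)} by exact: cvg_cst.
have c1 : {for x, continuous (fun=> 1 : R)} by exact: cvg_cst.
have cK : {for x, continuous (fun x : R => K + 1 - `|x|)}.
  by apply: cvgB; [exact: cvg_cst|exact: norm_continuous].
exact: (continuous_max c0 (continuous_min c1 cK)).
Qed.

Let cutoff_norm K x : `|cutoff K x| <= 1.
Proof. by have /andP[h1 h2] := cutoff01 K x; rewrite ger0_norm. Qed.

(** A continuous cutoff of large support has mean close to 1 under the limit law,
    hence also along the sequence, by convergence for compactly supported functions;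
    this tightness makes the part of f removed by the cutoff negligible. *)
Lemma levy_continuity (f : R -> R) (M : R) : continuous f ->
  (forall x, `|f x| <= M) ->
  \int[P]_w f (X n w) @[n --> \oo] --> \int[P']_w f (Y w).
Proof.
move=> cf fM; have M0 : 0 <= M by apply: le_trans (fM 0).
apply/cvgrPdist_le => eps e0; pose eta := eps / (4 * (M + 1)).
have eta0 : 0 < eta by rewrite divr_gt0// mulr_gt0// ltr_wpDl.
have etaM : M * eta <= eps / 4.
  have -> : M * eta = eps / 4 * (M / (M + 1)) by rewrite /eta; field; rewrite gt_eqF ?ltr_wpDl.
  have e4 : 0 <= eps / 4 by rewrite divr_ge0// ltW.
  by rewrite (ler_piMr e4)// ler_pdivrMr ?mul1r ?lerDl// ltr_wpDl.
have c1 : \int[P']_w cutoff K%:R (Y w) @[K --> \oo] --> (1 : R).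
  rewrite -[X in _ --> X](Rintegral_cstP P').
  have [K|w _||K w _|_] := @Rintegral_dominated _ _ _ P' setT
    (fun K w => cutoff K%:R (Y w)) (fun=> 1) (fun=> 1) measurableT _ _ _.
  - by apply: measurableT_comp => //; apply: continuous_measurable_fun; exact: cutoff_continuous.
  - apply: cvg_near_cst; near=> K; apply: cutoff1.
    by near: K; exact: nbhs_infty_ger.
  - exact: finite_measure_integrable_cst.
  - exact: cutoff_norm.
  - by [].
have [k hk] : exists k : nat, 1 - eta <= \int[P']_w cutoff k%:R (Y w).
  have lt1 : 1 - eta < 1 by rewrite ltrBlDr ltrDl.
  near \oo => k; exists k; near: k; exact: (cvgr_ge _ c1 _ lt1).
pose chi := cutoff k%:R.
have k10 : 0 < k%:R + 1 :> R by rewrite ltr_wpDl.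
have cchi : continuous chi by exact: cutoff_continuous.
have h1 := levy_compact_support cchi (cutoff_norm k%:R) k10 (@cutoff0 k%:R).
pose g x := f x * chi x.
have cg : continuous g by move=> x; apply: cvgM; [exact: cf|exact: cchi].
have gM x : `|g x| <= M by rewrite normrM -[leRHS]mulr1 ler_pM// cutoff_norm.
have gA x : k%:R + 1 < `|x| -> g x = 0 by move=> h; rewrite /g /chi cutoff0// mulr0.
have h2 := levy_compact_support cg gM k10 gA.
have tail d0 (T0 : measurableType d0) (Q : probability T0 R) (V : T0 -> R) :
    measurable_fun setT V ->
    `|\int[Q]_w f (V w) - \int[Q]_w g (V w)| <= M * (1 - \int[Q]_w chi (V w)).
  move=> mV; have If := Icf Q mV cf fM; have Ig := Icf Q mV cg gM.
  have Ichi := Icf Q mV cchi (cutoff_norm k%:R).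
  have I1 : Q.-integrable setT (EFin \o (fun _ : T0 => 1 : R)).
    exact: finite_measure_integrable_cst.
  have Id := RintegrableB measurableT If Ig.
  have I1c := RintegrableB measurableT I1 Ichi.
  rewrite -RintegralB//; apply: le_trans (le_normr_Rintegral _ Id) _ => //.
  rewrite -[X in M * (X - _)](Rintegral_cstP Q) -RintegralB// -RintegralZl//.
  apply: le_Rintegral => //.
  - exact: integrable_norm.
  - exact: RintegrableZl.
  move=> w _; rewrite /g -[X in `|X - _|]mulr1 -mulrBr normrM ler_pM//.
  by have /andP[c0 c1'] := cutoff01 k%:R (V w); rewrite ger0_norm// subr_ge0.
have lt2 : 1 - 2 * eta < \int[P']_w chi (Y w) by apply: lt_le_trans hk; lra.
have e4 : 0 < eps / 4 by rewrite divr_gt0.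
near=> n.
have n1 : 1 - 2 * eta <= \int[P]_w chi (X n w) by near: n; exact: (cvgr_ge _ h1 _ lt2).
have n2 : `|\int[P']_w g (Y w) - \int[P]_w g (X n w)| <= eps / 4.
  by near: n; move/cvgrPdist_le : h2 => /(_ _ e4).
have t1 : `|\int[P]_w f (X n w) - \int[P]_w g (X n w)| <= 2 * (eps / 4).
  apply: (le_trans (tail _ _ P _ (mX n))).
  apply: (@le_trans _ _ (M * (2 * eta))); first by rewrite ler_wpM2l//; lra.
  by rewrite mulrCA ler_wpM2l.
have t2 : `|\int[P']_w f (Y w) - \int[P']_w g (Y w)| <= eps / 4.
  apply: (le_trans (tail _ _ P' _ mY)).
  by apply: le_trans etaM; rewrite ler_wpM2l//; lra.
move: t1 t2 n2; rewrite !ler_norml => /andP[? ?] /andP[? ?] /andP[? ?].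
by apply/andP; split; lra.
Unshelve. all: by end_near. Qed.

End levy.

(** * Powers of complex numbers close to 1 *)

Section complex_powers.
Context {R : realType}.
Implicit Types (x y : R) (z : R[i]).

Lemma cexpX z n : cexp z ^+ n = cexp (z *+ n).
Proof.
case: z => x y; elim: n => [|n IH]; first by rewrite mulr0n /= expR0 cos0 sin0 mulr1 mulr0.
rewrite exprS IH mulrS.
have -> : (x +i* y)%C *+ n = (x *+ n +i* (y *+ n))%C.
  by elim: n {IH} => [|n IH]; rewrite ?mulr0n// !mulrS IH.
rewrite /cexp /= expRD cosD sinD; simpc.
by congr (_ +i* _)%C; ring.
Qed.

(** Polar form on the right half-plane, where the argument is an arctangent. *)
Lemma cexp_polar x y : 0 < x ->
  (x +i* y)%C = cexp ((ln (x ^+ 2 + y ^+ 2) / 2) +i* atan (y / x))%C.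
Proof.
move=> x0; have n0 : 0 < x ^+ 2 + y ^+ 2 by rewrite ltr_pwDl ?exprn_gt0// sqr_ge0.
have q0 : 0 < 1 + (y / x) ^+ 2 by rewrite ltr_pwDl// sqr_ge0.
have e : expR (ln (x ^+ 2 + y ^+ 2) / 2) = x * Num.sqrt (1 + (y / x) ^+ 2).
  have r0 : 0 < x * Num.sqrt (1 + (y / x) ^+ 2) by rewrite mulr_gt0// sqrtr_gt0.
  have -> : x ^+ 2 + y ^+ 2 = (x * Num.sqrt (1 + (y / x) ^+ 2)) ^+ 2.
    by rewrite exprMn sqr_sqrtr ?ltW//; field; rewrite gt_eqF.
  by rewrite lnXn// -[X in X / 2]mulr_natr mulfK// lnK ?posrE.
have c : cos (atan (y / x)) = (Num.sqrt (1 + (y / x) ^+ 2))^-1 by exact: cos_atan.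
have c0 : cos (atan (y / x)) != 0 by rewrite c invr_eq0 gt_eqF// sqrtr_gt0.
have s : sin (atan (y / x)) = y / x * cos (atan (y / x)).
  by have := atanK (y / x); rewrite {1}/tan => h; rewrite -[in LHS](divfK c0 (sin _)) h.
rewrite /cexp s e c; congr (_ +i* _)%C; field; rewrite ?gt_eqF ?sqrtr_gt0//.
Qed.

(** The equation is oriented from the function of the goal to the one whose limit
    is known. *)
Lemma near_eq_limit {I : Type} {F : set_system I} {FF : Filter F} (f g : I -> R) (l : R) :
  {near F, f =1 g} -> g i @[i --> F] --> l -> f i @[i --> F] --> l.
Proof.
move=> fg; apply: cvg_trans; apply: near_eq_cvg.
by apply: filterS fg => i ->.
Qed.

Lemma cvg0_of_natrM (u : nat -> R) (c : R) :
  n%:R * u n @[n --> \oo] --> c -> u n @[n --> \oo] --> 0.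
Proof.
move=> uc; have n0 : \forall n \near \oo, (0 : R) < n%:R.
  by near=> n; rewrite ltr0n; near: n; exact: nbhs_infty_gt.
have ci : (n%:R : R)^-1 @[n --> \oo] --> 0.
  by apply/(gtr0_cvgV0 n0); exact: cvgr_idn.
have h := cvgM ci uc; rewrite mul0r in h; apply: (near_eq_limit _ (h _)).
by apply: filterS n0 => n n0; rewrite mulKf// gt_eqF.
Unshelve. all: by end_near. Qed.

(** If n u_n has a limit then u_n tends to 0, and g (u_n) / u_n tends to the
    derivative; the quotient is extended by its limit since u_n may vanish. *)
Lemma derivative_limit (g : R -> R) (l c : R) (u : nat -> R) :
  is_derive (0 : R) 1 g l -> g 0 = 0 -> n%:R * u n @[n --> \oo] --> c ->
  n%:R * g (u n) @[n --> \oo] --> l * c.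
Proof.
move=> dg g0 uc; pose h v := if v == 0 then l else g v / v.
have gh v : g v = h v * v.
  by rewrite /h; case: eqVneq => [->|v0]; rewrite ?mulr0// divfK.
have ch : {for 0, continuous h}.
  apply/continuous_withinNx; rewrite {2}/h eqxx.
  have [hl e] := dg.
  have hl' : (fun h : R => h^-1 *: ((g \o shift 0) (h *: 1) - g 0)) v @[v --> 0^'] --> l.
    by rewrite -e; exact: hl.
  apply: (near_eq_limit _ hl'); near=> v.
  have v0 : v != 0 by near: v; exact: nbhs_dnbhs_neq.
  rewrite /h (negPf v0); change (g v / v = v^-1 * (g (v * 1 + 0) - g 0)).
  by rewrite mulr1 addr0 g0 subr0 mulrC.
have u0 := cvg0_of_natrM uc.
have hc := cvgM (cvg_comp _ _ u0 ch) uc; rewrite {2}/h eqxx in hc.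
apply: (near_eq_limit _ (hc _)); near=> n.
by rewrite gh mulrCA.
Unshelve. all: by end_near. Qed.

(** The complex version of (1 + x / n) ^ n -> exp x: in polar form the n-th power
    multiplies logarithm and argument by n, and both are differentiable functions
    of the real and imaginary parts at 1. *)
Lemma cvg_expn_cexp (z : nat -> R[i]) x y :
  n%:R * (complex.Re (z n) - 1) @[n --> \oo] --> x ->
  n%:R * complex.Im (z n) @[n --> \oo] --> y ->
  complex.Re (z n ^+ n) @[n --> \oo] --> complex.Re (cexp (x +i* y)%C) /\
  complex.Im (z n ^+ n) @[n --> \oo] --> complex.Im (cexp (x +i* y)%C).
Proof.
move=> hx hy; pose u n := complex.Re (z n); pose v n := complex.Im (z n).
have u1 : u n @[n --> \oo] --> (1 : R).
  by apply/subr_cvg0; exact: cvg0_of_natrM hx.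
have c1 : (1 : R) @[_ --> \oo] --> (1 : R) by exact: cvg_cst.
have v0 : v n @[n --> \oo] --> 0 by exact: cvg0_of_natrM hy.
pose l n := n%:R * (ln (u n ^+ 2 + v n ^+ 2) / 2); pose t n := n%:R * atan (v n / u n).
have dln : is_derive (0 : R) 1 (fun h => ln (1 + h)) 1.
  have l1 : is_derive (1 + 0 : R) 1 (@ln R) (1 + 0)^-1 by apply: is_derive1_ln; rewrite addr0.
  apply: (is_derive_eq (derivR_comp l1 (derivR_add (derivR_cst 1 0) (derivR_id 0)))).
  by rewrite addr0 add0r invr1 mulr1.
have datan : is_derive (0 : R) 1 atan 1.
  by apply: is_derive_eq; rewrite expr0n addr0 invr1.
have lc : l n @[n --> \oo] --> x.
  have : n%:R * (u n ^+ 2 + v n ^+ 2 - 1) @[n --> \oo] --> 2 * x.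
    rewrite (_ : 2 * x = x * (1 + 1) + y * 0); last by ring.
    rewrite (_ : (fun n => _) = (fun n => n%:R * (u n - 1) * (u n + 1) + n%:R * v n * v n)).
      by apply: cvgD; [apply: cvgM => //; exact: cvgD|exact: cvgM].
    by apply/funext => n; ring.
  have ln0 : ln (1 + 0) = 0 :> R by rewrite addr0 ln1.
  move=> /(derivative_limit dln ln0); rewrite mul1r => h.
  rewrite (_ : x = 2 * x * 2^-1); last by rewrite mulrAC divff// mul1r.
  rewrite (_ : l = (fun n => n%:R * ln (1 + (u n ^+ 2 + v n ^+ 2 - 1)) * 2^-1)).
    exact: cvgMl.
  by apply/funext => n; rewrite /l [1 + _]addrC subrK mulrA.
have tc : t n @[n --> \oo] --> y.
  have : n%:R * (v n / u n) @[n --> \oo] --> y.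
    rewrite -[y]divr1; under eq_fun do rewrite mulrA.
    by apply: cvgM => //; apply: cvgV => //; exact: oner_neq0.
  by move=> /(derivative_limit datan (atan0 R)); rewrite mul1r.
have ev : \forall n \near \oo, z n ^+ n = (expR (l n) * cos (t n) +i* (expR (l n) * sin (t n)))%C.
  near=> n.
  have un : 0 < u n by near: n; exact: (cvgr_gt _ u1 _ ltr01).
  rewrite (_ : z n = (u n +i* v n)%C); last by rewrite /u /v; case: (z n).
  rewrite (cexp_polar _ un) cexpX.
  set a := ln _ / 2; set c := atan _.
  have -> : (a +i* c)%C *+ n = (a *+ n +i* (c *+ n))%C.
    by elim: (n) => [|k IH]; rewrite ?mulr0n// !mulrS IH.
  by rewrite /cexp /l /t !mulr_natl.
have ec : expR (l n) @[n --> \oo] --> expR x.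
  by apply: continuous_cvg => //; exact: continuous_expR.
have cc : cos (t n) @[n --> \oo] --> cos y.
  by apply: continuous_cvg => //; exact: continuous_cos.
have sc : sin (t n) @[n --> \oo] --> sin y.
  by apply: continuous_cvg => //; exact: continuous_sin.
split.
- apply: (near_eq_limit (g := fun n => expR (l n) * cos (t n))); last exact: cvgM.
  by apply: filterS ev => n ->.
- apply: (near_eq_limit (g := fun n => expR (l n) * sin (t n))); last exact: cvgM.
  by apply: filterS ev => n ->.
Unshelve. all: by end_near. Qed.

End complex_powers.

(** * Integrals against rescaled tails *)

Section tail_integral.
Context {R : realType} {d : measure_display} {T : measurableType d} (P : probability T R).
Notation mu := (@lebesgue_measure R).
Local Notation halfline := (`]0, +oo[%classic : set R).

(** By the layer cake formula n E F (s V / a_n) is the integral of g u times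
    n P (V > u a_n / s), which converges to p s^alpha u^(- alpha). Potter's bound at
    x = a_n / s gives the majorant: min 1 u absorbs g and n H (a_n / s) is
    bounded. *)
Lemma tail_integral_cvg (H : R -> R) (alpha delta C x0 : R) (a : nat -> R)
    (V : T -> R) (p : R) (g F : R -> R) (s : R) :
  0 < delta -> delta <= 1 -> 0 < C -> 0 < x0 ->
  (forall x u, x0 <= x -> 0 < u ->
    H (u * x) * Num.min 1 u <= C * H x * two_power_kernel delta u) ->
  (forall x, 0 <= H x) ->
  a n @[n --> \oo] --> +oo ->
  (forall u, 0 < u -> n%:R * H (u * a n) @[n --> \oo] --> u `^ (- alpha)) ->
  measurable_fun setT V -> (forall w, 0 <= V w) ->
  (forall x, fine (P [set w | x < V w]) <= H x) ->
  (forall u, 0 < u ->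
    n%:R * fine (P [set w | u * a n < V w]) @[n --> \oo] --> p * u `^ (- alpha)) ->
  measurable_fun setT g -> (forall u, 0 < u -> `|g u| <= 2 * Num.min 1 u) ->
  (forall x, 0 <= x -> mu.-integrable `]0, x[ (EFin \o g) /\
     \int[mu]_(u in `]0, x[) g u = F x) ->
  mu.-integrable halfline (EFin \o (fun u => g u * u `^ (- alpha))) ->
  0 < s ->
  (\forall n \near \oo, P.-integrable setT (EFin \o (fun w => F (s / a n * V w)))) /\
  n%:R * (\int[P]_w F (s / a n * V w)) @[n --> \oo] -->
    p * s `^ alpha * \int[mu]_(u in halfline) (g u * u `^ (- alpha)).
Proof.
move=> delta0 delta1 C0 x00 potter H0 a_y a_H mV V0 VH a_V mg gb gF Iga s0.
have mH : measurable (halfline : set (measurableTypeR R)) by exact: measurable_itv.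
pose M := s `^ alpha + 1.
have sVN : s^-1 `^ (- alpha) = s `^ alpha.
  by rewrite -powR_inv1 ?ltW// -powRrM mulrNN mul1r.
have HM : \forall n \near \oo, n%:R * H (a n / s) <= M.
  have si : 0 < s^-1 by rewrite invr_gt0.
  have h := a_H _ si; rewrite sVN in h.
  have lt : s `^ alpha < M by rewrite ltrDl.
  under eq_near do rewrite [_ / s]mulrC; exact: (cvgr_le _ h _ lt).
have aL : \forall n \near \oo, 0 < a n /\ x0 <= a n / s.
  move/cvgryPgt : a_y => /(_ (Num.max 0 (x0 * s))); apply: filterS => n.
  by rewrite gt_max => /andP[an xa]; split => //; rewrite ler_pdivlMr// ltW.
have [N _ hN] : \forall n \near \oo,
    [/\ (0 < n)%N, 0 < a n, x0 <= a n / s & n%:R * H (a n / s) <= M].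
  near=> n; have [h1 h2] : 0 < a n /\ x0 <= a n / s by near: n.
  by split => //; near: n => //; exact: nbhs_infty_gt.
pose G n u := fine (P [set w | u < s / a n * V w]).
have GE n u : 0 < a n -> G n u = fine (P [set w | u / s * a n < V w]).
  move=> an; rewrite /G; congr (fine (P _)).
  have e w : (u < s / a n * V w) = (u / s * a n < V w).
    rewrite (_ : s / a n * V w = V w / (a n / s)); last by field; rewrite !gt_eqF.
    by rewrite ltr_pdivlMr ?divr_gt0// mulrA mulrAC.
  by apply/seteqP; split => w /=; rewrite e.
have mV' n : measurable_fun setT (fun w => s / a n * V w) by exact: measurable_funM.
have mG n : measurable_fun setT (G n).
  exact: measurable_tail.
have G0 n u : 0 <= G n u by exact: fine_ge0.
have dom n u : (N <= n)%N -> 0 < u ->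
    `|n%:R * (g u * G n u)| <= 2 * C * M * two_power_kernel delta u.
  move=> Nn u0; have [_ an xa HMn] := hN _ Nn.
  have g2 : `|g u| * G n u <= 2 * (C * H (a n / s) * two_power_kernel delta u).
    apply: (@le_trans _ _ (2 * Num.min 1 u * H (u * (a n / s)))).
      by rewrite ler_pM ?gb// GE// (_ : u * (a n / s) = u / s * a n) ?VH// mulrA mulrAC.
    by rewrite -mulrA [Num.min 1 u * _]mulrC ler_pM2l// potter.
  rewrite !normrM (ger0_norm (G0 n u)) ger0_norm//.
  apply: (le_trans (ler_wpM2l (ler0n _ n) g2)).
  rewrite (_ : n%:R * _ = 2 * C * two_power_kernel delta u * (n%:R * H (a n / s))); last by ring.
  rewrite (_ : 2 * C * M * _ = 2 * C * two_power_kernel delta u * M); last by ring.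
  by rewrite ler_wpM2l// !mulr_ge0// ltW// two_power_kernel_gt0.
have Ik : mu.-integrable halfline (EFin \o (fun u => 2 * C * M * two_power_kernel delta u)).
  by apply: RintegrableZl => //; exact: integrable_two_power_kernel.
have mgG n : measurable_fun halfline (fun u => g u * G n u).
  by apply: measurable_funM; exact: measurable_funTS.
have IgG n : (N <= n)%N -> mu.-integrable halfline (EFin \o (fun u => g u * G n u)).
  move=> Nn; have [n0 _ _ _] := hN _ Nn.
  have I := RintegrableZl n%:R^-1 mH Ik.
  apply: (le_Rintegrable mH (mgG n) I) => u; rewrite /= in_itv/= andbT => u0.
  have := dom _ _ Nn u0; rewrite normrM (ger0_norm (ler0n _ n)).
  by rewrite -ler_pdivlMl ?ltr0n.
have lc n (Nn : (N <= n)%N) : P.-integrable setT (EFin \o (fun w => F (s / a n * V w))) /\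
    n%:R * \int[P]_w F (s / a n * V w) = \int[mu]_(u in halfline) (n%:R * (g u * G n u)).
  have X0 w : 0 <= s / a n * V w by have [_ an _ _] := hN _ Nn; rewrite mulr_ge0// ltW// divr_gt0.
  have [I ->] := layer_cake (mV' n) X0 mg gF (IgG n Nn).
  by split => //; rewrite RintegralZl//; exact: IgG.
split; first by exists N => // n /lc[].
rewrite -(cvg_shiftn N).
under eq_fun => n do rewrite (lc _ (leq_addl n N)).2.
have [n|u u0|n u u0|_] := @Rintegral_dominated _ _ _ mu halfline
  (fun n u => (n + N)%:R * (g u * G (n + N)%N u))
  (fun u => p * s `^ alpha * (g u * u `^ (- alpha))) _ mH _ _ Ik.
- by apply: measurable_funM; [exact: measurable_cst|exact: mgG].
- have {}u0 : 0 < u by move: u0; rewrite /= in_itv/= andbT.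
  have e n : G (n + N)%N u = fine (P [set w | u / s * a (n + N)%N < V w]).
    by apply: GE; have [] := hN _ (leq_addl n N).
  under eq_fun => n do rewrite e mulrCA.
  rewrite (_ : p * s `^ alpha * (g u * _) = g u * (p * (u / s) `^ (- alpha))).
    apply: cvgMr; rewrite (cvg_shiftn N (fun n => n%:R * fine (P [set w | u / s * a n < V w]))).
    by apply: a_V; rewrite divr_gt0.
  by rewrite powRM ?ltW ?invr_gt0// sVN; ring.
- by apply: dom; rewrite ?leq_addl//; move: u0; rewrite /= in_itv/= andbT.
- by rewrite -RintegralZl.
Unshelve. all: by end_near. Qed.

End tail_integral.

(** * Expansion of the characteristic function at 0 *)

Section charfun_expansion.
Context {R : realType} {d : measure_display} {T : measurableType d} (P : probability T R).
Notation mu := (@lebesgue_measure R).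
Local Notation halfline := (`]0, +oo[%classic : set R).
Context (alpha : R) (alpha1 : 1 < alpha) (alpha2 : alpha < 2).
Context (X : T -> R) (mX : measurable_fun setT X).
Let H (x : R) := fine (P [set w | x < `|X w|]).
Context (delta C x0 : R) (delta0 : 0 < delta) (delta1 : delta <= 1) (C0 : 0 < C) (x00 : 0 < x0).
Context (potter : forall x u, x0 <= x -> 0 < u ->
    H (u * x) * Num.min 1 u <= C * H x * two_power_kernel delta u).
Context (H_gt0 : forall x, 0 < H x).
Context (a : nat -> R) (a_y : a n @[n --> \oo] --> +oo).
Context (a_H : forall u, 0 < u -> n%:R * H (u * a n) @[n --> \oo] --> u `^ (- alpha)).

Let Acos := Gamma (1 - alpha) * cos (pi * alpha / 2).
Let Asin := Gamma (1 - alpha) * sin (pi * alpha / 2).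

(** F = cos - 1 has derivative - sin, and F = sin - id has derivative cos - 1; both
    derivatives are bounded by 2 min 1 u, as required by Potter's bound. The
    variable W is X or its opposite, for the two tails. *)
Lemma half_charfun_expansion (W : T -> R) (p s : R) :
  measurable_fun setT W -> (forall w, `|W w| = `|X w|) ->
  fine (P [set w | x < W w]) / H x @[x --> +oo] --> p -> 0 < s ->
  let V w := Num.max 0 (W w) in
  [/\ \forall n \near \oo, P.-integrable setT (EFin \o (fun w => cos (s / a n * V w) - 1)) /\
        P.-integrable setT (EFin \o (fun w => sin (s / a n * V w) - s / a n * V w)),
      n%:R * (\int[P]_w (cos (s / a n * V w) - 1)) @[n --> \oo] --> - (p * s `^ alpha * Acos) &
      n%:R * (\int[P]_w (sin (s / a n * V w) - s / a n * V w)) @[n --> \oo] -->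
        p * s `^ alpha * Asin].
Proof.
move=> mW WX Wp s0 V.
have mV : measurable_fun setT V by apply: measurable_maxr.
have V0 w : 0 <= V w by rewrite /V le_max lexx.
have VX w : V w <= `|X w| by rewrite /V ge_max normr_ge0 -WX ler_norm.
have VH x : fine (P [set w | x < V w]) <= H x.
  apply: fine_le_measure; [exact: measurable_lt_set|by apply: measurable_lt_set; exact: measurableT_comp|].
  by move=> w /= /lt_le_trans; apply.
have a_V u : 0 < u ->
    n%:R * fine (P [set w | u * a n < V w]) @[n --> \oo] --> p * u `^ (- alpha).
  move=> u0; have uay : u * a n @[n --> \oo] --> +oo.
    apply/cvgryPgt => A; move/cvgryPgt : a_y => /(_ (A / u)).
    by apply: filterS => n; rewrite ltr_pdivrMr// mulrC.
  have h := cvg_comp _ _ uay Wp.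
  apply: (near_eq_limit (g := fun n => fine (P [set w | u * a n < W w]) / H (u * a n) * (n%:R * H (u * a n)))).
    move/cvgryPgt : a_y => /(_ 0); apply: filterS => n an.
    rewrite mulrCA divfK ?gt_eqF//; congr (_ * fine (P _)).
    apply/seteqP; split => w /=; rewrite /V lt_max.
      by rewrite ltNge mulr_ge0// ltW.
    by move=> ->; rewrite orbT.
  by apply: cvgM => //; exact: a_H.
have [Is es] := integral_sin_powR alpha1 alpha2.
have [Ic ec] := integral_cosB1_powR alpha1 alpha2.
have min1 (u y : R) : 0 < u -> `|y| <= u -> `|y| <= 2 -> `|y| <= 2 * Num.min 1 u.
  move=> u0 yu y2; rewrite minr_pMr// mulr1 le_min y2/= (le_trans yu)//.
  by rewrite ler_peMl ?ler1n// ltW.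
have limC := @tail_integral_cvg _ _ _ P H alpha delta C x0 a V p _ _ s
    delta0 delta1 C0 x00 potter (fun x => ltW (H_gt0 x)) a_y a_H mV V0 VH a_V.
have [h1 h2] : (\forall n \near \oo, P.-integrable setT (EFin \o (fun w => cos (s / a n * V w) - 1))) /\
    n%:R * (\int[P]_w (cos (s / a n * V w) - 1)) @[n --> \oo] --> - (p * s `^ alpha * Acos).
  have e : (fun u : R => - sin u * u `^ (- alpha)) = (fun u => -1 * (sin u * u `^ (- alpha))).
    by apply/funext => u; rewrite !mulNr mul1r.
  have mH : measurable (halfline : set (measurableTypeR R)) by exact: measurable_itv.
  have msin : measurable_fun setT (fun u : R => - sin u).
    by apply: continuous_measurable_fun => u; apply: cvgN; exact: continuous_sin.
  have bsin (u : R) : 0 < u -> `|- sin u| <= 2 * Num.min 1 u.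
    move=> u0; rewrite normrN min1//; last by rewrite (le_trans (sin_max _))// ler1n.
    by have := sin_lipschitz u 0; rewrite sin0 !subr0 (gtr0_norm u0).
  have gF (x : R) : 0 <= x -> mu.-integrable `]0, x[ (EFin \o (fun u => - sin u)) /\
     \int[mu]_(u in `]0, x[) (- sin u) = cos x - 1.
    move=> xge0; rewrite -[X in _ - X](@cos0 R); apply: FTC2_open => //.
    by move=> u; apply: cvgN; exact: continuous_sin.
  have Iga : mu.-integrable halfline (EFin \o (fun u => - sin u * u `^ (- alpha))).
    by rewrite e; exact: RintegrableZl.
  have [I l] := limC _ _ msin bsin gF Iga s0; split => //.
  move: l; rewrite e.
  by rewrite RintegralZl// es mulN1r mulrN.
have [h3 h4] : (\forall n \near \oo, P.-integrable setT (EFin \o (fun w => sin (s / a n * V w) - s / a n * V w))) /\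
    n%:R * (\int[P]_w (sin (s / a n * V w) - s / a n * V w)) @[n --> \oo] -->
        p * s `^ alpha * Asin.
  have ccos : continuous (fun u : R => cos u - 1).
    by move=> u; apply: cvgB; [exact: continuous_cos|exact: cvg_cst].
  have mcos : measurable_fun setT (fun u : R => cos u - 1) by exact: continuous_measurable_fun.
  have bcos (u : R) : 0 < u -> `|cos u - 1| <= 2 * Num.min 1 u.
    move=> u0; apply: min1 => //.
      by have := cos_lipschitz u 0; rewrite cos0 subr0 (gtr0_norm u0).
    by rewrite (le_trans (ler_normB _ _))// normr1 lerD// cos_max.
  have gF (x : R) : 0 <= x -> mu.-integrable `]0, x[ (EFin \o (fun u => cos u - 1)) /\
     \int[mu]_(u in `]0, x[) (cos u - 1) = sin x - x.
    move=> xge0; have [I ->] : mu.-integrable `]0, x[ (EFin \o (fun u => cos u - 1)) /\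
        \int[mu]_(u in `]0, x[) (cos u - 1) = (sin x - x) - (sin 0 - 0).
      exact: (@FTC2_open _ (fun u => sin u - u)).
    by rewrite sin0 !subr0.
  have [I l] := limC _ _ mcos bcos gF Ic s0; split => //.
  by move: l; rewrite ec.
by split => //; apply: filterS2 h1 h3.
Qed.

Context (p q : R) (IX : P.-integrable setT (EFin \o X)) (EX : \int[P]_w X w = 0).
Context (Xp : fine (P [set w | x < X w]) / H x @[x --> +oo] --> p).
Context (Xq : fine (P [set w | X w < - x]) / H x @[x --> +oo] --> q).

Let cosX s := integrable_cos_scale P s mX.
Let sinX s := integrable_sin_scale P s mX.

(** Splitting X into its positive and negative parts reduces to nonnegative
    variables, since cos u - 1 and sin u - u vanish at 0. *)
Lemma charfun_expansion_gt0 s : 0 < s ->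
  n%:R * (complex.Re (mean_cexp P X (s / a n)) - 1) @[n --> \oo] -->
    - ((p + q) * s `^ alpha * Acos) /\
  n%:R * complex.Im (mean_cexp P X (s / a n)) @[n --> \oo] -->
    (p - q) * s `^ alpha * Asin.
Proof.
move=> s0; have [Ip cp sp] := half_charfun_expansion mX (fun=> erefl) Xp s0.
have mN : measurable_fun setT (fun w => - X w) by exact: measurable_funN.
have Nq : fine (P [set w | x < - X w]) / H x @[x --> +oo] --> q.
  rewrite (_ : (fun x => _) = (fun x => fine (P [set w | X w < - x]) / H x))//.
  apply/funext => x; congr (fine (P _) / _).
  by apply/seteqP; split => w /=; rewrite ltrNr.
have [Iq cq sq] := half_charfun_expansion mN (fun w => normrN (X w)) Nq s0.
have I1 : P.-integrable setT (EFin \o (fun _ : T => 1 : R)).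
  exact: finite_measure_integrable_cst.
split.
- rewrite (_ : - _ = - (p * s `^ alpha * Acos) + - (q * s `^ alpha * Acos)); last by ring.
  apply: (near_eq_limit _ (cvgD cp cq)).
  apply: filterS2 Ip Iq => n [ip _] [iq _].
  rewrite /= -mulrDr -RintegralD// -[X in _ - X](Rintegral_cstP P) -RintegralB//.
  congr (_ * _); apply: eq_Rintegral => w _.
  have [X0|X0] := leP 0 (X w).
    by rewrite (max_l (y := - X w)) ?oppr_le0// mulr0 cos0 subrr addr0.
  by rewrite (max_r (y := - X w)) ?oppr_ge0 ?ltW// mulr0 cos0 subrr add0r mulrN cosN.
- rewrite (_ : (p - q) * _ * _ = p * s `^ alpha * Asin - q * s `^ alpha * Asin); last by ring.
  apply: (near_eq_limit _ (cvgB sp sq)).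
  apply: filterS2 Ip Iq => n [_ ip] [_ iq].
  rewrite /= -mulrBr -RintegralB//.
  have Iid := RintegrableZl (s / a n) measurableT IX.
  have e0 : \int[P]_w (s / a n * X w) = 0 by rewrite RintegralZl// EX mulr0.
  have -> : \int[P]_w sin (s / a n * X w) = \int[P]_w (sin (s / a n * X w) - s / a n * X w).
    by rewrite RintegralB// e0 subr0.
  congr (_ * _); apply: eq_Rintegral => w _.
  have [X0|X0] := leP 0 (X w).
    by rewrite (max_l (y := - X w)) ?oppr_le0// mulr0 sin0 !subr0.
  rewrite (max_r (y := - X w)) ?oppr_ge0 ?ltW// mulr0 sin0 mulrN sinN !subr0 sub0r.
  by rewrite opprB opprK addrC.
Qed.

(** The case s < 0 follows because cos is even and sin is odd. *)
Lemma charfun_expansion s :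
  n%:R * (complex.Re (mean_cexp P X (s / a n)) - 1) @[n --> \oo] -->
    - ((p + q) * `|s| `^ alpha * Acos) /\
  n%:R * complex.Im (mean_cexp P X (s / a n)) @[n --> \oo] -->
    (p - q) * Num.sg s * `|s| `^ alpha * Asin.
Proof.
have alpha0 : alpha != 0 by rewrite gt_eqF// (lt_trans _ alpha1).
have [->|sN0] := eqVneq s 0.
  rewrite normr0 powR0// sgr0 !mulr0 !mul0r oppr0.
  have e n : mean_cexp P X (0 / a n) = 1%C.
    rewrite /mean_cexp mul0r; under eq_Rintegral do rewrite mul0r cos0.
    under [X in (_ +i* X)%C]eq_Rintegral do rewrite mul0r sin0.
    by rewrite !Rintegral_cstP.
  by split; under eq_fun do rewrite e /= ?subrr ?mulr0; exact: cvg_cst.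
have s0 : 0 < `|s| by rewrite normr_gt0.
have [h1 h2] := charfun_expansion_gt0 s0.
have [sp|sn] := ltP 0 s; first by rewrite gtr0_sg// mulr1 gtr0_norm// in h1 h2 *.
have {}sn : s < 0 by rewrite lt_neqAle sN0.
rewrite ltr0_sg//; split.
  rewrite (_ : (fun n => _) = (fun n => n%:R * (complex.Re (mean_cexp P X (`|s| / a n)) - 1)))//.
  apply/funext => n /=; congr (_ * (_ - 1)); apply: eq_Rintegral => w _.
  by rewrite ltr0_norm// !mulNr cosN.
rewrite mulrN1 !mulNr.
rewrite (_ : (fun n => _) = (fun n => - (n%:R * complex.Im (mean_cexp P X (`|s| / a n))))); first exact: cvgN.
apply/funext => n /=.
rewrite -mulrN; congr (_ * _); rewrite -mulN1r -RintegralZl//; apply: eq_Rintegral => w _.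
by rewrite ltr0_norm// !mulNr sinN mul1r opprK.
Qed.

End charfun_expansion.

(** * The stable limit of normalized sums *)

Section stable_limit.
Context {R : realType}.

(** The parametrization by a tangent is legitimate as cos (pi alpha / 2) < 0 for
    1 < alpha < 2. *)
Lemma stable_charfunE (alpha rho s : R) : 1 < alpha -> alpha < 2 ->
  stable_charfun alpha rho s =
  cexp (- (`|s| `^ alpha * (Gamma (1 - alpha) * cos (pi * alpha / 2))) +i*
        (rho * Num.sg s * `|s| `^ alpha * (Gamma (1 - alpha) * sin (pi * alpha / 2))))%C.
Proof.
move=> alpha1 alpha2; have c0 : cos (pi * alpha / 2) != 0 :> R.
  have -> : pi * alpha / 2 = pi * (alpha - 1) / 2 + pi / 2 :> R by lra.
  rewrite cosDpihalf oppr_eq0 gt_eqF// sin_gt0_pi//.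
  have pi0 := pi_gt0 R.
  have a1 : 0 < pi * (alpha - 1) :> R by rewrite mulr_gt0// subr_gt0.
  have a2 : pi * (alpha - 1) < pi :> R by rewrite gtr_pMr// ltrBlDr.
  by apply/andP; split; lra.
rewrite /stable_charfun /tan; congr cexp.
set t := sin _ in c0 *; set k := cos _ in c0 *.
simpc; congr (_ +i* _)%C; first by ring.
by field.
Qed.

Context {d : measure_display} {T : measurableType d}
  (P : probability T R) (Z : nat -> {RV P >-> R}) (alpha : R).
Context (indepZ : mutually_independent Z) (idZ : identically_distributed Z).
Context (alpha1 : 1 < alpha) (alpha2 : alpha < 2).
Let H (x : R) := fine (P [set w | x < `|Z 0%N w|]).
Context (delta C x0 : R) (delta0 : 0 < delta) (delta1 : delta <= 1) (C0 : 0 < C) (x00 : 0 < x0).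
Context (potter : forall x u, x0 <= x -> 0 < u ->
    H (u * x) * Num.min 1 u <= C * H x * two_power_kernel delta u).
Context (H_gt0 : forall x, 0 < H x).
Context (a : nat -> R) (a_y : a n @[n --> \oo] --> +oo).
Context (a_H : forall u, 0 < u -> n%:R * H (u * a n) @[n --> \oo] --> u `^ (- alpha)).
Context (p q : R) (pq1 : p + q = 1).
Context (IZ : P.-integrable setT (EFin \o Z 0%N)) (EZ : \int[P]_w Z 0%N w = 0).
Context (Zp : fine (P [set w | x < Z 0%N w]) / H x @[x --> +oo] --> p).
Context (Zq : fine (P [set w | Z 0%N w < - x]) / H x @[x --> +oo] --> q).

(** The characteristic function of S_n / a_n at s is the n-th power of the one of
    Z_0 at s / a_n, whose distance to 1 is known up to o(1 / n). *)
Lemma normalized_sum_charfun_cvg s :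
  \int[P]_w cos (s * (partial_sum Z n w / a n)) @[n --> \oo] -->
    complex.Re (stable_charfun alpha (p - q) s) /\
  \int[P]_w sin (s * (partial_sum Z n w / a n)) @[n --> \oo] -->
    complex.Im (stable_charfun alpha (p - q) s).
Proof.
have [h1 h2] := charfun_expansion alpha1 alpha2 (measurable_funPT (Z 0%N)) delta0 delta1 C0 x00
  potter H_gt0 a_y a_H IZ EZ Zp Zq s.
rewrite stable_charfunE//; rewrite pq1 mul1r in h1.
have [c1 c2] := cvg_expn_cexp h1 h2.
have e n : mean_cexp P (Z 0%N) (s / a n) ^+ n =
    (\int[P]_w cos (s * (partial_sum Z n w / a n)) +i*
     \int[P]_w sin (s * (partial_sum Z n w / a n)))%C.
  rewrite -mean_cexp_partial_sum// /mean_cexp.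
  by congr (_ +i* _)%C; apply: eq_Rintegral => w _; rewrite mulrA mulrAC.
split.
- by move: c1; under eq_fun do rewrite e.
- by move: c2; under eq_fun do rewrite e.
Qed.

End stable_limit.

(** * Random indices and shifted sequences *)

Section random_index.
Context {R : realType} {d : measure_display} {T : measurableType d}.

(** The index takes countably many values, and the function is measurable on each
    of the events where it is constant. *)
Lemma measurable_random_index (F : nat -> T -> R) (t : T -> nat) :
  measurable_fun setT t -> (forall k, measurable_fun setT (F k)) ->
  measurable_fun setT (fun w => F (t w) w).
Proof.
move=> mt mF _ B mB; rewrite setTI.
rewrite (_ : _ @^-1` B = \bigcup_k ((t @^-1` [set k]) `&` (F k @^-1` B))).
  apply: bigcup_measurable => k _; apply: measurableI.
    by rewrite -[X in measurable X]setTI; exact: mt.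
  by rewrite -[X in measurable X]setTI; exact: mF.
apply/seteqP; split => w /=; first by move=> h; exists (t w).
by move=> [k _ [/= <-]].
Qed.

Context (P : probability T R) (Z : nat -> {RV P >-> R}).

Lemma mutually_independent_shift m :
  mutually_independent Z -> mutually_independent (fun i => Z (m + i)%N).
Proof.
move=> indZ J B uJ mB.
have u' : uniq [seq (m + j)%N | j <- J] by rewrite map_inj_uniq//; exact: addnI.
have := indZ _ (fun i => B (i - m)%N) u'.
rewrite big_map => e.
rewrite (eq_bigr (fun j => fine (P (Z (m + j)%N @^-1` B (m + j - m)%N)))); last first.
  by move=> j _; rewrite addKn.
rewrite -e; last by move=> _ /mapP[j jJ ->]; rewrite addKn; exact: mB.
congr (P _); apply/seteqP; split => w /= h.
  by move=> _ /mapP[j jJ ->]; rewrite addKn; exact: h.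
by move=> j jJ; have := h (m + j)%N (map_f _ jJ); rewrite addKn.
Qed.

Lemma identically_distributed_shift m :
  identically_distributed Z -> identically_distributed (fun i => Z (m + i)%N).
Proof. by move=> idZ i j; exact: idZ. Qed.

Lemma partial_sum_shift m k w :
  partial_sum (fun i => Z (m + i)%N) k w = partial_sum Z (m + k) w - partial_sum Z m w.
Proof.
by rewrite /partial_sum big_split_ord/= addrAC subrr add0r.
Qed.

Context (indZ : mutually_independent Z) (idZ : identically_distributed Z).
Let H (x : R) := fine (P [set w | x < `|Z 0%N w|]).
Context (delta C x0 : R) (delta0 : 0 < delta) (delta1 : delta <= 1) (C0 : 0 < C) (x00 : 0 < x0).
Context (potter : forall x u, x0 <= x -> 0 < u ->
    H (u * x) * Num.min 1 u <= C * H x * two_power_kernel delta u).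
Context (EZ : ('E_P[Z 0%N] = 0)%E).
Notation mu := (@lebesgue_measure R).

(** The shifted sequence satisfies the same hypotheses with the same tail, and the
    constant of the maximal inequality does not see the shift. *)
Lemma increment_maximal m (y : R) N : x0 <= y ->
  fine (P [set w | exists2 k, (k <= N)%N & y <= `|partial_sum Z (m + k) w - partial_sum Z m w|]) <=
  (1 + 10 * C * \int[mu]_(u in `]0, +oo[) two_power_kernel delta u) * N%:R * H y.
Proof.
move=> xy; pose Z' i := Z (m + i)%N.
have idZ' : identically_distributed Z' := identically_distributed_shift m idZ.
have Hm : (fun x : R => fine (P [set w | x < `|Z' 0%N w|])) = H.
  by apply/funext => x; rewrite /Z' (tail_identically_distributed idZ).
have potter' (x u : R) : x0 <= x -> 0 < u ->
    fine (P [set w | u * x < `|Z' 0%N w|]) * Num.min 1 u <=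
    C * fine (P [set w | x < `|Z' 0%N w|]) * two_power_kernel delta u.
  by move=> xx u0; have := potter xx u0; rewrite -Hm.
have I0 := regular_tail_integrable (Z := Z) delta0 delta1 C0 x00 potter.
have Im := regular_tail_integrable (Z := Z') delta0 delta1 C0 x00 potter'.
have EZ' : ('E_P[Z' 0%N] = 0)%E.
  rewrite -EZ !expectation_def !Rintegral_EFin//; congr EFin.
  exact: (@identically_distributed_Rintegral _ _ _ P Z id).
have := partial_sum_maximal (mutually_independent_shift m indZ) idZ'
  delta0 delta1 C0 x00 potter' EZ' N xy.
rewrite (congr1 (fun h => h y) Hm); apply: le_trans.
rewrite le_eqVlt; apply/orP; left; apply/eqP; congr (fine (P _)).
by apply/seteqP; split => w [k kN h]; exists k => //; move: h; rewrite partial_sum_shift.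
Qed.

End random_index.

(** * Replacing the random index by a deterministic one *)

Section random_index_close.
Context {R : realType}.

(** x / A - y / B is split as (x - y) / A plus y / B times (B - A) / A, and A is at
    least B / 2. *)
Lemma ratio_perturbation (x y A B K r e : R) : 0 < B -> 0 < r -> r <= 1 / 2 -> 0 < K ->
  `|A - B| <= r * B -> `|x - y| <= e / 4 * B -> `|y| <= K * B -> r * K <= e / 4 ->
  `|x / A - y / B| <= e.
Proof.
move=> B0 r0 r2 K0 AB xy yK rK.
have rB : r * B <= B / 2 by rewrite mulrC ler_pM2l// -[leRHS]mul1r.
have A2 : B / 2 <= A by move: AB; rewrite ler_norml => /andP[? ?]; lra.
have A0 : 0 < A by apply: lt_le_trans A2; rewrite divr_gt0.
rewrite (_ : x / A - y / B = ((x - y) + y / B * (B - A)) / A); last by field; rewrite !gt_eqF.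
rewrite normrM normfV (gtr0_norm A0) ler_pdivrMr//.
apply: (le_trans (ler_normD _ _)); apply: (@le_trans _ _ (e * (B / 2))); last first.
  by rewrite ler_wpM2l//; have := mulr_gt0 r0 K0; lra.
have h : `|y / B * (B - A)| <= e / 4 * B.
  rewrite normrM distrC; apply: (@le_trans _ _ (K * (r * B))); last first.
    by rewrite mulrA ler_pM2r// mulrC.
  by rewrite ler_pM// normrM normfV (gtr0_norm B0) ler_pdivrMr.
lra.
Qed.

Lemma nat_window (x : R) (m k : nat) : 0 <= x -> `|k%:R - m%:R : R| <= x ->
  (m - Num.truncn x <= k <= m + Num.truncn x)%N.
Proof.
move=> x0; rewrite ler_norml => /andP[h1 h2]; apply/andP; split.
  rewrite leq_subLR addnC -leq_subLR truncn_ge_nat//.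
  have [mk|/ltnW km] := leqP m k; first by rewrite (eqP mk).
  by rewrite natrB//; lra.
rewrite -leq_subLR truncn_ge_nat//.
have [km|/ltnW mk] := leqP k m; first by rewrite (eqP km).
by rewrite natrB//; lra.
Qed.

Context {d : measure_display} {T : measurableType d}
  (P : probability T R) (Z : nat -> {RV P >-> R}) (alpha : R).
Context (alpha1 : 1 < alpha).
Context (indZ : mutually_independent Z) (idZ : identically_distributed Z).
Let H (x : R) := fine (P [set w | x < `|Z 0%N w|]).
Context (delta C x0 : R) (delta0 : 0 < delta) (delta1 : delta <= 1) (C0 : 0 < C) (x00 : 0 < x0).
Context (potter : forall x u, x0 <= x -> 0 < u ->
    H (u * x) * Num.min 1 u <= C * H x * two_power_kernel delta u).
Context (EZ : ('E_P[Z 0%N] = 0)%E).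
Context (a : nat -> R) (a_y : a n @[n --> \oo] --> +oo).
Context (a_H : forall u, 0 < u -> n%:R * H (u * a n) @[n --> \oo] --> u `^ (- alpha)).
Context (a_ratio : forall r : R, 0 < r -> r < 1 -> exists2 delta : R, 0 < delta <= 1 / 2 &
  \forall m \near \oo, forall k, `|k%:R - m%:R : R| <= delta * m%:R ->
    `|a k - a m| <= r * a m).
Context (t : nat -> {RV P >-> nat}) (b : nat -> nat) (c : R) (c0 : 0 < c).
Context (tb : cvg_in_probability P (fun n w => (t n w)%:R / (b n)%:R) c).
Context (b_y : b n @[n --> \oo] --> \oo).
Notation mu := (@lebesgue_measure R).
Let D := 1 + 10 * C * \int[mu]_(u in `]0, +oo[) two_power_kernel delta u.

(** A deterministic index to which t_n is asymptotically equal in probability. *)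
Definition central_index n := Num.truncn (c * (b n)%:R).
Local Notation m := central_index.

Lemma central_index_cvgy : m n @[n --> \oo] --> \oo.
Proof.
apply/cvgnyPge => A.
have /cvgrnyP/cvgryPge/(_ (A%:R / c)) := b_y; apply: filterS => n.
by rewrite ler_pdivrMr// mulrC truncn_ge_nat// mulr_ge0// ltW.
Qed.

(** The exceptional event is the union of three: A1, t_n / b_n is not close to c;
    A2, |S_m| is at least K a_m; A3, some increment over the window of indices
    [m - L, m + L] is at least eps / 8 a_m. K is chosen first, for tightness, then the
    tolerance r on a_k / a_m, then the relative width del of the window, for which
    the maximal inequality bounds P A3 by about 2 del times a constant. *)
Lemma random_index_close (eps eta : R) : 0 < eps -> 0 < eta ->
  \forall n \near \oo, exists A, [/\ measurable A, fine (P A) <= eta &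
   forall w, ~ A w -> `|partial_sum Z (t n w) w / a (t n w) - partial_sum Z (m n) w / a (m n)| <= eps].
Proof.
move=> e0 eta0.
have D0 : 0 < D.
  rewrite /D ltr_pwDl// !mulr_ge0//; first exact: ltW.
  exact: two_power_kernel_integral_ge0.
pose e3 := eta / 3; have e30 : 0 < e3 by rewrite divr_gt0.
have alpha0 : 0 < alpha := lt_trans ltr01 alpha1.
have [K K0 KD] : exists2 K : R, 0 < K & D * K `^ (- alpha) < e3.
  exists ((2 * D / e3) `^ (alpha^-1)); first by rewrite powR_gt0// divr_gt0// mulr_gt0.
  rewrite -powRrM mulrN mulVf ?gt_eqF// powR_inv1; last by rewrite divr_ge0 ?mulr_ge0// ltW.
  by rewrite (_ : D * _ = e3 / 2); [lra|field; rewrite !gt_eqF].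
pose r := Num.min (1 / 2) (eps / (4 * K)).
have r0 : 0 < r by rewrite /r lt_min !divr_gt0// mulr_gt0.
have r2 : r <= 1 / 2 by rewrite /r ge_min lexx.
have rK : r * K <= eps / 4.
  have -> : eps / 4 = eps / (4 * K) * K by field; rewrite gt_eqF.
  by rewrite ler_pM2r// /r ge_min lexx orbT.
have r1 : r < 1 by lra.
have [del1 /andP[del10 del12] ratio] := a_ratio r0 r1.
pose q := (eps / 8) `^ (- alpha); have q0 : 0 < q by rewrite powR_gt0// divr_gt0.
pose del := Num.min del1 (e3 / (4 * D * q)).
have del0 : 0 < del by rewrite /del lt_min del10 divr_gt0// !mulr_gt0.
have del2 : del <= 1 / 2 by rewrite /del ge_min del12.
have delq : 2 * D * del * q < e3.
  have h : del * (4 * D * q) <= e3.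
    by rewrite -ler_pdivlMr ?mulr_gt0// /del ge_min lexx orbT.
  rewrite (_ : 2 * D * del * q = del * (4 * D * q) / 2); last by field.
  lra.
(* The tolerance on t_n / b_n; the rest of del c is left for the rounding in the
   definition of the central index. *)
pose ti := del * c / 4; have ti0 : 0 < ti by rewrite divr_gt0// mulr_gt0.
pose L n := Num.truncn (del * (m n)%:R).
pose A1 n := [set w | ti < `|(t n w)%:R / (b n)%:R - c|].
pose A2 n := [set w | exists2 k, (k <= m n)%N &
   K * a (m n) <= `|partial_sum Z (0 + k) w - partial_sum Z 0 w|].
pose A3 n := [set w | exists2 k, (k <= (L n).*2)%N & eps / 8 * a (m n) <=
   `|partial_sum Z ((m n - L n) + k) w - partial_sum Z (m n - L n) w|].
have mS k : measurable_fun setT (partial_sum Z k) by exact: measurable_partial_sum.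
have mA1 n : measurable (A1 n).
  apply: measurable_lt_set; apply: measurableT_comp => //; apply: measurable_funB => //.
  apply: measurable_funM => //.
  exact: (@measurable_random_index _ _ _ (fun k _ => k%:R) (t n)).
have mA2 n : measurable (A2 n).
  apply: (@measurable_exists_le _ _ _ (fun k w => partial_sum Z (0 + k) w - partial_sum Z 0 w)).
  by move=> k; exact: measurable_funB.
have mA3 n : measurable (A3 n).
  apply: (@measurable_exists_le _ _ _ (fun k w => partial_sum Z (m n - L n + k) w - partial_sum Z (m n - L n) w)).
  by move=> k; exact: measurable_funB.
have m_y := central_index_cvgy.
have am_y : a (m n) @[n --> \oo] --> +oo by exact: cvg_comp m_y a_y.
have P1 : \forall n \near \oo, fine (P (A1 n)) <= e3.
  have h : fine (P (A1 n)) @[n --> \oo] --> 0 by apply: fine_cvg; exact: tb.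
  exact: (cvgr_le _ h _ e30).
have big u : 0 < u -> \forall n \near \oo, 0 < a (m n) /\ x0 <= u * a (m n).
  move=> u0; move/cvgryPgt : am_y => /(_ (Num.max 0 (x0 / u))); apply: filterS => n.
  by rewrite gt_max ltr_pdivrMr// [_ * u]mulrC => /andP[-> /ltW].
have mH u : 0 < u -> (m n)%:R * H (u * a (m n)) @[n --> \oo] --> u `^ (- alpha).
  by move=> u0; exact: cvg_comp m_y (a_H u0).
have P2 : \forall n \near \oo, fine (P (A2 n)) <= e3.
  have h : D * ((m n)%:R * H (K * a (m n))) @[n --> \oo] --> D * K `^ (- alpha).
    by apply: cvgMr; exact: mH.
  apply: filterS2 (big _ K0) (cvgr_le _ h _ KD) => n [_ xK]; apply: le_trans.
  rewrite mulrA; exact: (increment_maximal indZ idZ delta0 delta1 C0 x00 potter EZ 0 (m n) xK).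
have P3 : \forall n \near \oo, fine (P (A3 n)) <= e3.
  have e8 : 0 < eps / 8 by rewrite divr_gt0.
  have h : 2 * D * del * ((m n)%:R * H (eps / 8 * a (m n))) @[n --> \oo] --> 2 * D * del * q.
    by apply: cvgMr; exact: mH.
  apply: filterS2 (big _ e8) (cvgr_le _ h _ delq) => n [_ xK]; apply: le_trans.
  have := increment_maximal indZ idZ delta0 delta1 C0 x00 potter EZ (m n - L n) (L n).*2 xK.
  move=> /le_trans; apply; rewrite -/D -muln2 natrM.
  rewrite (_ : D * _ * _ = 2 * D * H (eps / 8 * a (m n)) * (L n)%:R); last by rewrite /H; ring.
  rewrite (_ : 2 * D * del * _ = 2 * D * H (eps / 8 * a (m n)) * (del * (m n)%:R)); last by ring.
  rewrite ler_wpM2l//; first by rewrite !mulr_ge0 ?(ltW D0)// fine_ge0.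
  by rewrite truncn_le mulr_ge0// ltW.
have mb : \forall n \near \oo, (0 < b n)%N /\ forall k : nat, `|k%:R / (b n)%:R - c| <= ti ->
    `|k%:R - (m n)%:R : R| <= del * (m n)%:R.
  have /cvgrnyP/cvgryPge/(_ (4 * (1 + del) / (3 * del * c))) := b_y.
  apply: filterS => n bb.
  have b0' : 0 < (b n)%:R :> R by apply: lt_le_trans bb; rewrite divr_gt0 ?mulr_gt0 ?addr_gt0.
  split; [by rewrite -(ltr0n R)|move=> k].
  rewrite ler_pdivrMr ?mulr_gt0// in bb.
  have e : k%:R / (b n)%:R - c = (k%:R - c * (b n)%:R) / (b n)%:R.
    by field; rewrite gt_eqF.
  rewrite e normrM normfV (gtr0_norm b0') ler_pdivrMr// => kc.
  have cb0 : 0 <= c * (b n)%:R by rewrite mulr_ge0// ltW.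
  have /andP[m1 m2] := truncn_itv cb0; rewrite -/(m n) -natr1 in m1 m2.
  have h : del * (c * (b n)%:R - 1) <= del * (m n)%:R by rewrite ler_pM2l//; lra.
  move: kc; rewrite /ti !ler_norml => /andP[? ?]; apply/andP; split; nra.
have ratio' : \forall n \near \oo, forall k, `|k%:R - (m n)%:R : R| <= del * (m n)%:R ->
    `|a k - a (m n)| <= r * a (m n).
  have h : \forall n \near \oo, forall k, `|k%:R - (m n)%:R : R| <= del1 * (m n)%:R ->
      `|a k - a (m n)| <= r * a (m n) by exact: (m_y _ ratio).
  apply: filterS h => n h k kd; apply: h.
  by apply: (le_trans kd); rewrite ler_wpM2r// /del ge_min lexx.
near=> n; exists (A1 n `|` (A2 n `|` A3 n)); split.
- by apply: measurableU => //; exact: measurableU.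
- apply: (le_trans (fine_measureU_le P (mA1 n) (measurableU _ _ (mA2 n) (mA3 n)))).
  rewrite (_ : eta = e3 + (e3 + e3)); last by rewrite /e3; field.
  apply: lerD; first by near: n.
  apply: (le_trans (fine_measureU_le P (mA2 n) (mA3 n))).
  by apply: lerD; near: n.
move=> w nA.
have [am0 _] : 0 < a (m n) /\ x0 <= 1 * a (m n) by near: n; exact: big.
have [_ win] : (0 < b n)%N /\ forall k : nat, `|k%:R / (b n)%:R - c| <= ti ->
    `|k%:R - (m n)%:R : R| <= del * (m n)%:R by near: n.
have rat : forall k, `|k%:R - (m n)%:R : R| <= del * (m n)%:R ->
    `|a k - a (m n)| <= r * a (m n) by near: n.
have n1 : `|(t n w)%:R - (m n)%:R : R| <= del * (m n)%:R.
  by apply: win; rewrite leNgt; apply/negP => h; apply: nA; left.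
have Sm : `|partial_sum Z (m n) w| <= K * a (m n).
  rewrite leNgt; apply/negP => h; apply: nA; right; left; exists (m n) => //.
  by rewrite add0n {2}/partial_sum big_ord0 subr0 ltW.
have dm0 : 0 <= del * (m n)%:R by rewrite mulr_ge0// ltW.
have Lm : (L n <= m n)%N.
  rewrite -(ler_nat R); apply: (@le_trans _ _ (del * (m n)%:R)); first by rewrite truncn_le.
  by rewrite ler_piMl//; lra.
(* Increments are measured from the left end of the window, which covers both
   sides of the central index with one maximal inequality. *)
have inc k : (m n - L n <= k <= m n + L n)%N ->
    `|partial_sum Z k w - partial_sum Z (m n - L n) w| <= eps / 8 * a (m n).
  move=> /andP[k1 k2]; rewrite leNgt; apply/negP => h; apply: nA; right; right.
  exists (k - (m n - L n))%N; first by rewrite leq_subLR -addnn addnA subnK.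
  by rewrite subnKC// ltW.
apply: (ratio_perturbation am0 r0 r2 K0 (rat _ n1) _ Sm rK).
have i1 := inc _ (nat_window dm0 n1).
have i2 : `|partial_sum Z (m n) w - partial_sum Z (m n - L n) w| <= eps / 8 * a (m n).
  by apply: inc; rewrite leq_subr leq_addr.
move: i1 i2; rewrite !ler_norml => /andP[? ?] /andP[? ?]; apply/andP; split; lra.
Unshelve. all: by end_near. Qed.

End random_index_close.

(** * Transfer of limits and regularly varying tails *)

Section close_means.
Context {R : realType} {d : measure_display} {T : measurableType d} (P : probability T R).

(** Off A the difference of the values of g is at most l e, and on A at most 2. *)
Lemma lipschitz_mean_close (g : R -> R) (l : R) (X Y : T -> R) (A : set T) (e : R) :
  0 <= l -> (forall x y, `|g x - g y| <= l * `|x - y|) -> (forall x, `|g x| <= 1) ->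
  measurable_fun setT (g \o X) -> measurable_fun setT (g \o Y) -> measurable A ->
  0 <= e -> (forall w, ~ A w -> `|X w - Y w| <= e) ->
  `|\int[P]_w g (X w) - \int[P]_w g (Y w)| <= l * e + 2 * fine (P A).
Proof.
move=> l0 gl g1 mX mY mA e0 XY.
have IX := bounded_integrable P mX (fun w => g1 (X w)).
have IY := bounded_integrable P mY (fun w => g1 (Y w)).
have Ic : P.-integrable setT (EFin \o (fun _ : T => l * e)) by exact: finite_measure_integrable_cst.
have I2 : P.-integrable setT (EFin \o (fun w => 2 * \1_A w)).
  by apply: RintegrableZl => //; exact: integrable_indic.
rewrite -(Rintegral_indic P mA) -(Rintegral_cstP P (l * e)) -RintegralZl//; last exact: integrable_indic.
rewrite -RintegralB// -RintegralD//.
apply: le_trans (le_normr_Rintegral _ (RintegrableB measurableT IX IY)) _ => //.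
apply: le_Rintegral => //.
- by apply: integrable_norm => //; exact: RintegrableB.
- exact: RintegrableD.
move=> w _; rewrite indicE; have [Aw|nA] := pselect (A w).
  rewrite mem_set// mulr1; apply: (le_trans (ler_normB _ _)).
  by apply: (@le_trans _ _ 2); [exact: (lerD (g1 _) (g1 _))|rewrite lerDr mulr_ge0].
rewrite memNset// mulr0 addr0; apply: (le_trans (gl _ _)); exact: ler_wpM2l (XY _ nA).
Qed.

Lemma close_means_cvg (g : R -> R) (l lim : R) (X Y : nat -> T -> R) :
  0 <= l -> (forall x y, `|g x - g y| <= l * `|x - y|) -> (forall x, `|g x| <= 1) ->
  (forall n, measurable_fun setT (g \o X n)) -> (forall n, measurable_fun setT (g \o Y n)) ->
  (forall eps eta : R, 0 < eps -> 0 < eta -> \forall n \near \oo,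
     exists A, [/\ measurable A, fine (P A) <= eta & forall w, ~ A w -> `|X n w - Y n w| <= eps]) ->
  \int[P]_w g (Y n w) @[n --> \oo] --> lim ->
  \int[P]_w g (X n w) @[n --> \oo] --> lim.
Proof.
move=> l0 gl g1 mX mY XY Ylim; apply/cvgrPdist_le => e e0.
have e1 : 0 < e / (4 * (l + 1)) by rewrite divr_gt0// mulr_gt0// ltr_wpDl.
have e2 : 0 < e / 8 by rewrite divr_gt0.
have e3 : 0 < e / 4 by rewrite divr_gt0.
have le1 : l * (e / (4 * (l + 1))) <= e / 4.
  rewrite (_ : l * _ = e / 4 * (l / (l + 1))); last by field; rewrite gt_eqF// ltr_wpDl.
  by rewrite (ler_piMr (ltW e3))// ler_pdivrMr ?mul1r ?lerDl// ltr_wpDl.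
move/cvgrPdist_le : Ylim => /(_ _ e3); apply: filterS2 (XY _ _ e1 e2) => n [A [mA PA XYA]] h.
have := lipschitz_mean_close l0 gl g1 (mX n) (mY n) mA (ltW e1) XYA.
move: h; rewrite !ler_norml => /andP[? ?] /andP[? ?]; apply/andP; split; lra.
Qed.

End close_means.

Section tail.
Context {R : realType} (H L : R -> R) (alpha : R).
Context (H_ge0 : forall x, 0 <= H x) (H_noninc : forall x y, x <= y -> H y <= H x).
Context (L_slow : slowly_varying L).
Context (HL : H x / (x `^ (- alpha) * L x) @[x --> +oo] --> (1 : R)).

(** H does not vanish near infinity since a ratio with numerator H has limit 1, and
    H is nonincreasing. *)
Lemma regular_tail_gt0 x : 0 < H x.
Proof.
have := cvgr_gt _ HL _ ltr01 => -[M [_ h]].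
pose y := Num.max (M + 1) x.
have My : M < y by rewrite /y lt_max ltrDl ltr01.
have := h _ My; have xy : x <= y by rewrite /y le_max lexx orbT.
move=> Hy; apply: lt_le_trans (H_noninc xy); rewrite lt_neqAle H_ge0 andbT.
by apply/eqP => H0; move: Hy; rewrite -H0 mul0r ltxx.
Qed.

Lemma regular_tail_ratio (l : R) : 0 < l -> H (l * x) / H x @[x --> +oo] --> l `^ (- alpha).
Proof.
move=> l0; have [_ L0 Ls] := L_slow.
have lxy : l * x @[x --> +oo] --> (+oo : set_system R).
  apply/cvgryPgt => A; near=> x; rewrite mulrC -ltr_pdivrMr//.
  by near: x; apply: nbhs_pinfty_gt; exact: num_real.
have h1 := cvg_comp _ _ lxy HL.
pose f x := H (l * x) / ((l * x) `^ (- alpha) * L (l * x)).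
pose g x := H x / (x `^ (- alpha) * L x).
have h2 : f x * (L (l * x) / L x) / g x * l `^ (- alpha) @[x --> +oo] --> l `^ (- alpha).
  rewrite -[X in _ --> X]mul1r; apply: cvgMl.
  rewrite -[X in _ --> X]divr1; apply: cvgM; last by apply: cvgV => //; exact: oner_neq0.
  by rewrite -[X in _ --> X]mul1r; apply: cvgM => //; exact: Ls.
apply: (near_eq_limit _ h2); near=> x.
have x0 : 0 < x by near: x; apply: nbhs_pinfty_gt; exact: num_real.
have lx0 : 0 < l * x by rewrite mulr_gt0.
rewrite /f /g powRM ?ltW//; field.
by rewrite !gt_eqF ?powR_gt0 ?L0 ?regular_tail_gt0.
Unshelve. all: by end_near. Qed.

Lemma norming_cvg1 (a : nat -> R) : a n @[n --> \oo] --> +oo ->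
  n%:R * a n `^ (- alpha) * L (a n) @[n --> \oo] --> (1 : R) ->
  n%:R * H (a n) @[n --> \oo] --> (1 : R).
Proof.
move=> a_y aL; have [_ L0 _] := L_slow.
have h := cvgM aL (cvg_comp _ _ a_y HL); rewrite mulr1 in h.
apply: (near_eq_limit _ (h _)).
move/cvgryPgt : a_y => /(_ 0); apply: filterS => n an /=.
by field; rewrite !gt_eqF ?powR_gt0 ?L0.
Qed.

End tail.

(** * The random-index limit theorem *)

Unset Implicit Arguments.

Theorem theorem2p2 (R : realType) (d : measure_display) (T : measurableType d)
    (P : probability T R) (Z : nat -> {RV P >-> R})
    (alpha : R) (L : R -> R) (p q : R)
    (t : nat -> {RV P >-> nat}) (b : nat -> nat) (c : R) (a : nat -> R)
    (d' : measure_display) (T' : measurableType d') (P' : probability T' R)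
    (S : {RV P' >-> R}) :
  mutually_independent Z ->
  identically_distributed Z ->
  1 < alpha -> alpha < 2 ->
  slowly_varying L ->
  fine (P [set w | x < `|Z 0%N w|]) / (x `^ (- alpha) * L x)
    @[x --> +oo] --> (1 : R) ->
  ('E_P[Z 0%N] = 0)%E ->
  0 <= p <= 1 ->
  0 <= q <= 1 ->
  fine (P [set w | x < Z 0%N w]) / fine (P [set w | x < `|Z 0%N w|])
    @[x --> +oo] --> p ->
  fine (P [set w | Z 0%N w < - x]) / fine (P [set w | x < `|Z 0%N w|])
    @[x --> +oo] --> q ->
  (forall n w, (0 < t n w)%N) ->
  (forall n, (0 < b n)%N) ->
  0 < c ->
  cvg_in_probability P (fun n w => (t n w)%:R / (b n)%:R) c ->
  b n @[n --> \oo] --> \oo ->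
  a n @[n --> \oo] --> +oo ->
  n%:R * a n `^ (- alpha) * L (a n) @[n --> \oo] --> (1 : R) ->
  (forall s : R, charfun S s = stable_charfun alpha (p - q) s) ->
  cvg_in_distribution P (fun n w => partial_sum Z (t n w) w / a (t n w)) S.
Proof.
move=> indZ idZ alpha1 alpha2 L_slow HL EZ p01 q01 Zp Zq t0 b0 c0 tb b_y a_y aL charS.
pose H (x : R) := fine (P [set w | x < `|Z 0%N w|]).
have mabs : measurable_fun setT (fun w => `|Z 0%N w|) by exact: measurableT_comp.
have mtail x : measurable [set w | x < `|Z 0%N w|] by exact: measurable_lt_set.
have H_ge0 x : 0 <= H x by exact: fine_ge0.
have H_le1 x : H x <= 1 by exact: fine_probability_le1.
have H_noninc x y : x <= y -> H y <= H x.
  by move=> xy; apply: fine_le_measure => // w /=; exact: le_lt_trans.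
have H_gt0 := regular_tail_gt0 H_ge0 H_noninc HL.
have H_rv := regular_tail_ratio H_ge0 H_noninc L_slow HL.
have nH : n%:R * H (a n) @[n --> \oo] --> (1 : R) := norming_cvg1 L_slow HL a_y aL.
have [delta [C [x0 [/andP[delta0 delta1] C0 x00 potter]]]] :=
  potter_bound alpha1 alpha2 H_gt0 H_le1 H_noninc H_rv.
have a_H u : 0 < u -> n%:R * H (u * a n) @[n --> \oo] --> u `^ (- alpha).
  by move=> u0; exact: (norming_tail H_gt0 H_rv a_y nH u0).
have a_ratio := @norming_ratio R H alpha alpha1 H_gt0 H_noninc H_rv a a_y nH.
have IZ := regular_tail_integrable (Z := Z) delta0 delta1 C0 x00 potter.
have EZ0 : \int[P]_w Z 0%N w = 0 by rewrite /Rintegral -expectation_def EZ.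
have pq1 : p + q = 1.
  (* The two one-sided tails add up to the tail of |Z|. *)
  pose G (x : R) := fine (P [set w | x < Z 0%N w]) / H x + fine (P [set w | Z 0%N w < - x]) / H x.
  have Gpq : G x @[x --> +oo] --> p + q by exact: (cvgD Zp Zq).
  have G1 : G x @[x --> +oo] --> (1 : R).
    apply: (near_eq_limit (g := fun=> 1)); last exact: cvg_cst.
    near=> x; have x0' : 0 <= x by near: x; apply: nbhs_pinfty_ge; exact: num_real.
    have mp : measurable [set w | x < Z 0%N w] by exact: measurable_lt_set.
    have mn : measurable [set w | Z 0%N w < - x] by exact: measurable_gt_set.
    rewrite /G -mulrDl -fineD ?fin_num_measure// -measureU//; last first.
      by apply/seteqP; split => w //= [h1 h2]; lra.
    rewrite (_ : _ `|` _ = [set w | x < `|Z 0%N w|]) ?divff ?gt_eqF//.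
      exact: H_gt0.
    apply/seteqP; split => w /=; rewrite ltr_normr ltrNr.
      by move=> [->//|->]; rewrite orbT.
    by move/orP.
  by rewrite -(cvg_lim _ Gpq)//; apply/cvg_lim.
have Y_lim := normalized_sum_charfun_cvg indZ idZ alpha1 alpha2 delta0 delta1 C0 x00
  potter H_gt0 a_y a_H pq1 IZ EZ0 Zp Zq.
have m_y := central_index_cvgy c0 b_y.
have close := random_index_close alpha1 indZ idZ delta0 delta1 C0 x00 potter EZ a_y a_H a_ratio c0 tb b_y.
pose X n w := partial_sum Z (t n w) w / a (t n w).
have mS k : measurable_fun setT (fun w => partial_sum Z k w / a k).
  by apply: measurable_funM => //; exact: measurable_partial_sum.
have mX n : measurable_fun setT (X n).
  exact: (measurable_random_index (F := fun k w => partial_sum Z k w / a k) (measurable_funPT (t n)) mS).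
have mY := measurable_funPT S.
have scale (g : R -> R) : (forall x y, `|g x - g y| <= `|x - y|) ->
    forall s x y, `|g (s * x) - g (s * y)| <= `|s| * `|x - y|.
  by move=> gl s x y; apply: le_trans (gl _ _) _; rewrite -mulrBr normrM.
have cosXS s : \int[P]_w cos (s * X n w) @[n --> \oo] --> \int[P']_w cos (s * S w).
  rewrite (_ : \int[P']_w _ = complex.Re (charfun S s)); last first.
    by rewrite /charfun/= expectation.unlock.
  rewrite charS; have [h _] := Y_lim s.
  apply: (close_means_cvg (g := fun x => cos (s * x)) (normr_ge0 s) (scale _ (@cos_lipschitz R) s) _ _ _ close).
  - by move=> x; exact: cos_max.
  - by move=> n; apply: measurableT_comp (mX n); exact: measurable_cos_scale.
  - by move=> n; apply: measurableT_comp (mS _); exact: measurable_cos_scale.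
  - exact: cvg_comp m_y h.
have sinXS s : \int[P]_w sin (s * X n w) @[n --> \oo] --> \int[P']_w sin (s * S w).
  rewrite (_ : \int[P']_w _ = complex.Im (charfun S s)); last first.
    by rewrite /charfun/= expectation.unlock.
  rewrite charS; have [_ h] := Y_lim s.
  apply: (close_means_cvg (g := fun x => sin (s * x)) (normr_ge0 s) (scale _ (@sin_lipschitz R) s) _ _ _ close).
  - by move=> x; exact: sin_max.
  - by move=> n; apply: measurableT_comp (mX n); exact: measurable_sin_scale.
  - by move=> n; apply: measurableT_comp (mS _); exact: measurable_sin_scale.
  - exact: cvg_comp m_y h.
move=> f cf [M fM].
have lim := levy_continuity mX mY cosXS sinXS cf fM.
have mf : measurable_fun setT f by exact: continuous_measurable_fun.
have E d0 (T0 : measurableType d0) (Q : probability T0 R) (V : T0 -> R) : measurable_fun setT V ->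
    ('E_Q[f \o V])%E = (\int[Q]_w f (V w))%:E.
  move=> mV; rewrite expectation.unlock Rintegral_EFin//.
  exact: (bounded_integrable Q (measurableT_comp mf mV) (fun w => fM (V w))).
rewrite E//; under eq_fun => n do rewrite (E _ _ P _ (mX n)).
by apply: cvg_EFin => //; exact: nearW.
Unshelve. all: by end_near. Qed.
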